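(* For every $\varepsilon>0$ and every $g>1$, the system of ordinary differential equations $$\frac{d^{4}A_{0}}{dx^{4}} = A_{0}\,(1-|A_{0}|^{2}-g|B_{0}|^{2}),\qquad \frac{d^{2}B_{0}}{dx^{2}} = \varepsilon^{2}B_{0}\,(-1+g|A_{0}|^{2}+|B_{0}|^{2}),\qquad x\in\mathbb{R},$$ possesses a smooth real-valued heteroclinic solution $(A_0,B_0)=(A_{\varepsilon,g},B_{\varepsilon,g})$, where $A_{\varepsilon,g},B_{\varepsilon,g}:\mathbb{R}\to\mathbb{R}$, such that the family $(A_{\varepsilon,g},B_{\varepsilon,g})_{\varepsilon>0,\,g>1}$ has the following properties: (1) for all $\varepsilon>0$ and $g>1$, $\lim_{x\to-\infty}(A_{\varepsilon,g}(x),B_{\varepsilon,g}(x))=(1,0)$ and $\lim_{x\to+\infty}(A_{\varepsilon,g}(x),B_{\varepsilon,g}(x))=(0,1)$; (2) for all $\varepsilon>0$ and $g>1$, $B_{\varepsilon,g}(x)\geq 0$ for all $x\in\mathbb{R}$; (3) for each fixed $\varepsilon>0$, $\displaystyle\lim_{g\to 1^+}\ \sup_{x\in\mathbb{R}}\left|A_{\varepsilon,g}(x)^2+B_{\varepsilon,g}(x)^2-1\right|=0.$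
   Context: In general, the unknowns $A_0,B_0$ of the system are complex-valued functions on $\mathbb{R}$; the solutions asserted here are real-valued. ''Heteroclinic solution'' means a solution defined on all of $\mathbb{R}$ that connects the two equilibria $(A_0,B_0)=(1,0)$ (as $x\to-\infty$) and $(A_0,B_0)=(0,1)$ (as $x\to+\infty$) of the system, in the sense of property (1). ''Smooth'' means $C^\infty$. *)

(* Defs.v *)
From Stdlib Require Export Reals.
From Coquelicot Require Export Coquelicot.
Open Scope R_scope.

Definition smooth (f : R -> R) : Prop :=
  forall (n : nat) (x : R), ex_derive_n f n x.

(* [Derive_n] is a total operator, so this is meaningful only together with
   the differentiability supplied by [smooth]. *)
Definition solves_system (eps g : R) (A B : R -> R) : Prop :=
  forall x : R,
    Derive_n A 4 x = A x * (1 - Rabs (A x) ^ 2 - g * Rabs (B x) ^ 2) /\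
    Derive_n B 2 x =
      eps ^ 2 * (B x * (- 1 + g * Rabs (A x) ^ 2 + Rabs (B x) ^ 2)).

Definition connects_equilibria (A B : R -> R) : Prop :=
  filterlim (fun x : R => (A x, B x))
    (Rbar_locally m_infty) (locally (1, 0)) /\
  filterlim (fun x : R => (A x, B x))
    (Rbar_locally p_infty) (locally (0, 1)).

Definition smooth_heteroclinic_solution (eps g : R) (A B : R -> R) : Prop :=
  smooth A /\ smooth B /\ solves_system eps g A B /\ connects_equilibria A B.

(* Supremum over the whole line, in the extended reals. *)
Definition sup_line (f : R -> R) : Rbar :=
  Lub_Rbar (fun y : R => exists x : R, y = f x).

(* Convergence to the real [l] of an extended-real-valued [F g] as g -> 1+.
   The finiteness clause is needed because [real] sends infinities to 0. *)
Definition lim_one_right (F : R -> Rbar) (l : R) : Prop :=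
  at_right 1 (fun g : R => is_finite (F g)) /\
  filterlim (fun g : R => real (F g)) (at_right 1) (locally l).

(* Main.v *)
Require Import Defs.
From Stdlib Require Import Lra Lia Psatz Classical IndefiniteDescription Cantor ZArith.

(** The system is the Euler-Lagrange system of the energy
    E(A, B) = int A''^2 / 2 + B'^2 / (2 eps^2) + W(A, B),
    W(a, b) = (a^2 + b^2 - 1)^2 / 4 + (g - 1) a^2 b^2 / 2 >= 0,
    whose wells W = 0 are (+-1, 0) and (0, +-1). Take a minimizing sequence
    among C^2 x C^1 profiles equal to (1, 0) far on the left and to (0, 1) far on
    the right, with B >= 0 (a smoothed |B| does not raise the energy much) and
    translated so that B = 1/2 at 0. Bounded energy gives uniform bounds and
    equicontinuity, so a subsequence converges locally uniformly. Almost
    minimality makes the first variation tend to 0; after moving all derivatives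
    onto the test functions, the limit solves the equations weakly, hence
    classically by du Bois-Reymond, and is smooth. No weak convergence of
    derivatives is needed. The potential energy of the limit is finite, so the
    limit tends to a well at both ends. If it tended to (+-1, 0) at +infinity,
    one could cut the profile there, restart from (1, 0) after a reflection, and
    save the energy spent near B = 1/2, contradicting minimality; the same
    argument excludes (0, 1) at -infinity. Finally A -> -A fixes the sign.
    For (3), trial profiles (cos, sin)(theta(x / L)) show that the infimum
    tends to 0 as g -> 1, and small energy forces A^2 + B^2 uniformly close
    to 1. *)

(** * Continuous functions and their integrals *)

(** The obstacle is loss of compactness: a minimizing sequence may converge locally to a profile
    with a wrong end while the rest of the transition drifts to infinity. The limit is never shown
    to be a minimizer. Every comparison is made on a member [p n] of the sequence, whose energy is
    within [(/ (INR n + 1)) ^ 2] of the infimum; closeness of the limit to a well on a far but fixed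
    window passes to [p n] by locally uniform convergence. The normalization B = 1/2 at 0 ensures
    that the discarded piece carries a fixed amount of energy. The sign condition on B removes the
    well (0, -1), while (-1, 0) has to be handled by reflection. For (3) the constants must not
    depend on g. The first term of W alone bounds the amplitudes and measures the distance to the
    circle, so [a_priori] and [low_energy_near_sphere] are uniform in g; g > 1 is used to isolate
    the wells, with constants that degenerate as g tends to 1. *)

Definition Cont (f : R -> R) : Prop := forall x, continuous f x.

Lemma Cont_const (c : R) : Cont (fun _ => c).
Proof. intros x; apply continuous_const. Qed.

Lemma Cont_id : Cont (fun x => x).
Proof. intros x; apply continuous_id. Qed.

Lemma Cont_plus (f h : R -> R) : Cont f -> Cont h -> Cont (fun x => f x + h x).
Proof. intros F H x; apply (continuous_plus f h); auto. Qed.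

Lemma Cont_opp (f : R -> R) : Cont f -> Cont (fun x => - f x).
Proof. intros F x; apply (continuous_opp f); auto. Qed.

Lemma Cont_minus (f h : R -> R) : Cont f -> Cont h -> Cont (fun x => f x - h x).
Proof. intros F H x; apply (continuous_minus f h); auto. Qed.

Lemma Cont_mult (f h : R -> R) : Cont f -> Cont h -> Cont (fun x => f x * h x).
Proof. intros F H x; apply (continuous_mult f h); auto. Qed.

Lemma Cont_pow (f : R -> R) (n : nat) : Cont f -> Cont (fun x => f x ^ n).
Proof.
  intros F; induction n as [|n IH]; simpl.
  - apply Cont_const.
  - now apply Cont_mult.
Qed.

Lemma Cont_div (f : R -> R) (c : R) : Cont f -> Cont (fun x => f x / c).
Proof. intros F; apply Cont_mult; [assumption | apply Cont_const]. Qed.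

Lemma Cont_comp (f h : R -> R) : Cont f -> Cont h -> Cont (fun x => h (f x)).
Proof. intros F H x; apply (continuous_comp f h); auto. Qed.

Lemma Cont_Rabs (f : R -> R) : Cont f -> Cont (fun x => Rabs (f x)).
Proof. intros F; apply (Cont_comp f Rabs F); intro x; apply continuous_Rabs. Qed.

Lemma Cont_derive (f f' : R -> R) : (forall x, is_derive f x (f' x)) -> Cont f.
Proof. intros H x; apply (@ex_derive_continuous R_AbsRing R_NormedModule); exists (f' x); apply H. Qed.

Lemma Cont_eps (f : R -> R) :
  (forall x e, 0 < e -> exists d, 0 < d /\
     forall y, Rabs (y - x) < d -> Rabs (f y - f x) < e) -> Cont f.
Proof.
  intros H x P [e He].
  destruct (H x e (cond_pos e)) as [d [Hd Hy]].
  exists (mkposreal d Hd); intros y By; apply He, Hy, By.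
Qed.

Create HintDb cont.
#[export] Hint Resolve Cont_const Cont_id Cont_plus Cont_opp Cont_minus Cont_mult
  Cont_pow Cont_div Cont_Rabs : cont.
Ltac cont := auto 20 with cont.

(* Fixes the codomain of [RInt] to the plain type [R], for [ring] and [lra]. *)
Definition Int (f : R -> R) (a b : R) : R := RInt f a b.

Lemma int_ex (f : R -> R) (a b : R) : Cont f -> ex_RInt f a b.
Proof. intros F; apply (@ex_RInt_continuous R_CompleteNormedModule); auto. Qed.

Lemma int_plus (f h : R -> R) (a b : R) : Cont f -> Cont h ->
  Int (fun x => f x + h x) a b = Int f a b + Int h a b.
Proof. intros; apply (@RInt_plus R_CompleteNormedModule); now apply int_ex. Qed.

Lemma int_minus (f h : R -> R) (a b : R) : Cont f -> Cont h ->
  Int (fun x => f x - h x) a b = Int f a b - Int h a b.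
Proof. intros; apply (@RInt_minus R_CompleteNormedModule); now apply int_ex. Qed.

Lemma int_scal (f : R -> R) (c a b : R) : Cont f ->
  Int (fun x => c * f x) a b = c * Int f a b.
Proof. intros; apply (@RInt_scal R_CompleteNormedModule); now apply int_ex. Qed.

Lemma int_const (c a b : R) : Int (fun _ => c) a b = (b - a) * c.
Proof. apply (@RInt_const R_CompleteNormedModule). Qed.

Lemma int_chasles (f : R -> R) (a b c : R) : Cont f ->
  Int f a b + Int f b c = Int f a c.
Proof. intros; apply (@RInt_Chasles R_CompleteNormedModule); now apply int_ex. Qed.

Lemma int_ext (f h : R -> R) (a b : R) : a <= b ->
  (forall x, a < x < b -> f x = h x) -> Int f a b = Int h a b.
Proof.
  intros ab H; unfold Int; apply RInt_ext; intros x.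
  rewrite Rmin_left, Rmax_right; auto.
Qed.

Lemma int_le (f h : R -> R) (a b : R) : a <= b -> Cont f -> Cont h ->
  (forall x, a < x < b -> f x <= h x) -> Int f a b <= Int h a b.
Proof. intros; unfold Int; apply RInt_le; auto using int_ex. Qed.

Lemma int_ge0 (f : R -> R) (a b : R) : a <= b -> Cont f ->
  (forall x, a < x < b -> 0 <= f x) -> 0 <= Int f a b.
Proof.
  intros ab F H; pose proof (int_const 0 a b) as E; rewrite Rmult_0_r in E; rewrite <- E.
  apply int_le; cont.
Qed.

Lemma int_mono (f : R -> R) (a b a' b' : R) : Cont f -> (forall x, 0 <= f x) ->
  a' <= a -> a <= b -> b <= b' -> Int f a b <= Int f a' b'.
Proof.
  intros F P H1 H2 H3.
  rewrite <- (int_chasles f a' a b' F), <- (int_chasles f a b b' F).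
  pose proof (int_ge0 f a' a H1 F (fun x _ => P x)).
  pose proof (int_ge0 f b b' H3 F (fun x _ => P x)).
  lra.
Qed.

Lemma int_derive (f f' : R -> R) (a b : R) :
  (forall x, is_derive f x (f' x)) -> Cont f' -> Int f' a b = f b - f a.
Proof.
  intros D C; apply is_RInt_unique.
  apply (is_RInt_derive f f'); auto.
Qed.

Lemma derive_mult (f h : R -> R) (x f' h' : R) :
  is_derive f x f' -> is_derive h x h' ->
  is_derive (fun y => f y * h y) x (f' * h x + f x * h').
Proof.
  intros F H; apply (is_derive_mult f h x f' h' F H).
  intros; apply Rmult_comm.
Qed.

Lemma derive_plus (f h : R -> R) (x f' h' : R) :
  is_derive f x f' -> is_derive h x h' -> is_derive (fun y => f y + h y) x (f' + h').
Proof. intros; now apply (is_derive_plus f h). Qed.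

Lemma int_parts (f f' h h' : R -> R) (a b : R) :
  (forall x, is_derive f x (f' x)) -> (forall x, is_derive h x (h' x)) ->
  Cont f' -> Cont h' ->
  Int (fun x => f' x * h x) a b
    = f b * h b - f a * h a - Int (fun x => f x * h' x) a b.
Proof.
  intros F H CF CH.
  pose proof (Cont_derive f f' F) as C1.
  pose proof (Cont_derive h h' H) as C2.
  rewrite <- (int_derive (fun x => f x * h x) (fun x => f' x * h x + f x * h' x)).
  - rewrite int_plus by cont; ring.
  - intro x; now apply derive_mult.
  - cont.
Qed.

Lemma int_abs_le (f : R -> R) (C a b : R) : a <= b -> Cont f ->
  (forall x, a < x < b -> Rabs (f x) <= C) -> Rabs (Int f a b) <= (b - a) * C.
Proof.
  intros ab F H.
  assert (Int f a b <= Int (fun _ => C) a b).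
  { apply int_le; cont. intros x Hx; specialize (H x Hx).
    apply Rabs_le_between in H; lra. }
  assert (Int (fun _ => - C) a b <= Int f a b).
  { apply int_le; cont. intros x Hx; specialize (H x Hx).
    apply Rabs_le_between in H; lra. }
  rewrite int_const in *; apply Rabs_le_between; lra.
Qed.

Lemma prim_derive (f : R -> R) (a x : R) : Cont f ->
  is_derive (fun y => Int f a y) x (f x).
Proof.
  intros F; unfold Int; apply (is_derive_RInt f (fun y => RInt f a y) a x).
  - exists (mkposreal 1 Rlt_0_1); intros y _.
    apply (@RInt_correct R_CompleteNormedModule), int_ex, F.
  - apply F.
Qed.

Lemma Cont_prim (f : R -> R) (a : R) : Cont f -> Cont (fun y => Int f a y).
Proof. intros F; apply (Cont_derive _ f); intro x; now apply prim_derive. Qed.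

Lemma int_zero_pos (f : R -> R) (a b x : R) : Cont f -> (forall y, 0 <= f y) ->
  Int f a b <= 0 -> a < x < b -> f x = 0.
Proof.
  intros F P H Hx.
  destruct (Rle_lt_or_eq_dec 0 (f x) (P x)) as [L|]; [exfalso|auto].
  destruct (F x (fun z => f x / 2 < z)) as [d Hd].
  { exists (mkposreal (f x / 2) ltac:(lra)); intros y By.
    change (Rabs (y - f x) < f x / 2) in By.
    apply Rabs_lt_between in By; lra. }
  pose proof (cond_pos d) as Hdp.
  (* A right half-neighbourhood of [x], shortened to stay inside [[a, b]]; there [f] exceeds
     [f x / 2]. *)
  set (e := Rmin (d / 2) (b - x)).
  assert (0 < e) by (apply Rmin_glb_lt; lra).
  assert (e <= d / 2) by apply Rmin_l.
  assert (e <= b - x) by apply Rmin_r.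
  assert (Int (fun _ => f x / 2) x (x + e) <= Int f x (x + e)).
  { apply int_le; cont; [lra|]. intros y Hy; left; apply Hd.
    change (Rabs (y - x) < d); apply Rabs_lt_between; lra. }
  rewrite int_const in H3.
  assert (Int f x (x + e) <= Int f a b) by (apply int_mono; auto; lra).
  nra.
Qed.

#[export] Hint Resolve Cont_prim : cont.

(** * Test functions and the lemma of du Bois-Reymond *)

(* Continuous, supported in [-r, r], with [k] vanishing moments: exactly the
   k-th derivatives of the C^k functions supported in [-r, r]. *)
Definition test (r : R) (k : nat) (rho : R -> R) : Prop :=
  Cont rho /\ (forall x, r <= Rabs x -> rho x = 0) /\
  forall j, (j < k)%nat -> Int (fun x => rho x * x ^ j) (- r) r = 0.

Definition prim (r : R) (rho : R -> R) (x : R) : R := Int rho (- r) x.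

(** Stated for endpoints in either order, since [prim r rho x] with [x < - r] integrates
    backwards. *)
Lemma int_vanish (f : R -> R) (a b : R) :
  (forall x, Rmin a b < x < Rmax a b -> f x = 0) -> Int f a b = 0.
Proof.
  intros H; unfold Int; rewrite (RInt_ext f (fun _ => 0)) by auto.
  fold (Int (fun _ => 0) a b); rewrite int_const; ring.
Qed.

Lemma derive_pow_over (j : nat) (x : R) :
  is_derive (fun y => y ^ S j / INR (S j)) x (x ^ j).
Proof.
  pose proof (lt_0_INR (S j) ltac:(lia)).
  auto_derive; auto.
  simpl pred; change (1 * (INR (S j) * x ^ j) * / INR (S j) = x ^ j); field; lra.
Qed.

Lemma prim_is_derive (r : R) (k : nat) (rho : R -> R) (x : R) :
  test r k rho -> is_derive (prim r rho) x (rho x).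
Proof. intros [C _]; now apply prim_derive. Qed.

(** The vanishing zeroth moment makes the primitive vanish beyond [r]. The moment of order [j] of
    the primitive becomes, by parts, a multiple of the moment of order [S j] of [rho], which is why
    one moment is lost. *)
Lemma prim_test (r : R) (k : nat) (rho : R -> R) :
  0 < r -> test r (S k) rho -> test r k (prim r rho).
Proof.
  intros Hr T; pose proof T as (C & Z & M).
  assert (E : forall x, r <= Rabs x -> prim r rho x = 0).
  { intros x Hx; unfold prim.
    destruct (Rle_dec 0 x) as [P|P].
    - rewrite Rabs_right in Hx by lra.
      rewrite <- (int_chasles rho (- r) r x C), (int_vanish rho r x).
      + rewrite Rplus_0_r, <- (M 0%nat ltac:(lia)).
        apply int_ext; [lra|]; intros; simpl; ring.
      + intros y; rewrite Rmin_left, Rmax_right by lra.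
        intros; apply Z; rewrite Rabs_right; lra.
    - rewrite Rabs_left in Hx by lra.
      apply int_vanish; intros y; rewrite Rmin_right, Rmax_left by lra.
      intros; apply Z; rewrite Rabs_left; lra. }
  split; [now apply Cont_prim|]; split; [exact E|].
  intros j Hj.
  assert (P := int_parts (prim r rho) rho (fun y => y ^ S j / INR (S j))
    (fun y => y ^ j) (- r) r (fun x => prim_is_derive r (S k) rho x T)
    (derive_pow_over j) C ltac:(cont)).
  cbv beta in P.
  rewrite (E r), (E (- r)) in P by (rewrite ?Rabs_Ropp, Rabs_right; lra).
  assert (Q : Int (fun x => rho x * (x ^ S j / INR (S j))) (- r) r = 0).
  { rewrite (int_ext _ (fun x => / INR (S j) * (rho x * x ^ S j))); [|lra|].
    - rewrite int_scal by cont; rewrite (M (S j)) by lia; ring.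
    - intros; unfold Rdiv; ring. }
  lra.
Qed.

Fixpoint polyval (c : nat -> R) (k : nat) (x : R) : R :=
  match k with 0%nat => 0 | S k => polyval c k x + c k * x ^ k end.

Lemma polyval_ext (c d : nat -> R) (k : nat) (x : R) :
  (forall j, (j < k)%nat -> c j = d j) -> polyval c k x = polyval d k x.
Proof.
  induction k as [|k IH]; simpl; intros H; [reflexivity|].
  rewrite IH, (H k) by auto; reflexivity.
Qed.

Lemma polyval_minus (c d : nat -> R) (t : R) (k : nat) (x : R) :
  polyval (fun j => c j - t * d j) k x = polyval c k x - t * polyval d k x.
Proof. induction k as [|k IH]; simpl; [ring|]; rewrite IH; ring. Qed.

Lemma Cont_polyval (c : nat -> R) (k : nat) : Cont (polyval c k).
Proof.
  induction k as [|k IH]; simpl; [apply Cont_const|].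
  apply (Cont_plus (polyval c k) (fun x => c k * x ^ k)); cont.
Qed.
#[export] Hint Resolve Cont_polyval : cont.

Lemma int_polyval_zero (f : R -> R) (c : nat -> R) (k : nat) (a b : R) : Cont f ->
  (forall j, (j < k)%nat -> Int (fun x => f x * x ^ j) a b = 0) ->
  Int (fun x => f x * polyval c k x) a b = 0.
Proof.
  intros F; induction k as [|k IH]; intros H; simpl.
  - apply int_vanish; intros; ring.
  - transitivity (Int (fun x => f x * polyval c k x + c k * (f x * x ^ k)) a b).
    + unfold Int; apply RInt_ext; intros; simpl; ring.
    + rewrite int_plus, int_scal, IH, (H k) by (auto with arith; cont); ring.
Qed.

(* Gram-Schmidt for the weight [chi]: no independence of the monomials is
   needed, because a new direction of norm zero is orthogonal to everything. *)
Lemma weighted_projection (chi : R -> R) (a b : R) (k : nat) : a <= b ->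
  Cont chi -> (forall x, 0 <= chi x) -> forall w, Cont w ->
  exists c, forall j, (j < k)%nat ->
    Int (fun x => chi x * (w x - polyval c k x) * x ^ j) a b = 0.
Proof.
  intros ab Cchi Pchi; induction k as [|k IH]; intros w Cw.
  - exists (fun _ => 0); intros; lia.
  - destruct (IH w Cw) as [c Hc].
    destruct (IH (fun x => x ^ k) ltac:(cont)) as [d Hd].
    set (e := fun x => x ^ k - polyval d k x).
    assert (Ce : Cont e) by (unfold e; cont).
    set (N := Int (fun x => chi x * e x * e x) a b).
    set (I := Int (fun x => chi x * (w x - polyval c k x) * e x) a b).
    (* [e] is the part of [x ^ k] orthogonal to lower powers, [t] the coefficient of [w] along it.
       The value 0 is right when [N = 0], because then [I = 0] as well. *)
    set (t := if Req_EM_T N 0 then 0 else I / N).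
    assert (HI : I = t * N).
    { unfold t; destruct (Req_EM_T N 0) as [Z|Z]; [|field; auto].
      (* [N = 0] makes [chi * e ^ 2] vanish at every interior point, so [chi x] or [e x] is zero
         there, and with it the integrand of [I]. *)
      rewrite Rmult_0_l; apply int_vanish; intros x.
      rewrite Rmin_left, Rmax_right by lra; intros Hx.
      assert (chi x * e x * e x = 0).
      { apply (int_zero_pos (fun x => chi x * e x * e x) a b); cont.
        - intros y; specialize (Pchi y); nra.
        - fold N; lra. }
      apply Rmult_integral in H as [H|H]; [|rewrite H; ring].
      apply Rmult_integral in H as [H|H]; rewrite H; ring. }
    exists (fun j => if Nat.eq_dec j k then t else c j - t * d j).
    assert (L : forall x, polyval (fun j => if Nat.eq_dec j k then t else c j - t * d j) (S k) x
      = polyval c k x + t * e x).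
    { intros x; simpl; destruct (Nat.eq_dec k k); [|lia].
      rewrite (polyval_ext _ (fun j => c j - t * d j)).
      - rewrite polyval_minus; unfold e; ring.
      - intros j Hj; destruct (Nat.eq_dec j k); [lia|auto]. }
    assert (G : forall h, Cont h -> Int (fun x => chi x * (w x - polyval (fun j =>
        if Nat.eq_dec j k then t else c j - t * d j) (S k) x) * h x) a b
      = Int (fun x => chi x * (w x - polyval c k x) * h x) a b
        - t * Int (fun x => chi x * e x * h x) a b).
    { intros h Ch; rewrite <- int_scal, <- int_minus by cont.
      apply int_ext; auto; intros x _; rewrite L; ring. }
    assert (J : forall j, (j < k)%nat -> Int (fun x => chi x * (w x - polyval (fun j =>
        if Nat.eq_dec j k then t else c j - t * d j) (S k) x) * x ^ j) a b = 0).
    { intros j Hj; rewrite (G (fun x => x ^ j)) by cont.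
      unfold e; rewrite Hc, Hd by auto; ring. }
    intros j Hj; destruct (Nat.eq_dec j k) as [->|]; [|apply J; lia].
    (* Write [x ^ k] as [e x + polyval d k x]: the choice of [t] handles [e], and [J] handles the
       polynomial. *)
    rewrite (int_ext _ (fun x => chi x * (w x - polyval (fun j =>
        if Nat.eq_dec j k then t else c j - t * d j) (S k) x) * e x
      + chi x * (w x - polyval (fun j =>
        if Nat.eq_dec j k then t else c j - t * d j) (S k) x) * polyval d k x) a b ab)
      by (intros; unfold e; ring).
    rewrite int_plus, (G e), int_polyval_zero; try fold N I; [lra|..]; auto; cont.
Qed.

(** The weighted residual [chi * (w - polyval c k)] is itself a test function: the parabola [chi]
    gives the support, and the projection gives the moments. Testing against it yields a vanishing
    integral of [chi * (w - polyval c k) ^ 2]. *)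
Lemma du_bois_reymond (w : R -> R) (r : R) (k : nat) : 0 < r -> Cont w ->
  (forall rho, test r k rho -> Int (fun x => w x * rho x) (- r) r = 0) ->
  exists c, forall x, Rabs x < r -> w x = polyval c k x.
Proof.
  intros Hr Cw H.
  set (chi := fun x => Rmax 0 (r * r - x * x)).
  assert (Pchi : forall x, 0 <= chi x) by (intro; apply Rmax_l).
  assert (Cchi : Cont chi).
  { assert (E : forall x, (r * r - x * x + Rabs (r * r - x * x)) / 2 = chi x).
    { intros x; unfold chi, Rmax, Rabs.
      destruct Rle_dec, Rcase_abs; lra. }
    intros x; apply (continuous_ext (fun x => (r * r - x * x + Rabs (r * r - x * x)) / 2)).
    - exact E.
    - revert x; change (Cont (fun x => (r * r - x * x + Rabs (r * r - x * x)) / 2)).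
      cont. }
  destruct (weighted_projection chi (- r) r k ltac:(lra) Cchi Pchi w Cw) as [c Hc].
  exists c.
  set (rho := fun x => chi x * (w x - polyval c k x)).
  assert (Crho : Cont rho) by (unfold rho; cont).
  assert (T : test r k rho).
  { split; [exact Crho|]; split; [|exact Hc].
    intros x Hx; unfold rho.
    assert (chi x = 0) as ->; [|ring].
    apply Rmax_left.
    assert (x * x = Rabs x * Rabs x) as -> by
      (rewrite <- Rabs_mult, Rabs_right; [auto|nra]).
    nra. }
  assert (E : Int (fun x => chi x * (w x - polyval c k x) ^ 2) (- r) r = 0).
  { rewrite (int_ext _ (fun x => w x * rho x - rho x * polyval c k x)); [|lra|].
    - rewrite int_minus, (H rho T), int_polyval_zero; [ring|..]; auto; cont.
    - intros; unfold rho; ring. }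
  intros x Hx; apply Rabs_lt_between in Hx.
  assert (Z : chi x * (w x - polyval c k x) ^ 2 = 0).
  { apply (int_zero_pos (fun x => chi x * (w x - polyval c k x) ^ 2) (- r) r); cont.
    - intros y; specialize (Pchi y); pose proof (pow2_ge_0 (w y - polyval c k y)); nra.
    - lra. }
  assert (0 < chi x).
  { unfold chi; rewrite Rmax_right; nra. }
  apply Rmult_integral in Z as [Z|Z]; [lra|].
  apply Rminus_diag_uniq, Rsqr_0_uniq; unfold Rsqr; rewrite <- Z; ring.
Qed.

(** * Profiles, energy and a priori bounds *)

(* Bounded by [C] and Hoelder-1/2 at unit scale; the modulus is written
   without square roots. *)
Definition Mod (C : R) (f : R -> R) : Prop :=
  (forall x, Rabs (f x) <= C) /\
  forall d x y, 0 < d <= 1 -> Rabs (x - y) <= d ^ 2 -> Rabs (f x - f y) <= C * d.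

Lemma Mod_pos (C : R) (f : R -> R) : Mod C f -> 0 <= C.
Proof. intros [H _]; generalize (H 0) (Rabs_pos (f 0)); lra. Qed.

Lemma Mod_const (c : R) : Mod (Rabs c) (fun _ => c).
Proof.
  split; [intros; lra|]; intros d x y Hd _.
  unfold Rminus; rewrite Rplus_opp_r, Rabs_R0.
  pose proof (Rabs_pos c); nra.
Qed.

Lemma Mod_plus (C D : R) (f h : R -> R) :
  Mod C f -> Mod D h -> Mod (C + D) (fun x => f x + h x).
Proof.
  intros [F1 F2] [H1 H2]; split.
  - intros x; eapply Rle_trans; [apply Rabs_triang|]; specialize (F1 x); specialize (H1 x); lra.
  - intros d x y Hd Hx; specialize (F2 d x y Hd Hx); specialize (H2 d x y Hd Hx).
    replace (f x + h x - (f y + h y)) with ((f x - f y) + (h x - h y)) by ring.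
    eapply Rle_trans; [apply Rabs_triang|]; lra.
Qed.

Lemma Mod_mult (C D : R) (f h : R -> R) :
  Mod C f -> Mod D h -> Mod (2 * C * D) (fun x => f x * h x).
Proof.
  intros MF MH; pose proof (Mod_pos C f MF); pose proof (Mod_pos D h MH).
  destruct MF as [F1 F2], MH as [H1 H2].
  assert (0 <= C * D) by nra.
  split.
  - intros x; rewrite Rabs_mult; specialize (F1 x); specialize (H1 x).
    pose proof (Rabs_pos (f x)); pose proof (Rabs_pos (h x)).
    assert (Rabs (f x) * Rabs (h x) <= C * D) by (apply Rmult_le_compat; auto).
    lra.
  - intros d x y Hd Hx; specialize (F2 d x y Hd Hx); specialize (H2 d x y Hd Hx).
    replace (f x * h x - f y * h y) with ((f x - f y) * h x + f y * (h x - h y)) by ring.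
    eapply Rle_trans; [apply Rabs_triang|]; rewrite !Rabs_mult.
    assert (Rabs (f x - f y) * Rabs (h x) <= (C * d) * D)
      by (apply Rmult_le_compat; auto using Rabs_pos).
    assert (Rabs (f y) * Rabs (h x - h y) <= C * (D * d))
      by (apply Rmult_le_compat; auto using Rabs_pos).
    lra.
Qed.

Lemma Mod_comp_opp (C : R) (f : R -> R) : Mod C f -> Mod C (fun x => f (- x)).
Proof.
  intros [F1 F2]; split; [intros; apply F1|]; intros d x y Hd Hx.
  apply F2; auto; replace (- x - - y) with (- (x - y)) by ring.
  now rewrite Rabs_Ropp.
Qed.

Lemma Mod_Cont (C : R) (f : R -> R) : Mod C f -> Cont f.
Proof.
  intros M; pose proof (Mod_pos C f M); destruct M as [_ M].
  apply Cont_eps; intros x e He.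
  set (d := Rmin 1 (e / (C + 1))).
  assert (0 < e / (C + 1)) by (apply Rdiv_lt_0_compat; lra).
  assert (0 < d) by (apply Rmin_glb_lt; lra).
  assert (d <= 1) by apply Rmin_l.
  assert (d <= e / (C + 1)) by apply Rmin_r.
  exists (d ^ 2); split; [nra|]; intros y Hy.
  specialize (M d y x ltac:(lra) ltac:(lra)).
  assert (d * (C + 1) <= e).
  { apply (Rmult_le_compat_r (C + 1)) in H3; [|lra].
    replace (e / (C + 1) * (C + 1)) with e in H3 by (field; lra); lra. }
  lra.
Qed.

(** The modulus prevents [h] from falling from [s] below [s / 2] within a distance [d ^ 2] fixed by
    [C] and [s]. The gain [kappa] is thus the same for all [h] and all [x], so bounded energy limits
    how often, and small energy whether, a level is reached. *)
Lemma Mod_integral_gap (C s : R) : 0 < s -> exists kappa, 0 < kappa /\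
  forall h, Mod C h -> (forall x, 0 <= h x) ->
  forall x, s <= h x -> kappa <= Int h x (x + 1).
Proof.
  intros Hs; destruct (Rlt_dec C 0) as [HC|HC].
  (* No function satisfies [Mod C] for negative [C], so any value serves. *)
  { exists 1; split; [lra|]; intros h M; apply Mod_pos in M; lra. }
  set (d := Rmin 1 (s / (2 * (C + 1)))).
  assert (0 < s / (2 * (C + 1))) by (apply Rdiv_lt_0_compat; lra).
  assert (0 < d) by (apply Rmin_glb_lt; lra).
  assert (d <= 1) by apply Rmin_l.
  assert (d <= s / (2 * (C + 1))) by apply Rmin_r.
  assert (d * (C + 1) <= s / 2).
  { apply (Rmult_le_compat_r (C + 1)) in H2; [|lra].
    replace (s / (2 * (C + 1)) * (C + 1)) with (s / 2) in H2 by (field; lra); lra. }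
  assert (0 < d ^ 2 <= 1) by nra.
  exists (d ^ 2 * (s / 2)); split; [nra|].
  intros h M P x Hx; pose proof (Mod_Cont C h M) as Ch; destruct M as [_ M].
  apply Rle_trans with (Int h x (x + d ^ 2)); [|apply int_mono; auto; lra].
  replace (d ^ 2 * (s / 2)) with (Int (fun _ => s / 2) x (x + d ^ 2))
    by (rewrite int_const; ring).
  apply int_le; cont; [lra|]; intros y Hy.
  specialize (M d x y ltac:(lra)).
  rewrite (Rabs_left1 (x - y)) in M by lra; specialize (M ltac:(lra)).
  apply Rabs_le_between in M; lra.
Qed.

(** The derivatives are data, tied to the functions by [regular]. Perturbed, shifted or glued
    profiles then have explicit energy densities, without any computation of [Derive]. *)
Record profile := Profile { pA : R -> R; pA1 : R -> R; pA2 : R -> R;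
                            pB : R -> R; pB1 : R -> R }.

Record regular (p : profile) : Prop := {
  dA : forall x, is_derive (pA p) x (pA1 p x);
  dA1 : forall x, is_derive (pA1 p) x (pA2 p x);
  cA2 : Cont (pA2 p);
  dB : forall x, is_derive (pB p) x (pB1 p x);
  cB1 : Cont (pB1 p) }.

Lemma cA (p : profile) : regular p -> Cont (pA p).
Proof. intros H; exact (Cont_derive _ _ (dA p H)). Qed.
Lemma cA1 (p : profile) : regular p -> Cont (pA1 p).
Proof. intros H; exact (Cont_derive _ _ (dA1 p H)). Qed.
Lemma cB (p : profile) : regular p -> Cont (pB p).
Proof. intros H; exact (Cont_derive _ _ (dB p H)). Qed.
#[export] Hint Resolve cA cA1 cA2 cB cB1 : cont.

(* The two equations are the Euler-Lagrange equations of the integral of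
   [A''^2 / 2 + B'^2 / (2 eps^2) + pot g A B]. *)
Definition pot (g a b : R) : R := (a ^ 2 + b ^ 2 - 1) ^ 2 / 4 + (g - 1) / 2 * (a ^ 2 * b ^ 2).

Definition dens (eps g : R) (p : profile) (x : R) : R :=
  pA2 p x ^ 2 / 2 + pB1 p x ^ 2 / (2 * eps ^ 2) + pot g (pA p x) (pB p x).

(** For nonnegative [f] this bounds the integral over the whole line without forming an improper
    integral. *)
Definition mass_le (f : R -> R) (K : R) : Prop := forall a b, a <= b -> Int f a b <= K.

Lemma pot_ge (g a b : R) : 1 <= g -> (a ^ 2 + b ^ 2 - 1) ^ 2 / 4 <= pot g a b.
Proof. intros; unfold pot; pose proof (pow2_ge_0 (a * b)); nra. Qed.

Lemma pot_pos (g a b : R) : 1 <= g -> 0 <= pot g a b.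
Proof. intros H; pose proof (pot_ge g a b H); pose proof (pow2_ge_0 (a ^ 2 + b ^ 2 - 1)); lra. Qed.

Lemma pot_abs (g a b : R) : pot g a (Rabs b) = pot g a b.
Proof. unfold pot; now rewrite pow2_abs. Qed.

Lemma Cont_pot (g : R) (f h : R -> R) : Cont f -> Cont h -> Cont (fun x => pot g (f x) (h x)).
Proof. intros; unfold pot; cont. Qed.
#[export] Hint Resolve Cont_pot : cont.

Lemma Cont_dens (eps g : R) (p : profile) : regular p -> Cont (dens eps g p).
Proof. intros; unfold dens; cont. Qed.
#[export] Hint Resolve Cont_dens : cont.

Lemma dens_parts (eps g : R) (p : profile) (x : R) : 0 < eps -> 1 <= g ->
  0 <= pA2 p x ^ 2 /\ 0 <= pB1 p x ^ 2 / (2 * eps ^ 2) /\ 0 <= pot g (pA p x) (pB p x).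
Proof.
  intros He Hg; split; [apply pow2_ge_0|]; split; [|now apply pot_pos].
  apply Rmult_le_pos; [apply pow2_ge_0|]; left; apply Rinv_0_lt_compat; nra.
Qed.

Lemma dens_pos (eps g : R) (p : profile) (x : R) : 0 < eps -> 1 <= g -> 0 <= dens eps g p x.
Proof. intros He Hg; destruct (dens_parts eps g p x He Hg) as (?&?&?); unfold dens; lra. Qed.

Lemma pot_le_dens (eps g : R) (p : profile) (x : R) : 0 < eps -> 1 <= g ->
  pot g (pA p x) (pB p x) <= dens eps g p x.
Proof. intros He Hg; destruct (dens_parts eps g p x He Hg) as (?&?&?); unfold dens; lra. Qed.

(** The Cauchy-Schwarz estimate of an increment by the square root of the distance, in root-free
    form: integrate [|f'| <= d * f' ^ 2 + / (4 * d)] over an interval of length at most [d ^ 2]. *)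
Lemma derive_modulus (f f' : R -> R) (K : R) : (forall x, is_derive f x (f' x)) -> Cont f' ->
  mass_le (fun x => f' x ^ 2) K ->
  forall d x y, 0 < d -> Rabs (x - y) <= d ^ 2 -> Rabs (f x - f y) <= (K + 1) * d.
Proof.
  intros D C H.
  assert (W : forall d x y, 0 < d -> x <= y -> y - x <= d ^ 2 ->
    Rabs (f y - f x) <= (K + 1) * d).
  { intros d x y Hd xy L; specialize (H x y xy).
    rewrite <- (int_derive f f') by auto.
    (* [s] is the sign 1 or -1, so that both bounds come from one computation. *)
    assert (U : forall s, s ^ 2 = 1 -> s * Int f' x y <= (K + 1) * d).
    { intros s Hs; rewrite <- int_scal by auto.
      apply Rle_trans with (Int (fun z => d * f' z ^ 2 + / (4 * d)) x y).
      - apply int_le; cont; intros z _.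
        assert (E : d * f' z ^ 2 + / (4 * d) - s * f' z = d * (s * f' z - / (2 * d)) ^ 2
          + d * f' z ^ 2 * (1 - s ^ 2)) by (field; lra).
        rewrite Hs in E; pose proof (pow2_ge_0 (s * f' z - / (2 * d))); nra.
      - rewrite int_plus, int_scal, int_const by cont.
        assert ((y - x) * / (4 * d) <= d / 4).
        { apply Rle_trans with (d ^ 2 * / (4 * d)).
          - apply Rmult_le_compat_r; auto; left; apply Rinv_0_lt_compat; lra.
          - right; field; lra. }
        nra. }
    pose proof (U 1 ltac:(ring)); pose proof (U (-1) ltac:(ring)).
    apply Rabs_le_between; lra. }
  intros d x y Hd Hx; apply Rabs_le_between in Hx.
  destruct (Rle_dec x y).
  - rewrite Rabs_minus_sym; apply W; auto; lra.
  - apply W; auto; lra.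
Qed.

Lemma mass_scal (f h : R -> R) (c K : R) : 0 <= c -> Cont f -> Cont h ->
  (forall x, f x <= c * h x) -> mass_le h K -> mass_le f (c * K).
Proof.
  intros Hc Cf Ch L M a b ab; apply Rle_trans with (Int (fun x => c * h x) a b).
  - apply int_le; cont.
  - rewrite int_scal by auto; apply Rmult_le_compat_l; auto.
Qed.

Lemma mass_pos (f : R -> R) (K : R) : mass_le f K -> 0 <= K.
Proof. intros H; specialize (H 0 0 ltac:(lra)); unfold Int in H; rewrite RInt_point in H; exact H. Qed.

(** Each unit interval contains a point where both amplitudes are moderate. The modulus of [pB]
    spreads the bound for [B]. For [A'] the mean value theorem between two moderate points gives one
    good slope, and the modulus of [pA1] spreads it. Only [pot_ge] is used of the potential, hence
    [M] does not depend on [g]. *)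
Lemma a_priori (eps K : R) : 0 < eps -> exists M, 0 < M /\ forall g p, 1 <= g ->
  regular p -> mass_le (dens eps g p) K -> Mod M (pA p) /\ Mod M (pA1 p) /\ Mod M (pB p).
Proof.
  intros He.
  destruct (Rle_dec 0 K) as [HK|HK].
  2: { exists 1; split; [lra|]; intros g p _ _ H; apply mass_pos in H; lra. }
  set (c1 := 2 * K + 1); set (c2 := 2 * eps ^ 2 * K + 1).
  assert (Heps : 0 <= 2 * eps ^ 2 * K) by (pose proof (pow2_ge_0 eps); nra).
  set (M1 := 2 * (K + 3) + 2 * c1); set (M := K + 3 + c2 + 4 * M1).
  exists M; split; [unfold M, M1, c1, c2; lra|].
  intros g p Hg Rp H.
  assert (MA : forall d x y, 0 < d -> Rabs (x - y) <= d ^ 2 -> Rabs (pA1 p x - pA1 p y) <= c1 * d).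
  { apply (derive_modulus _ (pA2 p)); [apply dA1, Rp|apply cA2, Rp|].
    apply (mass_scal _ (dens eps g p)); cont; [lra|].
    intros x; destruct (dens_parts eps g p x He Hg) as (?&?&?); unfold dens; lra. }
  assert (MB : forall d x y, 0 < d -> Rabs (x - y) <= d ^ 2 -> Rabs (pB p x - pB p y) <= c2 * d).
  { apply (derive_modulus _ (pB1 p)); [apply dB, Rp|apply cB1, Rp|].
    apply (mass_scal _ (dens eps g p)); cont; [nra|].
    intros x; destruct (dens_parts eps g p x He Hg) as (?&?&?); unfold dens.
    apply Rle_trans with (2 * eps ^ 2 * (pB1 p x ^ 2 / (2 * eps ^ 2))).
    - right; field; lra.
    - apply Rmult_le_compat_l; nra. }
  (* Otherwise the potential would be at least [K + 1] on a whole unit interval, beyond the budget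
     [K]. *)
  assert (Q : forall x, exists y, x <= y <= x + 1 /\ Rabs (pA p y) <= K + 3 /\ Rabs (pB p y) <= K + 3).
  { intros x; apply NNPP; intros N.
    assert (L : Int (fun _ => K + 1) x (x + 1) <= Int (dens eps g p) x (x + 1)).
    { apply int_le; cont; [lra|]; intros y Hy.
      eapply Rle_trans; [|now apply pot_le_dens]; eapply Rle_trans; [|now apply pot_ge].
      apply Rnot_lt_le; intros L'; apply N; exists y; split; [lra|].
      set (a := pA p y) in *; set (b := pB p y) in *.
      assert (a ^ 2 + b ^ 2 <= (K + 3) ^ 2) by nra.
      split; apply Rabs_le_between; nra. }
    rewrite int_const in L; specialize (H x (x + 1) ltac:(lra)); lra. }
  assert (BB : forall x, Rabs (pB p x) <= M).
  { intros x; destruct (Q x) as (y & Hy & _ & L).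
    specialize (MB 1 x y ltac:(lra)); rewrite Rabs_left1 in MB by lra.
    specialize (MB ltac:(lra)).
    replace (pB p x) with ((pB p x - pB p y) + pB p y) by ring.
    eapply Rle_trans; [apply Rabs_triang|]; unfold M, M1, c1 in *; lra. }
  assert (BA1 : forall x, Rabs (pA1 p x) <= M1).
  { intros x; destruct (Q x) as (y & Hy & Ly & _), (Q (x + 2)) as (z & Hz & Lz & _).
    destruct (MVT_gen (pA p) y z (pA1 p)) as (xi & Hxi & E).
    - intros; apply dA, Rp.
    - intros t _; apply continuity_pt_filterlim, cA, Rp.
    - rewrite Rmin_left, Rmax_right in Hxi by lra.
      (* [xi] lies in [[x, x + 3]], within the distance [2 ^ 2] that the modulus allows for
         [d = 2]. *)
      specialize (MA 2 x xi ltac:(lra)); rewrite Rabs_left1 in MA by lra.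
      specialize (MA ltac:(lra)).
      apply Rabs_le_between in Ly, Lz, MA.
      assert (- (2 * (K + 3)) <= pA1 p xi <= 2 * (K + 3)) by nra.
      apply Rabs_le_between; unfold M1; lra. }
  assert (LA : forall x y, Rabs (pA p x - pA p y) <= M1 * Rabs (x - y)).
  { intros x y; destruct (MVT_gen (pA p) y x (pA1 p)) as (xi & Hxi & E).
    - intros; apply dA, Rp.
    - intros t _; apply continuity_pt_filterlim, cA, Rp.
    - rewrite E, Rabs_mult; apply Rmult_le_compat_r; auto using Rabs_pos. }
  assert (0 <= M1 /\ M1 <= M /\ c1 <= M /\ c2 <= M /\ M1 + K + 3 <= M) as (P1 & P2 & P3 & P4 & P5)
    by (unfold M, M1, c1, c2; lra).
  assert (U : forall c d t, 0 < d -> c <= M -> t <= c * d -> t <= M * d)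
    by (intros c d t Hd Hc Ht; apply (Rmult_le_compat_r d) in Hc; lra).
  split; [split|split; split; auto].
  - intros x; destruct (Q x) as (y & Hy & L & _).
    specialize (LA x y); rewrite (Rabs_left1 (x - y)) in LA by lra.
    replace (pA p x) with ((pA p x - pA p y) + pA p y) by ring.
    eapply Rle_trans; [apply Rabs_triang|]; nra.
  - intros d x y Hd Hx; apply (U M1); [lra|auto|]; eapply Rle_trans; [apply LA|].
    apply Rmult_le_compat_l; nra.
  - intros x; eapply Rle_trans; [apply BA1|auto].
  - intros d x y Hd Hx; apply (U c1); auto; [lra|apply MA; auto; lra].
  - intros d x y Hd Hx; apply (U c2); auto; [lra|apply MB; auto; lra].
Qed.

(** Kept apart from [Mod_pot] because this [D] is independent of [g], which the limit [g -> 1]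
    requires. *)
Lemma Mod_sphere (C : R) : exists D, forall f h, Mod C f -> Mod C h ->
  Mod D (fun x => (f x ^ 2 + h x ^ 2 - 1) ^ 2 / 4).
Proof.
  set (D1 := 2 * C * C + 2 * C * C + Rabs (-1)).
  exists (2 * (2 * D1 * D1) * Rabs (/ 4)); intros f h F H.
  assert (U : Mod D1 (fun x => f x * f x + h x * h x + -1)).
  { apply (Mod_plus _ _ (fun x => f x * f x + h x * h x)); [|apply Mod_const].
    apply (Mod_plus _ _ (fun x => f x * f x) (fun x => h x * h x)); now apply Mod_mult. }
  pose proof (Mod_mult _ _ _ _ (Mod_mult _ _ _ _ U U) (Mod_const (/ 4))) as V.
  destruct V as [V1 V2]; split.
  - intros x; eapply Rle_trans; [|apply (V1 x)]; right; f_equal; field.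
  - intros d x y Hd Hx; eapply Rle_trans; [|apply (V2 d x y Hd Hx)]; right; f_equal; field.
Qed.

Lemma Mod_pot (g C : R) : exists D, forall f h, Mod C f -> Mod C h ->
  Mod D (fun x => pot g (f x) (h x)).
Proof.
  destruct (Mod_sphere C) as [D1 H1].
  exists (D1 + 2 * Rabs ((g - 1) / 2) * (2 * (2 * C * C) * (2 * C * C))); intros f h F H.
  assert (E : Mod (2 * Rabs ((g - 1) / 2) * (2 * (2 * C * C) * (2 * C * C)))
    (fun x => (g - 1) / 2 * ((f x * f x) * (h x * h x)))).
  { apply (Mod_mult _ _ (fun _ => (g - 1) / 2)); [apply Mod_const|].
    apply (Mod_mult _ _ (fun x => f x * f x) (fun x => h x * h x)); now apply Mod_mult. }
  destruct (Mod_plus _ _ _ _ (H1 f h F H) E) as [V1 V2]; unfold pot; split.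
  - intros x; eapply Rle_trans; [|apply (V1 x)]; right; f_equal; field.
  - intros d x y Hd Hx; eapply Rle_trans; [|apply (V2 d x y Hd Hx)]; right; f_equal; field.
Qed.

(** * First variation of the energy *)

Definition connecting (p : profile) : Prop := exists T, 0 < T /\
  (forall x, x <= - T -> pA p x = 1 /\ pB p x = 0 /\ pA2 p x = 0 /\ pB1 p x = 0) /\
  (forall x, T <= x -> pA p x = 0 /\ pB p x = 1 /\ pA2 p x = 0 /\ pB1 p x = 0).

Definition admissible (p : profile) : Prop := regular p /\ connecting p.

Definition energy_bound (eps g m : R) : Prop :=
  forall p K, admissible p -> mass_le (dens eps g p) K -> m <= K.

(** Accounts for a modification inside [[- r, r]] that costs at most [D]. Enlarging the interval to
    contain [[- r, r]] only increases the integral of [h], so a single comparison covers all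
    intervals. *)
Lemma mass_local (f h : R -> R) (r K D : R) : 0 <= r -> Cont f -> Cont h ->
  (forall x, 0 <= h x) -> (forall x, r <= Rabs x -> h x <= f x) ->
  Int h (- r) r <= Int f (- r) r + D -> mass_le f K -> mass_le h (K + D).
Proof.
  intros Hr Cf Ch P L H M a b ab.
  set (a' := Rmin a (- r)); set (b' := Rmax b r).
  assert (a' <= a /\ a' <= - r) by (split; [apply Rmin_l|apply Rmin_r]).
  assert (b <= b' /\ r <= b') by (split; [apply Rmax_l|apply Rmax_r]).
  apply Rle_trans with (Int h a' b'); [apply int_mono; auto; lra|].
  specialize (M a' b' ltac:(lra)).
  rewrite <- (int_chasles h a' (- r) b'), <- (int_chasles h (- r) r b') by auto.
  rewrite <- (int_chasles f a' (- r) b'), <- (int_chasles f (- r) r b') in M by auto.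
  assert (Int h a' (- r) <= Int f a' (- r)).
  { apply int_le; auto; [lra|]; intros; apply L; rewrite Rabs_left1; lra. }
  assert (Int h r b' <= Int f r b').
  { apply int_le; auto; [lra|]; intros; apply L; rewrite Rabs_right; lra. }
  lra.
Qed.

Lemma Rabs_plus_le (x y C D : R) : Rabs x <= C -> Rabs y <= D -> Rabs (x + y) <= C + D.
Proof. intros; eapply Rle_trans; [apply Rabs_triang|lra]. Qed.

Lemma Rabs_mult_le (x y C D : R) : Rabs x <= C -> Rabs y <= D -> Rabs (x * y) <= C * D.
Proof. intros; rewrite Rabs_mult; apply Rmult_le_compat; auto using Rabs_pos. Qed.

Lemma Rabs_self_le (c : R) : Rabs c <= Rabs c.
Proof. apply Rle_refl. Qed.

(** Builds the bound while proving it: after [eexists] the right side is an evar that the recursion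
    on sums and products fills in. *)
Ltac Rabs_bound := repeat first [eassumption | apply Rabs_plus_le | apply Rabs_mult_le | apply Rabs_self_le].

(** The partial derivatives of [pot] in [a] and in [b]. They use sums and products only, with [+ -1]
    for the subtraction, the shape that [ndiff_potA] takes apart. *)
Definition potA (g a b : R) : R := a * (a * a + g * (b * b) + -1).
Definition potB (g a b : R) : R := b * (b * b + g * (a * a) + -1).

(** Since [pot] is a polynomial, the remainder after the linear term is exactly [t ^ 2] times the
    polynomial displayed in the proof, which is bounded on the box. *)
Lemma pot_taylor (g N : R) : exists C, forall a b u v t,
  Rabs a <= N -> Rabs b <= N -> Rabs u <= N -> Rabs v <= N -> Rabs t <= 1 ->
  pot g (a + t * u) (b + t * v)
    <= pot g a b + t * (potA g a b * u + potB g a b * v) + t ^ 2 * C.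
Proof.
  assert (E : exists C, forall a b u v t,
    Rabs a <= N -> Rabs b <= N -> Rabs u <= N -> Rabs v <= N -> Rabs t <= 1 ->
    Rabs ((a * u + b * v) * (a * u + b * v)
      + / 2 * ((a * a + b * b + -1) * (u * u + v * v))
      + t * ((a * u + b * v) * (u * u + v * v))
      + / 4 * (t * t * ((u * u + v * v) * (u * u + v * v)))
      + (g - 1) / 2 * ((a * v + b * u) * (a * v + b * u) + 2 * (a * b * (u * v))
         + 2 * (t * ((a * v + b * u) * (u * v))) + t * t * ((u * v) * (u * v)))) <= C).
  { eexists; intros a b u v t Ha Hb Hu Hv Ht; Rabs_bound. }
  destruct E as [C HC]; exists C; intros a b u v t Ha Hb Hu Hv Ht.
  specialize (HC a b u v t Ha Hb Hu Hv Ht).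
  apply Rabs_le_between in HC; destruct HC as [_ HC].
  apply (Rmult_le_compat_l (t ^ 2)) in HC; [|apply pow2_ge_0].
  eapply Rle_trans; [|apply Rplus_le_compat_l, HC].
  right; unfold pot, potA, potB; field.
Qed.

Lemma Cont_potA (g : R) (f h : R -> R) : Cont f -> Cont h -> Cont (fun x => potA g (f x) (h x)).
Proof. intros; unfold potA; cont. Qed.
Lemma Cont_potB (g : R) (f h : R -> R) : Cont f -> Cont h -> Cont (fun x => potB g (f x) (h x)).
Proof. intros; unfold potB; cont. Qed.
#[export] Hint Resolve Cont_potA Cont_potB : cont.

Definition perturb (p : profile) (u u1 u2 v v1 : R -> R) (t : R) : profile :=
  Profile (fun x => pA p x + t * u x) (fun x => pA1 p x + t * u1 x)
    (fun x => pA2 p x + t * u2 x) (fun x => pB p x + t * v x) (fun x => pB1 p x + t * v1 x).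

Lemma derive_scal (f : R -> R) (x f' t : R) :
  is_derive f x f' -> is_derive (fun y => t * f y) x (t * f').
Proof. intros; now apply is_derive_scal. Qed.

(** Perturb by [t = d] and by [t = - d]. Minimality up to [d ^ 2] gives
    [0 <= d ^ 2 + t * I + O(t ^ 2)] for the integral [I] of the statement, hence [|I| = O(d)]. The
    constant depends on the test functions and on [M], but not on [p], so it serves a whole
    sequence. *)
Lemma first_variation (eps g M N r : R) (u u1 u2 v v1 : R -> R) :
  0 < eps -> 1 <= g -> 0 < r ->
  (forall x, is_derive u x (u1 x)) -> (forall x, is_derive u1 x (u2 x)) -> Cont u2 ->
  (forall x, is_derive v x (v1 x)) -> Cont v1 ->
  (forall x, r <= Rabs x -> u x = 0 /\ u2 x = 0 /\ v x = 0 /\ v1 x = 0) ->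
  (forall x, Rabs (u x) <= N /\ Rabs (u2 x) <= N /\ Rabs (v x) <= N /\ Rabs (v1 x) <= N) ->
  exists C, forall m p d, 0 < d <= 1 -> admissible p -> energy_bound eps g m ->
    mass_le (dens eps g p) (m + d ^ 2) ->
    (forall x, Rabs (pA p x) <= M) -> (forall x, Rabs (pB p x) <= M) ->
    Rabs (Int (fun x => pA2 p x * u2 x + pB1 p x * v1 x * / eps ^ 2
      + (potA g (pA p x) (pB p x) * u x + potB g (pA p x) (pB p x) * v x)) (- r) r) <= C * d.
Proof.
  intros He Hg Hr Du Du1 Cu2 Dv Cv1 Z Bd.
  destruct (pot_taylor g (Rmax M N)) as [C1 HC1].
  set (C2 := N * N / 2 + N * N / (2 * eps ^ 2) + C1).
  exists (1 + 2 * r * C2); intros m p d Hd [Rp Cp] Hm H BA BB.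
  set (L := fun x => pA2 p x * u2 x + pB1 p x * v1 x * / eps ^ 2
      + (potA g (pA p x) (pB p x) * u x + potB g (pA p x) (pB p x) * v x)).
  pose proof (Cont_derive _ _ Du) as Cu; pose proof (Cont_derive _ _ Dv) as Cv.
  assert (CL : Cont L) by (unfold L; cont).
  assert (Ie : 0 < / (2 * eps ^ 2)) by (apply Rinv_0_lt_compat; nra).
  assert (V : forall t, Rabs t <= 1 -> 0 <= d ^ 2 + t * Int L (- r) r + t ^ 2 * (2 * r * C2)).
  { intros t Ht; set (q := perturb p u u1 u2 v v1 t).
    assert (Rq : regular q).
    { split; simpl.
      - intros x; apply derive_plus; [apply dA, Rp|now apply derive_scal].
      - intros x; apply derive_plus; [apply dA1, Rp|now apply derive_scal].
      - cont.
      - intros x; apply derive_plus; [apply dB, Rp|now apply derive_scal].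
      - cont. }
    assert (Cq : connecting q).
    { destruct Cp as (T & HT & L1 & L2).
      pose proof (Rmax_l T r); pose proof (Rmax_r T r).
      exists (Rmax T r); split; [lra|]; split; intros x Hx; simpl.
      - destruct (Z x) as (->&->&->&->); [rewrite Rabs_left1; lra|].
        rewrite !Rmult_0_r, !Rplus_0_r; apply L1; lra.
      - destruct (Z x) as (->&->&->&->); [rewrite Rabs_right; lra|].
        rewrite !Rmult_0_r, !Rplus_0_r; apply L2; lra. }
    assert (E : Int (dens eps g q) (- r) r
      <= Int (dens eps g p) (- r) r + (t * Int L (- r) r + t ^ 2 * (2 * r * C2))).
    { replace (t ^ 2 * (2 * r * C2)) with (Int (fun _ => t ^ 2 * C2) (- r) r)
        by (rewrite int_const; ring).
      rewrite <- int_scal, <- !int_plus by cont.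
      apply int_le; cont; [lra|]; intros x _.
      destruct (Bd x) as (U & U2 & W & W1).
      assert (P := HC1 (pA p x) (pB p x) (u x) (v x) t
        (Rle_trans _ _ _ (BA x) (Rmax_l _ _)) (Rle_trans _ _ _ (BB x) (Rmax_l _ _))
        (Rle_trans _ _ _ U (Rmax_r _ _)) (Rle_trans _ _ _ W (Rmax_r _ _)) Ht).
      assert (S2 : u2 x ^ 2 <= N * N) by (rewrite <- pow2_abs; pose proof (Rabs_pos (u2 x)); nra).
      assert (S1 : v1 x ^ 2 <= N * N) by (rewrite <- pow2_abs; pose proof (Rabs_pos (v1 x)); nra).
      assert (S3 : t ^ 2 * (v1 x ^ 2 / (2 * eps ^ 2)) <= t ^ 2 * (N * N / (2 * eps ^ 2))).
      { apply Rmult_le_compat_l; [apply pow2_ge_0|]; apply Rmult_le_compat_r; lra. }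
      assert (S4 : t ^ 2 * (u2 x ^ 2 / 2) <= t ^ 2 * (N * N / 2)).
      { apply Rmult_le_compat_l; [apply pow2_ge_0|lra]. }
      assert (S5 : (pB1 p x + t * v1 x) ^ 2 / (2 * eps ^ 2) = pB1 p x ^ 2 / (2 * eps ^ 2)
        + t * (pB1 p x * v1 x * / eps ^ 2) + t ^ 2 * (v1 x ^ 2 / (2 * eps ^ 2)))
        by (field; lra).
      unfold dens, L; simpl pA; simpl pA2; simpl pB; simpl pB1; rewrite S5.
      unfold C2; nra. }
    assert (Hq := mass_local (dens eps g p) (dens eps g q) r (m + d ^ 2)
      (t * Int L (- r) r + t ^ 2 * (2 * r * C2)) ltac:(lra)
      ltac:(cont) ltac:(cont) (fun x => dens_pos eps g q x He Hg)).
    assert (X : forall x, r <= Rabs x -> dens eps g q x <= dens eps g p x).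
    { intros x Hx; unfold dens; simpl; destruct (Z x Hx) as (->&->&->&->).
      rewrite !Rmult_0_r, !Rplus_0_r; apply Rle_refl. }
    specialize (Hq X E H); apply Hm in Hq; [lra|]; now split. }
  assert (V1 := V d ltac:(apply Rabs_le_between; lra)).
  assert (V2 := V (- d) ltac:(apply Rabs_le_between; lra)).
  fold L; apply Rabs_le_between; nra.
Qed.

Lemma test_bounded (r : R) (k : nat) (rho : R -> R) : 0 < r -> test r k rho ->
  exists N, forall x, Rabs (rho x) <= N.
Proof.
  intros Hr (C & Z & _).
  destruct (continuity_ab_maj (fun x => Rabs (rho x)) (- r) r) as (x0 & H0 & _); [lra| |].
  { intros x _; apply continuity_pt_filterlim; revert x.
    change (Cont (fun x => Rabs (rho x))); cont. }
  exists (Rabs (rho x0)); intros x.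
  destruct (Rle_dec r (Rabs x)) as [L|L].
  - rewrite (Z x L), Rabs_R0; apply Rabs_pos.
  - apply H0; apply Rnot_le_lt, Rabs_lt_between in L; lra.
Qed.

Lemma test_end (r : R) (k : nat) (rho : R -> R) : 0 < r -> test r k rho ->
  rho r = 0 /\ rho (- r) = 0.
Proof. intros Hr (_ & Z & _); split; apply Z; rewrite ?Rabs_Ropp, Rabs_right; lra. Qed.

(** The variation is the fourfold primitive of [rho]. Two integrations by parts turn [pA2 * r2] into
    [pA * rho], with boundary terms that vanish; what remains involves values of [A] and [B] only
    and survives locally uniform limits. *)
Lemma weak_equation_A (eps g M r : R) (rho : R -> R) :
  0 < eps -> 1 <= g -> 0 < r -> test r 4 rho ->
  exists C, forall m p d, 0 < d <= 1 -> admissible p -> energy_bound eps g m ->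
    mass_le (dens eps g p) (m + d ^ 2) ->
    (forall x, Rabs (pA p x) <= M) -> (forall x, Rabs (pB p x) <= M) ->
    Rabs (Int (fun x => pA p x * rho x
      + potA g (pA p x) (pB p x) * prim r (prim r (prim r (prim r rho))) x) (- r) r) <= C * d.
Proof.
  intros He Hg Hr T4.
  set (r3 := prim r rho); set (r2 := prim r r3); set (r1 := prim r r2); set (r0 := prim r r1).
  assert (T3 : test r 3 r3) by now apply prim_test.
  assert (T2 : test r 2 r2) by now apply prim_test.
  assert (T1 : test r 1 r1) by now apply prim_test.
  assert (T0 : test r 0 r0) by now apply prim_test.
  destruct (test_bounded r 0 r0 Hr T0) as [N0 B0].
  destruct (test_bounded r 2 r2 Hr T2) as [N2 B2].
  destruct (first_variation eps g M (Rmax N0 N2) r r0 r1 r2 (fun _ => 0) (fun _ => 0))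
    as [C HC]; auto; cont.
  - intros x; exact (prim_is_derive r 1 r1 x T1).
  - intros x; exact (prim_is_derive r 2 r2 x T2).
  - apply T2.
  - intros x; auto_derive; auto.
  - intros x Hx; split; [apply (proj1 (proj2 T0)), Hx|]; split; [apply (proj1 (proj2 T2)), Hx|auto].
  - intros x; rewrite Rabs_R0.
    pose proof (Rmax_l N0 N2); pose proof (Rmax_r N0 N2); specialize (B0 x); specialize (B2 x).
    pose proof (Rabs_pos (r0 x)); repeat split; lra.
  - exists C; intros m p d Hd Ap Hm H BA BB.
    specialize (HC m p d Hd Ap Hm H BA BB); destruct Ap as [Rp _].
    pose proof (proj1 T4) as C4; pose proof (proj1 T3) as C3; pose proof (proj1 T2) as C2;
      pose proof (proj1 T0) as C0.
    rewrite (int_ext _ (fun x => pA2 p x * r2 x + potA g (pA p x) (pB p x) * r0 x)) in HC;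
      [|lra|intros; ring].
    rewrite int_plus in HC |- * by cont.
    rewrite (int_parts (pA1 p) (pA2 p) r2 r3) in HC; cont;
      [|apply dA1, Rp|intros x; exact (prim_is_derive r 3 r3 x T3)].
    rewrite (int_parts (pA p) (pA1 p) r3 rho) in HC; cont;
      [|apply dA, Rp|intros x; exact (prim_is_derive r 4 rho x T4)].
    destruct (test_end r 2 r2 Hr T2) as [E1 E2], (test_end r 3 r3 Hr T3) as [E3 E4].
    rewrite E1, E2, E3, E4 in HC.
    eapply Rle_trans; [|exact HC]; right; f_equal; ring.
Qed.

Lemma weak_equation_B (eps g M r : R) (rho : R -> R) :
  0 < eps -> 1 <= g -> 0 < r -> test r 2 rho ->
  exists C, forall m p d, 0 < d <= 1 -> admissible p -> energy_bound eps g m ->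
    mass_le (dens eps g p) (m + d ^ 2) ->
    (forall x, Rabs (pA p x) <= M) -> (forall x, Rabs (pB p x) <= M) ->
    Rabs (Int (fun x => - / eps ^ 2 * (pB p x * rho x)
      + potB g (pA p x) (pB p x) * prim r (prim r rho) x) (- r) r) <= C * d.
Proof.
  intros He Hg Hr T2.
  set (r1 := prim r rho); set (r0 := prim r r1).
  assert (T1 : test r 1 r1) by now apply prim_test.
  assert (T0 : test r 0 r0) by now apply prim_test.
  destruct (test_bounded r 0 r0 Hr T0) as [N0 B0].
  destruct (test_bounded r 1 r1 Hr T1) as [N1 B1].
  destruct (first_variation eps g M (Rmax N0 N1) r (fun _ => 0) (fun _ => 0) (fun _ => 0) r0 r1)
    as [C HC]; auto; cont.
  - intros x; auto_derive; auto.
  - intros x; auto_derive; auto.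
  - intros x; exact (prim_is_derive r 1 r1 x T1).
  - apply T1.
  - intros x Hx; repeat split; auto; [apply (proj1 (proj2 T0)), Hx|apply (proj1 (proj2 T1)), Hx].
  - intros x; rewrite Rabs_R0.
    pose proof (Rmax_l N0 N1); pose proof (Rmax_r N0 N1); specialize (B0 x); specialize (B1 x).
    pose proof (Rabs_pos (r0 x)); repeat split; lra.
  - exists C; intros m p d Hd Ap Hm H BA BB.
    specialize (HC m p d Hd Ap Hm H BA BB); destruct Ap as [Rp _].
    pose proof (proj1 T2) as C2; pose proof (proj1 T1) as C1; pose proof (proj1 T0) as C0.
    rewrite (int_ext _ (fun x => / eps ^ 2 * (pB1 p x * r1 x)
      + potB g (pA p x) (pB p x) * r0 x)) in HC; [|lra|intros; ring].
    rewrite int_plus, int_scal in HC |- * by cont.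
    rewrite (int_parts (pB p) (pB1 p) r1 rho) in HC; cont;
      [|apply dB, Rp|intros x; exact (prim_is_derive r 2 rho x T2)].
    destruct (test_end r 1 r1 Hr T1) as [E1 E2]; rewrite E1, E2 in HC.
    eapply Rle_trans; [|exact HC]; right; f_equal; ring.
Qed.

(** * Locally uniform compactness *)

(** An enumeration of the rationals through Cantor pairing. *)
Definition grid (k : nat) : R :=
  let (i, j) := of_nat k in let (p, s) := of_nat j in (INR i - INR p) / (INR s + 1).

Lemma grid_dense (x e : R) : 0 < e -> exists k, Rabs (x - grid k) <= e.
Proof.
  intros He.
  destruct (archimed_cor1 e He) as (s & Hs & Ps).
  assert (Q : 0 < INR s) by now apply lt_0_INR.
  destruct (archimed (x * INR s)) as [U1 U2].
  assert (Z : exists i p, IZR (up (x * INR s)) = INR i - INR p).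
  { assert (I : forall z, (0 <= z)%Z -> INR (Z.to_nat z) = IZR z)
      by (intros; rewrite INR_IZR_INZ, Z2Nat.id; auto).
    destruct (Z_le_dec 0 (up (x * INR s))).
    - exists (Z.to_nat (up (x * INR s))), 0%nat; rewrite I by auto; simpl; ring.
    - exists 0%nat, (Z.to_nat (- up (x * INR s))); rewrite I, opp_IZR by lia; simpl; ring. }
  destruct Z as (i & p & E).
  exists (to_nat (i, to_nat (p, pred s))); unfold grid; rewrite !cancel_of_to.
  rewrite <- S_INR, Nat.succ_pred by lia.
  rewrite <- E.
  replace (x - IZR (up (x * INR s)) / INR s)
    with (- ((IZR (up (x * INR s)) - x * INR s) * / INR s)) by (field; lra).
  pose proof (Rinv_0_lt_compat _ Q).
  rewrite Rabs_Ropp, Rabs_right; nra.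
Qed.

(** Of a subsequence only [n <= psi n] is kept instead of monotonicity; this is stable under
    composition and suffices to pass limits along it ([Un_cv_sub]). *)
Lemma bolzano_weierstrass (v : nat -> R) (M : R) : (forall n, Rabs (v n) <= M) ->
  exists psi : nat -> nat, (forall n, (n <= psi n)%nat) /\
    exists l, Un_cv (fun n => v (psi n)) l.
Proof.
  intros B.
  destruct (Bolzano_Weierstrass v (fun x => - M <= x <= M)) as [l Hl].
  - apply compact_P3.
  - intros n; now apply Rabs_le_between.
  - destruct (functional_choice (fun n p => (n <= p)%nat /\ Rabs (v p - l) < / (INR n + 1))) as [psi H].
    + intros n.
      assert (0 < / (INR n + 1)) by (apply Rinv_0_lt_compat; pose proof (pos_INR n); lra).
      destruct (Hl (disc l (mkposreal _ H)) n) as (p & Hp & D).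
      * exists (mkposreal _ H); intros y Hy; exact Hy.
      * exists p; split; auto.
    + exists psi; split; [intros; apply H|]; exists l; intros e He.
      destruct (archimed_cor1 e He) as (N & HN & PN).
      exists N; intros n Hn; unfold Rdist.
      destruct (H n) as [_ L]; eapply Rlt_trans; [exact L|].
      eapply Rlt_trans; [|exact HN].
      apply Rinv_lt_contravar; apply le_INR in Hn; apply lt_0_INR in PN; nra.
Qed.

Lemma diagonal (u : nat -> nat -> R) (M : R) : (forall k n, Rabs (u k n) <= M) ->
  exists phi : nat -> nat, (forall n, (n <= phi n)%nat) /\
    forall k, exists l, Un_cv (fun n => u k (phi n)) l.
Proof.
  intros B.
  (* One selector for all sequences, so that the recursion [Phi] can apply it at each stage;
     sequences not bounded by [M] get the identity. *)
  destruct (functional_choice (fun (v : nat -> R) (psi : nat -> nat) => (forall n, Rabs (v n) <= M) ->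
    (forall n, (n <= psi n)%nat) /\ exists l, Un_cv (fun n => v (psi n)) l)) as [sel Hsel].
  { intros v; destruct (classic (forall n, Rabs (v n) <= M)) as [H|H].
    - destruct (bolzano_weierstrass v M H) as [psi P]; exists psi; auto.
    - exists (fun n => n); tauto. }
  set (Phi := fix Phi k := match k with
    | 0%nat => fun n : nat => n
    | S k => fun n => Phi k (sel (fun n => u k (Phi k n)) n) end).
  (* Each later selection samples every earlier one at an index that is at least as large. *)
  assert (I : forall j k n, exists t, (n <= t)%nat /\ Phi (j + k)%nat n = Phi k t).
  { induction j as [|j IH]; intros k n; [exists n; auto|].
    destruct (IH k (sel (fun n => u (j + k)%nat (Phi (j + k)%nat n)) n)) as (t & Ht & E).
    exists t; split; [|exact E].
    destruct (Hsel (fun n => u (j + k)%nat (Phi (j + k)%nat n))) as [Q _]; [auto|].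
    specialize (Q n); lia. }
  exists (fun n => Phi n n); split.
  - intros n; destruct (I n 0%nat n) as (t & Ht & E); rewrite Nat.add_0_r in E.
    rewrite E; exact Ht.
  - intros k; destruct (Hsel (fun n => u k (Phi k n))) as (_ & l & Hl); [auto|].
    exists l; intros e He; destruct (Hl e He) as [N HN].
    (* Row [k] converges along [Phi (S k)], and from index [S k] on the diagonal is a sampling of
       it. *)
    exists (N + S k)%nat; intros n Hn.
    destruct (I (n - S k)%nat (S k) n) as (t & Ht & E).
    replace (n - S k + S k)%nat with n in E by lia.
    rewrite E; apply HN; lia.
Qed.

Definition unif_on (L : R) (a : nat -> R -> R) (f : R -> R) : Prop :=
  forall e, 0 < e -> exists N, forall n, (N <= n)%nat ->
    forall x, Rabs x <= L -> Rabs (a n x - f x) <= e.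

Lemma eventually_finite (P : nat -> nat -> Prop) :
  (forall i, exists N, forall n, (N <= n)%nat -> P i n) ->
  forall k, exists N, forall n, (N <= n)%nat -> forall i, (i < k)%nat -> P i n.
Proof.
  intros H; induction k as [|k [N1 IH]].
  - exists 0%nat; intros; lia.
  - destruct (H k) as [N2 H2]; exists (N1 + N2)%nat; intros n Hn i Hi.
    destruct (Nat.eq_dec i k) as [->|]; [apply H2|apply IH]; lia.
Qed.

Lemma Mod_limit (M : R) (a : nat -> R -> R) (f : R -> R) :
  (forall n, Mod M (a n)) -> (forall x, Un_cv (fun n => a n x) (f x)) -> Mod M f.
Proof.
  intros H C; split.
  - intros x; apply le_epsilon; intros e He.
    destruct (C x e He) as [N HN]; specialize (HN N (le_n N)); unfold Rdist in HN.
    pose proof (proj1 (H N) x).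
    replace (f x) with (a N x - (a N x - f x)) by ring.
    eapply Rle_trans; [apply Rabs_triang|]; rewrite Rabs_Ropp; lra.
  - intros d x y Hd Hx; apply le_epsilon; intros e He.
    destruct (C x (e / 2) ltac:(lra)) as [N1 H1], (C y (e / 2) ltac:(lra)) as [N2 H2].
    specialize (H1 (N1 + N2)%nat ltac:(lia)); specialize (H2 (N1 + N2)%nat ltac:(lia)).
    unfold Rdist in H1, H2.
    pose proof (proj2 (H (N1 + N2)%nat) d x y Hd Hx) as H3.
    set (n := (N1 + N2)%nat) in *.
    replace (f x - f y) with ((a n x - a n y) - (a n x - f x) + (a n y - f y)) by ring.
    eapply Rle_trans; [apply Rabs_triang|].
    eapply Rle_trans; [apply Rplus_le_compat_r, Rabs_triang|]; rewrite Rabs_Ropp; lra.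
Qed.

(** Equicontinuity: convergence at the finitely many points of a mesh of width [d ^ 2] gives uniform
    convergence, one third of [e] being spent at the mesh point and one third on each of the two
    moduli. *)
Lemma Mod_unif_on (M L : R) (a : nat -> R -> R) (f : R -> R) : 0 < L ->
  (forall n, Mod M (a n)) -> (forall x, Un_cv (fun n => a n x) (f x)) -> unif_on L a f.
Proof.
  intros HL H C e He.
  pose proof (Mod_limit M a f H C) as Mf.
  pose proof (Mod_pos M f Mf) as PM.
  set (d := Rmin 1 (e / (3 * (M + 1)))).
  assert (P : 0 < e / (3 * (M + 1))) by (apply Rdiv_lt_0_compat; lra).
  assert (0 < d) by (apply Rmin_glb_lt; lra).
  assert (d <= 1) by apply Rmin_l.
  assert (M * d <= e / 3).
  { assert (d <= e / (3 * (M + 1))) as Q by apply Rmin_r.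
    apply (Rmult_le_compat_r (M + 1)) in Q; [|lra].
    replace (e / (3 * (M + 1)) * (M + 1)) with (e / 3) in Q by (field; lra); nra. }
  (* [k] mesh steps of width [d ^ 2] cover [[- L, L]]. *)
  destruct (archimed_cor1 (d ^ 2 / (2 * L + 1))) as (k & Hk & Pk).
  { apply Rdiv_lt_0_compat; nra. }
  destruct (eventually_finite (fun i n =>
    Rabs (a n (- L + INR i * d ^ 2) - f (- L + INR i * d ^ 2)) <= e / 3)) with (k := S (k))
    as [N HN].
  { intros i; destruct (C (- L + INR i * d ^ 2) (e / 3) ltac:(lra)) as [N HN].
    exists N; intros n Hn; left; apply HN, Hn. }
  exists N; intros n Hn x Hx; apply Rabs_le_between in Hx.
  set (t := (x + L) / d ^ 2).
  assert (D2 : 0 < d ^ 2) by nra.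
  assert (Et : x = - L + t * d ^ 2) by (unfold t; field; lra).
  assert (Pt : 0 <= t) by (apply Rmult_le_pos; [lra|left; now apply Rinv_0_lt_compat]).
  destruct (nfloor_ex t Pt) as (i & I1 & I2).
  assert (Lk : (i < S k)%nat).
  { apply INR_lt; rewrite S_INR.
    apply lt_0_INR in Pk.
    assert (2 * L + 1 < d ^ 2 * INR k).
    { apply (Rmult_lt_compat_r (INR k * (2 * L + 1))) in Hk; [|nra].
      replace (/ INR k * (INR k * (2 * L + 1))) with (2 * L + 1) in Hk by (field; lra).
      replace (d ^ 2 / (2 * L + 1) * (INR k * (2 * L + 1))) with (d ^ 2 * INR k) in Hk
        by (field; lra); lra. }
    assert (t * d ^ 2 < INR k * d ^ 2) by lra.
    apply Rmult_lt_reg_r in H4; lra. }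
  specialize (HN n Hn i Lk).
  set (y := - L + INR i * d ^ 2) in *.
  assert (Hy : Rabs (x - y) <= d ^ 2).
  { rewrite Et; unfold y; apply Rabs_le_between; nra. }
  pose proof (proj2 (H n) d x y ltac:(lra) Hy).
  pose proof (proj2 Mf d x y ltac:(lra) Hy).
  replace (a n x - f x) with ((a n x - a n y) + (a n y - f y) - (f x - f y)) by ring.
  eapply Rle_trans; [apply Rabs_triang|].
  eapply Rle_trans; [apply Rplus_le_compat_r, Rabs_triang|]; rewrite Rabs_Ropp; lra.
Qed.

(** The diagonal sequence converges at the rationals, and the common modulus makes it Cauchy
    everywhere else. *)
Lemma ascoli (M : R) (a : nat -> R -> R) : (forall n, Mod M (a n)) ->
  exists phi : nat -> nat, (forall n, (n <= phi n)%nat) /\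
    exists f, forall x, Un_cv (fun n => a (phi n) x) (f x).
Proof.
  intros H.
  destruct (diagonal (fun k n => a n (grid k)) M) as (phi & P & C).
  { intros k n; apply H. }
  exists phi; split; auto.
  destruct (functional_choice (fun x l => Un_cv (fun n => a (phi n) x) l)) as [f Hf]; [|now exists f].
  intros x.
  assert (Cauchy_crit (fun n => a (phi n) x)) as Ca; [|destruct (Rcomplete.R_complete _ Ca) as [l Hl]; now exists l].
  intros e He.
  pose proof (Mod_pos M (a 0%nat) (H 0%nat)) as PM.
  set (d := Rmin 1 (e / (6 * (M + 1)))).
  assert (Q : 0 < e / (6 * (M + 1))) by (apply Rdiv_lt_0_compat; lra).
  assert (0 < d) by (apply Rmin_glb_lt; lra).
  assert (d <= 1) by apply Rmin_l.
  assert (M * d <= e / 6).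
  { assert (d <= e / (6 * (M + 1))) as U by apply Rmin_r.
    apply (Rmult_le_compat_r (M + 1)) in U; [|lra].
    replace (e / (6 * (M + 1)) * (M + 1)) with (e / 6) in U by (field; lra); nra. }
  destruct (grid_dense x (d ^ 2) ltac:(nra)) as [k Hk].
  destruct (C k) as [l Hl]; destruct (Hl (e / 6) ltac:(lra)) as [N HN].
  exists N; intros n m Hn Hm; unfold Rdist in *.
  pose proof (HN n Hn) as Un; pose proof (HN m Hm) as Um.
  pose proof (proj2 (H (phi n)) d x (grid k) ltac:(lra) Hk) as Vn.
  pose proof (proj2 (H (phi m)) d x (grid k) ltac:(lra) Hk) as Vm.
  apply Rabs_lt_between in Un, Um; apply Rabs_le_between in Vn, Vm.
  apply Rabs_lt_between; lra.
Qed.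

Lemma Un_cv_sub (u : nat -> R) (phi : nat -> nat) (l : R) :
  (forall n, (n <= phi n)%nat) -> Un_cv u l -> Un_cv (fun n => u (phi n)) l.
Proof.
  intros P C e He; destruct (C e He) as [N HN]; exists N; intros n Hn; apply HN.
  specialize (P n); lia.
Qed.

Lemma int_unif_limit (L : R) (h : nat -> R -> R) (f : R -> R) : 0 < L ->
  (forall n, Cont (h n)) -> Cont f -> unif_on L h f ->
  forall e, 0 < e -> exists N, forall n, (N <= n)%nat ->
    Rabs (Int (h n) (- L) L - Int f (- L) L) <= e.
Proof.
  intros HL Ch Cf U e He.
  destruct (U (e / (2 * L)) ltac:(apply Rdiv_lt_0_compat; lra)) as [N HN].
  exists N; intros n Hn; rewrite <- int_minus by auto.
  eapply Rle_trans; [apply (int_abs_le _ (e / (2 * L)))|]; cont; [lra| |].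
  - intros x Hx; apply HN; auto; apply Rabs_le_between; lra.
  - right; field; lra.
Qed.

Lemma unif_on_lipschitz (L M C : R) (a b : nat -> R -> R) (f h : R -> R) (G : R -> R -> R) :
  (forall x y x' y', Rabs x <= M -> Rabs y <= M -> Rabs x' <= M -> Rabs y' <= M ->
     Rabs (G x y - G x' y') <= C * (Rabs (x - x') + Rabs (y - y'))) ->
  (forall n x, Rabs (a n x) <= M) -> (forall n x, Rabs (b n x) <= M) ->
  (forall x, Rabs (f x) <= M) -> (forall x, Rabs (h x) <= M) ->
  unif_on L a f -> unif_on L b h -> unif_on L (fun n x => G (a n x) (b n x)) (fun x => G (f x) (h x)).
Proof.
  intros LG Ba Bb Bf Bh Ua Ub e He.
  set (s := e / (2 * (Rabs C + 1))).
  pose proof (Rabs_pos C).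
  assert (Ps : 0 < s) by (apply Rdiv_lt_0_compat; lra).
  destruct (Ua s Ps) as [N1 H1], (Ub s Ps) as [N2 H2].
  exists (N1 + N2)%nat; intros n Hn x Hx.
  specialize (H1 n ltac:(lia) x Hx); specialize (H2 n ltac:(lia) x Hx).
  eapply Rle_trans; [apply LG; auto|].
  apply Rle_trans with (Rabs C * (2 * s)).
  - eapply Rle_trans; [apply Rle_abs|]; rewrite Rabs_mult.
    apply Rmult_le_compat_l; auto.
    pose proof (Rabs_pos (a n x - f x)); pose proof (Rabs_pos (b n x - h x)).
    rewrite Rabs_right; lra.
  - assert (s * (2 * (Rabs C + 1)) = e) by (unfold s; field; lra); nra.
Qed.

(** * The limit of a minimizing sequence solves the system *)

(** Unlike an equation for [Derive_n], this carries the existence of all intermediate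
    derivatives. *)
Fixpoint chain (k : nat) (f F : R -> R) : Prop :=
  match k with
  | 0%nat => forall x, f x = F x
  | S k => exists f', (forall x, is_derive f x (f' x)) /\ chain k f' F
  end.

Fixpoint ndiff (n : nat) (f : R -> R) : Prop :=
  match n with
  | 0%nat => True
  | S n => exists f', (forall x, is_derive f x (f' x)) /\ ndiff n f'
  end.

(** The polynomial supplied by [du_bois_reymond] depends on [r], so [f] is known only through a
    different representative on each [(- r, r)]. Derivatives being local, [Derive f] agrees with all
    of them and the induction continues from it. *)
Lemma chain_local (k : nat) (F : R -> R) : forall f,
  (forall r, 0 < r -> exists h, (forall x, Rabs x < r -> f x = h x) /\ chain k h F) ->
  chain k f F.
Proof.
  induction k as [|k IH]; intros f H.
  - intros x; destruct (H (Rabs x + 1)) as (h & E & C); [pose proof (Rabs_pos x); lra|].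
    rewrite E by lra; apply C.
  - assert (L : forall r h h', (forall x, Rabs x < r -> f x = h x) ->
      (forall x, is_derive h x (h' x)) -> forall x, Rabs x < r -> is_derive f x (h' x)).
    { intros r h h' E D x Hx; apply (is_derive_ext_loc h); [|apply D].
      exists (mkposreal (r - Rabs x) ltac:(lra)); intros y Hy; symmetry; apply E.
      change (Rabs (y - x) < r - Rabs x) in Hy.
      replace y with ((y - x) + x) by ring.
      eapply Rle_lt_trans; [apply Rabs_triang|lra]. }
    exists (Derive f); split.
    + intros x; apply Derive_correct.
      destruct (H (Rabs x + 1)) as (h & E & h' & D & _); [pose proof (Rabs_pos x); lra|].
      exists (h' x); apply (L (Rabs x + 1) h); auto; lra.
    + apply IH; intros r Hr; destruct (H r Hr) as (h & E & h' & D & C).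
      exists h'; split; [|exact C].
      intros x Hx; apply is_derive_unique, (L r h); auto.
Qed.

Lemma chain_Derive_n (k : nat) (F : R -> R) : forall f, chain k f F ->
  forall x, Derive_n f k x = F x.
Proof.
  induction k as [|k IH]; intros f H x; [apply H|].
  destruct H as (f' & D & C).
  replace (S k) with (k + 1)%nat by lia.
  rewrite <- Derive_n_comp, <- (IH f' C x); apply Derive_n_ext.
  intros y; apply is_derive_unique, D.
Qed.

Lemma ndiff_ext (n : nat) (f h : R -> R) : (forall x, f x = h x) -> ndiff n f -> ndiff n h.
Proof.
  destruct n; simpl; auto; intros E (f' & D & C); exists f'; split; auto.
  intros x; apply (is_derive_ext f); auto.
Qed.

Lemma ndiff_pred (n : nat) : forall f, ndiff (S n) f -> ndiff n f.
Proof.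
  induction n as [|n IH]; intros f H; [exact I|].
  destruct H as (f' & D & C); exists f'; split; auto.
Qed.

Lemma ndiff_chain (k n : nat) (F : R -> R) : ndiff n F -> forall f, chain k f F -> ndiff (k + n) f.
Proof.
  intros HF; induction k as [|k IH]; intros f H; simpl.
  - apply (ndiff_ext n F); auto.
  - destruct H as (f' & D & C); exists f'; auto.
Qed.

Lemma ndiff_const (n : nat) : forall c, ndiff n (fun _ => c).
Proof.
  induction n as [|n IH]; intros c; [exact I|].
  exists (fun _ => 0); split; [intros x; auto_derive; auto|apply IH].
Qed.

Lemma ndiff_plus (n : nat) : forall f h, ndiff n f -> ndiff n h -> ndiff n (fun x => f x + h x).
Proof.
  induction n as [|n IH]; intros f h F H; [exact I|].
  destruct F as (f' & DF & F), H as (h' & DH & H).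
  exists (fun x => f' x + h' x); split; [intros x; now apply derive_plus|now apply IH].
Qed.

Lemma ndiff_mult (n : nat) : forall f h, ndiff n f -> ndiff n h -> ndiff n (fun x => f x * h x).
Proof.
  induction n as [|n IH]; intros f h F H; [exact I|].
  pose proof (ndiff_pred n f F) as F0; pose proof (ndiff_pred n h H) as H0.
  destruct F as (f' & DF & F), H as (h' & DH & H).
  exists (fun x => f' x * h x + f x * h' x); split; [intros x; now apply derive_mult|].
  apply (ndiff_plus n (fun x => f' x * h x) (fun x => f x * h' x)); now apply IH.
Qed.

Lemma ndiff_smooth (f : R -> R) : (forall n, ndiff n f) -> smooth f.
Proof.
  intros H [|n] x; [exact I|].
  assert (E : forall k f, ndiff (S k) f -> ex_derive (Derive_n f k) x).
  { induction k as [|k IH]; intros h (h' & D & C).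
    - exists (h' x); apply D.
    - apply (ex_derive_ext (Derive_n h' k)); [|apply IH, C].
      intros y; replace (S k) with (k + 1)%nat by lia.
      rewrite <- Derive_n_comp; apply Derive_n_ext; intros z; symmetry.
      apply is_derive_unique, D. }
  apply E, H.
Qed.

Lemma ndiff_potA (n : nat) (g : R) (f h : R -> R) : ndiff n f -> ndiff n h ->
  ndiff n (fun x => potA g (f x) (h x)).
Proof.
  intros F H; unfold potA; apply (ndiff_mult n f); auto.
  apply (ndiff_plus n (fun x => f x * f x + g * (h x * h x))); [|apply ndiff_const].
  apply (ndiff_plus n (fun x => f x * f x) (fun x => g * (h x * h x))); [now apply ndiff_mult|].
  apply (ndiff_mult n (fun _ => g)); [apply ndiff_const|now apply ndiff_mult].
Qed.

Lemma ndiff_scal (n : nat) (c : R) (f : R -> R) : ndiff n f -> ndiff n (fun x => c * f x).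
Proof. intros; apply (ndiff_mult n (fun _ => c)); auto; apply ndiff_const. Qed.

(** If [A] and [B] have [n] derivatives, so do the right sides, and the equations return [n + 4] and
    [n + 2]; one additional derivative per round is enough. *)
Lemma bootstrap (g c d : R) (A B : R -> R) :
  chain 4 A (fun x => c * potA g (A x) (B x)) ->
  chain 2 B (fun x => d * potB g (A x) (B x)) -> smooth A /\ smooth B.
Proof.
  intros HA HB.
  assert (H : forall n, ndiff n A /\ ndiff n B).
  { induction n as [|n [IA IB]]; [split; exact I|].
    assert (ndiff (4 + n) A) by (eapply ndiff_chain, HA; now apply ndiff_scal, ndiff_potA).
    (* [potB g a b] is convertible to [potA g b a], so [ndiff_potA] applies here too. *)
    assert (ndiff (2 + n) B) by (eapply ndiff_chain, HB; now apply ndiff_scal, ndiff_potA).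
    split; [do 3 apply ndiff_pred|apply ndiff_pred]; auto. }
  split; apply ndiff_smooth; apply H.
Qed.

(** For a polynomial, the difference of two values factors through [x - x'] and [y - y'] with
    polynomial cofactors, which are bounded on the box. *)
Lemma lipschitz_split (M : R) (G P Q : R -> R -> R -> R -> R) (C : R) :
  (forall x y x' y', Rabs x <= M -> Rabs y <= M -> Rabs x' <= M -> Rabs y' <= M ->
    Rabs (P x y x' y') <= C /\ Rabs (Q x y x' y') <= C /\
    G x y x' y' = (x - x') * P x y x' y' + (y - y') * Q x y x' y') ->
  forall x y x' y', Rabs x <= M -> Rabs y <= M -> Rabs x' <= M -> Rabs y' <= M ->
    Rabs (G x y x' y') <= C * (Rabs (x - x') + Rabs (y - y')).
Proof.
  intros H x y x' y' X Y X' Y'; destruct (H x y x' y' X Y X' Y') as (HP & HQ & ->).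
  eapply Rle_trans; [apply Rabs_triang|]; rewrite !Rabs_mult.
  pose proof (Rabs_pos (x - x')); pose proof (Rabs_pos (y - y')); nra.
Qed.

Lemma potA_lipschitz (g M : R) : exists C, forall x y x' y',
  Rabs x <= M -> Rabs y <= M -> Rabs x' <= M -> Rabs y' <= M ->
  Rabs (potA g x y - potA g x' y') <= C * (Rabs (x - x') + Rabs (y - y')).
Proof.
  assert (E : exists C, forall x y x' y', Rabs x <= M -> Rabs y <= M -> Rabs x' <= M -> Rabs y' <= M ->
    Rabs (x * x + g * (y * y) + -1 + x' * (x + x')) <= C).
  { eexists; intros; Rabs_bound. }
  assert (F : exists C, forall x y x' y', Rabs x <= M -> Rabs y <= M -> Rabs x' <= M -> Rabs y' <= M ->
    Rabs (g * (x' * (y + y'))) <= C).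
  { eexists; intros; Rabs_bound. }
  destruct E as [C1 E], F as [C2 F]; exists (Rmax C1 C2).
  apply (lipschitz_split M (fun x y x' y' => potA g x y - potA g x' y')
    (fun x y x' y' => x * x + g * (y * y) + -1 + x' * (x + x'))
    (fun x y x' y' => g * (x' * (y + y')))).
  intros x y x' y' X Y X' Y'.
  split; [eapply Rle_trans; [now apply (E x y x' y')|apply Rmax_l]|].
  split; [eapply Rle_trans; [now apply (F x y x' y')|apply Rmax_r]|].
  unfold potA; ring.
Qed.

Lemma potB_lipschitz (g M : R) : exists C, forall x y x' y',
  Rabs x <= M -> Rabs y <= M -> Rabs x' <= M -> Rabs y' <= M ->
  Rabs (potB g x y - potB g x' y') <= C * (Rabs (x - x') + Rabs (y - y')).
Proof.
  destruct (potA_lipschitz g M) as [C H]; exists C; intros.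
  rewrite (Rplus_comm (Rabs (x - x'))); now apply H.
Qed.

Lemma pot_lipschitz (g M : R) : exists C, forall x y x' y',
  Rabs x <= M -> Rabs y <= M -> Rabs x' <= M -> Rabs y' <= M ->
  Rabs (pot g x y - pot g x' y') <= C * (Rabs (x - x') + Rabs (y - y')).
Proof.
  set (S := fun x y x' y' : R => / 4 * (x * x + y * y + -1 + (x' * x' + y' * y' + -1))).
  set (V := fun x y x' y' : R => (g - 1) / 2 * (x * y + x' * y')).
  assert (E : exists C, forall x y x' y', Rabs x <= M -> Rabs y <= M -> Rabs x' <= M -> Rabs y' <= M ->
    Rabs ((x + x') * S x y x' y' + y * V x y x' y') <= C).
  { unfold S, V; eexists; intros; Rabs_bound. }
  assert (F : exists C, forall x y x' y', Rabs x <= M -> Rabs y <= M -> Rabs x' <= M -> Rabs y' <= M ->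
    Rabs ((y + y') * S x y x' y' + x' * V x y x' y') <= C).
  { unfold S, V; eexists; intros; Rabs_bound. }
  destruct E as [C1 E], F as [C2 F]; exists (Rmax C1 C2).
  apply (lipschitz_split M (fun x y x' y' => pot g x y - pot g x' y')
    (fun x y x' y' => (x + x') * S x y x' y' + y * V x y x' y')
    (fun x y x' y' => (y + y') * S x y x' y' + x' * V x y x' y')).
  intros x y x' y' X Y X' Y'.
  split; [eapply Rle_trans; [now apply (E x y x' y')|apply Rmax_l]|].
  split; [eapply Rle_trans; [now apply (F x y x' y')|apply Rmax_r]|].
  unfold pot, S, V; field.
Qed.

Lemma unif_on_mult (L N : R) (a : nat -> R -> R) (f rho : R -> R) :
  (forall x, Rabs (rho x) <= N) -> unif_on L a f ->
  unif_on L (fun n x => a n x * rho x) (fun x => f x * rho x).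
Proof.
  intros B U e He.
  assert (PN : 0 <= N) by (pose proof (B 0); pose proof (Rabs_pos (rho 0)); lra).
  destruct (U (e / (N + 1)) ltac:(apply Rdiv_lt_0_compat; lra)) as [n0 H].
  exists n0; intros n Hn x Hx; specialize (H n Hn x Hx); specialize (B x).
  rewrite <- Rmult_minus_distr_r, Rabs_mult.
  apply Rle_trans with (e / (N + 1) * (N + 1)); [|right; field; lra].
  apply Rmult_le_compat; auto using Rabs_pos; lra.
Qed.

Lemma unif_on_plus (L : R) (a b : nat -> R -> R) (f h : R -> R) :
  unif_on L a f -> unif_on L b h -> unif_on L (fun n x => a n x + b n x) (fun x => f x + h x).
Proof.
  intros U V e He; destruct (U (e / 2) ltac:(lra)) as [N1 H1], (V (e / 2) ltac:(lra)) as [N2 H2].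
  exists (N1 + N2)%nat; intros n Hn x Hx.
  specialize (H1 n ltac:(lia) x Hx); specialize (H2 n ltac:(lia) x Hx).
  replace (a n x + b n x - (f x + h x)) with ((a n x - f x) + (b n x - h x)) by ring.
  eapply Rle_trans; [apply Rabs_triang|lra].
Qed.

(** The defect is a square because [first_variation] turns a defect [d ^ 2] into a bound [C * d],
    used with [d = / (INR n + 1)]. *)
Record minimizing (eps g M m : R) (p : nat -> profile) (A B : R -> R) : Prop := {
  min_adm : forall n, admissible (p n);
  min_low : energy_bound eps g m;
  min_mass : forall n, mass_le (dens eps g (p n)) (m + (/ (INR n + 1)) ^ 2);
  min_ModA : forall n, Mod M (pA (p n));
  min_ModB : forall n, Mod M (pB (p n));
  min_cvA : forall x, Un_cv (fun n => pA (p n) x) (A x);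
  min_cvB : forall x, Un_cv (fun n => pB (p n) x) (B x) }.

Lemma weak_limit (r C : R) (h : nat -> R -> R) (f : R -> R) : 0 < r ->
  (forall n, Cont (h n)) -> Cont f -> unif_on r h f ->
  (forall n, Rabs (Int (h n) (- r) r) <= C * / (INR n + 1)) -> Int f (- r) r = 0.
Proof.
  intros Hr Ch Cf U H; apply cond_eq; intros e He; rewrite Rminus_0_r.
  destruct (int_unif_limit r h f Hr Ch Cf U (e / 3) ltac:(lra)) as [N1 H1].
  pose proof (Rabs_pos C).
  destruct (archimed_cor1 (e / (3 * (Rabs C + 1)))) as (N2 & H2 & P2).
  { apply Rdiv_lt_0_compat; lra. }
  set (n := (N1 + N2)%nat).
  specialize (H1 n ltac:(lia)); specialize (H n).
  assert (Q : C * / (INR n + 1) <= e / 3).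
  { apply lt_0_INR in P2.
    assert (INR N2 <= INR n) by (apply le_INR; lia).
    assert (/ (INR n + 1) <= e / (3 * (Rabs C + 1))).
    { left; eapply Rle_lt_trans; [|exact H2]; apply Rinv_le_contravar; lra. }
    assert (0 < / (INR n + 1)) by (apply Rinv_0_lt_compat; lra).
    assert ((Rabs C + 1) * (e / (3 * (Rabs C + 1))) = e / 3) by (field; lra).
    pose proof (Rle_abs C); nra. }
  replace (Int f (- r) r) with (Int (h n) (- r) r - (Int (h n) (- r) r - Int f (- r) r)) by ring.
  eapply Rle_lt_trans; [apply Rabs_triang|]; rewrite Rabs_Ropp; lra.
Qed.

Lemma inv_succ_bounds (n : nat) : 0 < / (INR n + 1) <= 1.
Proof.
  pose proof (pos_INR n); split; [apply Rinv_0_lt_compat; lra|].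
  rewrite <- Rinv_1; apply Rinv_le_contravar; lra.
Qed.

(** Trades one primitive on the test function for one on the coefficient. Repetition turns the weak
    equation into orthogonality of one function to all test functions, the hypothesis of
    [du_bois_reymond]. *)
Lemma prim_shift (F G rho : R -> R) (r : R) (k : nat) : 0 < r -> test r (S k) rho ->
  Cont F -> (forall x, is_derive G x (F x)) ->
  Int (fun x => F x * prim r rho x) (- r) r = - Int (fun x => G x * rho x) (- r) r.
Proof.
  intros Hr T CF D; rewrite (int_parts G F (prim r rho) rho); auto; [| |apply T].
  - destruct (test_end r k _ Hr (prim_test r k rho Hr T)) as [-> ->]; ring.
  - intros x; exact (prim_is_derive r (S k) rho x T).
Qed.

(** With [G4] a fourfold primitive of the nonlinearity, the weak equation says that [A + G4]
    annihilates the tests of order 4. Hence it is a cubic on each [(- r, r)], and differentiating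
    four times leaves the equation. *)
Lemma limit_equation_A (eps g M m : R) (p : nat -> profile) (A B : R -> R) :
  0 < eps -> 1 <= g -> minimizing eps g M m p A B ->
  chain 4 A (fun x => - 1 * potA g (A x) (B x)).
Proof.
  intros He Hg H; destruct H as [Ad Lo Ma MA MB CA CB].
  pose proof (Mod_limit M _ A MA CA) as LA; pose proof (Mod_limit M _ B MB CB) as LB.
  pose proof (Mod_Cont M A LA) as CtA; pose proof (Mod_Cont M B LB) as CtB.
  set (F := fun x => potA g (A x) (B x)).
  assert (CF : Cont F) by (unfold F; cont).
  set (G1 := fun x => Int F 0 x); set (G2 := fun x => Int G1 0 x);
    set (G3 := fun x => Int G2 0 x); set (G4 := fun x => Int G3 0 x).
  assert (C1 : Cont G1) by now apply Cont_prim.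
  assert (C2 : Cont G2) by now apply Cont_prim.
  assert (C3 : Cont G3) by now apply Cont_prim.
  assert (C4 : Cont G4) by now apply Cont_prim.
  assert (D1 : forall x, is_derive G1 x (F x)) by (intros; now apply prim_derive).
  assert (D2 : forall x, is_derive G2 x (G1 x)) by (intros; now apply prim_derive).
  assert (D3 : forall x, is_derive G3 x (G2 x)) by (intros; now apply prim_derive).
  assert (D4 : forall x, is_derive G4 x (G3 x)) by (intros; now apply prim_derive).
  apply chain_local; intros r Hr.
  destruct (du_bois_reymond (fun x => A x + G4 x) r 4 Hr) as [c Hc]; [cont| |].
  - intros rho T4.
    set (r3 := prim r rho); set (r2 := prim r r3); set (r1 := prim r r2); set (r0 := prim r r1).
    assert (T3 : test r 3 r3) by now apply prim_test.
    assert (T2 : test r 2 r2) by now apply prim_test.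
    assert (T1 : test r 1 r1) by now apply prim_test.
    assert (T0 : test r 0 r0) by now apply prim_test.
    pose proof (proj1 T4) as Crho; pose proof (proj1 T0) as Cr0.
    transitivity (Int (fun x => A x * rho x + F x * r0 x) (- r) r).
    + rewrite (int_ext _ (fun x => A x * rho x + G4 x * rho x)) by (try lra; intros; ring).
      rewrite !int_plus by cont; f_equal.
      unfold r0; rewrite (prim_shift F G1 r1 r 0) by auto.
      unfold r1; rewrite (prim_shift G1 G2 r2 r 1) by auto.
      unfold r2; rewrite (prim_shift G2 G3 r3 r 2) by auto.
      unfold r3; rewrite (prim_shift G3 G4 rho r 3) by auto.
      ring.
    + destruct (weak_equation_A eps g M r rho He Hg Hr T4) as [C HC].
      destruct (test_bounded r 4 rho Hr T4) as [N1 B1], (test_bounded r 0 r0 Hr T0) as [N2 B2].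
      destruct (potA_lipschitz g M) as [K HK].
      apply (weak_limit r C (fun n x => pA (p n) x * rho x + potA g (pA (p n) x) (pB (p n) x) * r0 x));
        auto.
      * intros n; pose proof (proj1 (Ad n)); cont.
      * cont.
      * apply (unif_on_plus r (fun n x => pA (p n) x * rho x)
          (fun n x => potA g (pA (p n) x) (pB (p n) x) * r0 x)).
        -- apply (unif_on_mult r N1 (fun n => pA (p n))); auto; now apply (Mod_unif_on M).
        -- apply (unif_on_mult r N2 (fun n x => potA g (pA (p n) x) (pB (p n) x))); auto.
           apply (unif_on_lipschitz r M K (fun n => pA (p n)) (fun n => pB (p n)) A B (potA g)); auto;
             try (intros; apply MA || apply MB || apply LA || apply LB); now apply (Mod_unif_on M).
      * intros n; apply (HC m); auto using inv_succ_bounds; intros; [apply MA|apply MB].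
  - exists (fun x => polyval c 4 x - G4 x); split; [intros x Hx; rewrite <- Hc by auto; ring|].
    exists (fun x => c 1%nat + 2 * c 2%nat * x + 3 * c 3%nat * x ^ 2 - G3 x); split.
    { intros x; apply (is_derive_minus (polyval c 4) G4); [unfold polyval; auto_derive; auto; ring|apply D4]. }
    exists (fun x => 2 * c 2%nat + 6 * c 3%nat * x - G2 x); split.
    { intros x; apply (is_derive_minus (fun x => c 1%nat + 2 * c 2%nat * x + 3 * c 3%nat * x ^ 2) G3);
        [auto_derive; auto; ring|apply D3]. }
    exists (fun x => 6 * c 3%nat - G1 x); split.
    { intros x; apply (is_derive_minus (fun x => 2 * c 2%nat + 6 * c 3%nat * x) G2);
        [auto_derive; auto; ring|apply D2]. }
    exists (fun x => 0 - F x); split.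
    { intros x; apply (is_derive_minus (fun x => 6 * c 3%nat) G1);
        [auto_derive; auto; ring|apply D1]. }
    intros x; unfold F; ring.
Qed.

Lemma limit_equation_B (eps g M m : R) (p : nat -> profile) (A B : R -> R) :
  0 < eps -> 1 <= g -> minimizing eps g M m p A B ->
  chain 2 B (fun x => eps ^ 2 * potB g (A x) (B x)).
Proof.
  intros He Hg H; destruct H as [Ad Lo Ma MA MB CA CB].
  pose proof (Mod_limit M _ A MA CA) as LA; pose proof (Mod_limit M _ B MB CB) as LB.
  pose proof (Mod_Cont M A LA) as CtA; pose proof (Mod_Cont M B LB) as CtB.
  set (F := fun x => potB g (A x) (B x)).
  assert (CF : Cont F) by (unfold F; cont).
  set (G1 := fun x => Int F 0 x); set (G2 := fun x => Int G1 0 x).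
  assert (C1 : Cont G1) by now apply Cont_prim.
  assert (C2 : Cont G2) by now apply Cont_prim.
  assert (D1 : forall x, is_derive G1 x (F x)) by (intros; now apply prim_derive).
  assert (D2 : forall x, is_derive G2 x (G1 x)) by (intros; now apply prim_derive).
  apply chain_local; intros r Hr.
  destruct (du_bois_reymond (fun x => - / eps ^ 2 * B x + G2 x) r 2 Hr) as [c Hc]; [cont| |].
  - intros rho T2.
    set (r1 := prim r rho); set (r0 := prim r r1).
    assert (T1 : test r 1 r1) by now apply prim_test.
    assert (T0 : test r 0 r0) by now apply prim_test.
    pose proof (proj1 T2) as Crho; pose proof (proj1 T0) as Cr0.
    transitivity (Int (fun x => B x * (- / eps ^ 2 * rho x) + F x * r0 x) (- r) r).
    + rewrite (int_ext _ (fun x => B x * (- / eps ^ 2 * rho x) + G2 x * rho x)) by (try lra; intros; ring).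
      rewrite !int_plus by cont; f_equal.
      unfold r0; rewrite (prim_shift F G1 r1 r 0) by auto.
      unfold r1; rewrite (prim_shift G1 G2 rho r 1) by auto.
      ring.
    + destruct (weak_equation_B eps g M r rho He Hg Hr T2) as [C HC].
      destruct (test_bounded r 2 rho Hr T2) as [N1 B1], (test_bounded r 0 r0 Hr T0) as [N2 B2].
      destruct (potB_lipschitz g M) as [K HK].
      apply (weak_limit r C (fun n x => pB (p n) x * (- / eps ^ 2 * rho x)
        + potB g (pA (p n) x) (pB (p n) x) * r0 x)); auto.
      * intros n; pose proof (proj1 (Ad n)); cont.
      * cont.
      * apply (unif_on_plus r (fun n x => pB (p n) x * (- / eps ^ 2 * rho x))
          (fun n x => potB g (pA (p n) x) (pB (p n) x) * r0 x)).
        -- apply (unif_on_mult r (Rabs (- / eps ^ 2) * N1) (fun n => pB (p n)));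
             [|now apply (Mod_unif_on M)].
           intros x; apply Rabs_mult_le; auto; apply Rabs_self_le.
        -- apply (unif_on_mult r N2 (fun n x => potB g (pA (p n) x) (pB (p n) x))); auto.
           apply (unif_on_lipschitz r M K (fun n => pA (p n)) (fun n => pB (p n)) A B (potB g)); auto;
             try (intros; apply MA || apply MB || apply LA || apply LB); now apply (Mod_unif_on M).
      * intros n; eapply Rle_trans; [|apply (HC m (p n)); auto using inv_succ_bounds;
          intros; [apply MA|apply MB]].
        right; f_equal; apply int_ext; [lra|]; intros; unfold r0, r1; ring.
  - exists (fun x => eps ^ 2 * (G2 x - polyval c 2 x)); split.
    { intros x Hx; rewrite <- Hc by auto; field; lra. }
    exists (fun x => eps ^ 2 * (G1 x - c 1%nat)); split.
    { intros x; apply derive_scal, (is_derive_minus G2 (polyval c 2)); [apply D2|].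
      unfold polyval; auto_derive; auto; ring. }
    exists (fun x => eps ^ 2 * (F x - 0)); split.
    { intros x; apply derive_scal, (is_derive_minus G1 (fun _ => c 1%nat)); [apply D1|].
      auto_derive; auto. }
    intros x; unfold F; ring.
Qed.

Lemma chains_solve (eps g : R) (A B : R -> R) :
  chain 4 A (fun x => - 1 * potA g (A x) (B x)) ->
  chain 2 B (fun x => eps ^ 2 * potB g (A x) (B x)) -> solves_system eps g A B.
Proof.
  intros HA HB x; rewrite (chain_Derive_n _ _ _ HA x), (chain_Derive_n _ _ _ HB x), !pow2_abs.
  unfold potA, potB; split; ring.
Qed.

(** * Minimizing sequences *)

Lemma int_shift (f : R -> R) (t a b : R) : Cont f ->
  Int (fun x => f (x + t)) a b = Int f (a + t) (b + t).
Proof.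
  intros Cf; rewrite (int_derive (fun x => Int f 0 (x + t))).
  - rewrite <- (int_chasles f 0 (a + t) (b + t)) by auto; ring.
  - intros x; pose proof (prim_derive f 0 (x + t) Cf) as D.
    replace (f (x + t)) with (1 * f (x + t)) by ring.
    apply (is_derive_comp (fun y => Int f 0 y) (fun x => x + t)); auto.
    auto_derive; auto.
  - apply (Cont_comp (fun x => x + t) f); cont.
Qed.

Lemma int_reflect (f : R -> R) (a b : R) : Cont f ->
  Int (fun x => f (- x)) a b = Int f (- b) (- a).
Proof.
  intros Cf; rewrite (int_derive (fun x => - Int f 0 (- x))).
  - rewrite <- (int_chasles f 0 (- b) (- a)) by auto; ring.
  - intros x; pose proof (prim_derive f 0 (- x) Cf) as D.
    replace (f (- x)) with (- ((-1) * f (- x))) by ring.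
    apply (is_derive_opp (fun x => Int f 0 (- x))).
    apply (is_derive_comp (fun y => Int f 0 y) (fun x => - x)); auto.
    auto_derive; auto.
  - apply (Cont_comp (fun x => - x) f); cont.
Qed.

Definition shift (t : R) (p : profile) : profile :=
  Profile (fun x => pA p (x + t)) (fun x => pA1 p (x + t)) (fun x => pA2 p (x + t))
    (fun x => pB p (x + t)) (fun x => pB1 p (x + t)).

Lemma derive_shift (f f' : R -> R) (t x : R) : (forall x, is_derive f x (f' x)) ->
  is_derive (fun x => f (x + t)) x (f' (x + t)).
Proof.
  intros D; replace (f' (x + t)) with (1 * f' (x + t)) by ring.
  apply (is_derive_comp f (fun x => x + t)); auto.
  auto_derive; auto.
Qed.

Lemma shift_admissible (t : R) (p : profile) : admissible p -> admissible (shift t p).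
Proof.
  intros [Rp (T & HT & L1 & L2)]; split; [split; simpl|].
  - intros x; apply derive_shift, Rp.
  - intros x; apply (derive_shift (pA1 p)), Rp.
  - apply (Cont_comp (fun x => x + t) (pA2 p)); cont.
  - intros x; apply (derive_shift (pB p)), Rp.
  - apply (Cont_comp (fun x => x + t) (pB1 p)); cont.
  - pose proof (Rabs_pos t); pose proof (Rle_abs t); pose proof (Rle_abs (- t)).
    rewrite Rabs_Ropp in H1.
    exists (T + Rabs t); split; [lra|]; split; intros x Hx; simpl; [apply L1|apply L2]; lra.
Qed.

Lemma shift_mass (eps g t K : R) (p : profile) : regular p ->
  mass_le (dens eps g p) K -> mass_le (dens eps g (shift t p)) K.
Proof.
  intros Rp H a b ab; change (dens eps g (shift t p)) with (fun x => dens eps g p (x + t)).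
  rewrite int_shift by cont; apply H; lra.
Qed.

Lemma mass_le_weaken (f : R -> R) (K K' : R) : K <= K' -> mass_le f K -> mass_le f K'.
Proof. intros L H a b ab; specialize (H a b ab); lra. Qed.

(** The divisor [k] makes the smoothed modulus fix 1 as well as 0, so the end states survive. Its
    squared slope is at most [/ k ^ 2]; from [k >= 1 - eta] and [eta <= / 4] this is at most
    [1 + 6 * eta]. *)
Lemma smoothed_abs (M b eta : R) : 0 < eta <= / 4 -> Rabs b <= M ->
  let k := sqrt (1 + eta ^ 2) - eta in
  let s := (sqrt (b ^ 2 + eta ^ 2) - eta) / k in
  3 / 4 <= k <= 1 /\ 1 <= (1 + 6 * eta) * k ^ 2 /\ 0 <= s <= 2 * M
    /\ Rabs (s - Rabs b) <= (2 * M + 1) * eta.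
Proof.
  intros He Hb k s.
  pose proof (Rabs_pos b) as Pb.
  assert (Lo : forall y z, 0 <= y -> y ^ 2 <= z -> y <= sqrt z)
    by (intros y z Hy Hz; rewrite <- (sqrt_pow2 y Hy); now apply sqrt_le_1_alt).
  assert (Up : forall y z, 0 <= y -> z <= y ^ 2 -> sqrt z <= y)
    by (intros y z Hy Hz; rewrite <- (sqrt_pow2 y Hy); now apply sqrt_le_1_alt).
  assert (Hk : 1 - eta <= k <= 1).
  { assert (1 <= sqrt (1 + eta ^ 2)) by (apply Lo; nra).
    assert (sqrt (1 + eta ^ 2) <= 1 + eta) by (apply Up; nra).
    unfold k; lra. }
  set (q := sqrt (b ^ 2 + eta ^ 2)) in *.
  assert (Hq : Rabs b <= q <= Rabs b + eta /\ eta <= q).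
  { unfold q; rewrite <- (pow2_abs b); repeat split; [apply Lo|apply Up|apply Lo]; nra. }
  assert (Es : s * k = q - eta) by (unfold s; field; lra).
  assert (0 <= s) by (apply Rmult_le_pos; [lra|left; apply Rinv_0_lt_compat; lra]).
  assert (s <= 2 * M) by nra.
  split; [lra|]; split; [|split].
  - assert ((1 - eta) ^ 2 <= k ^ 2) by nra.
    assert (1 <= (1 + 6 * eta) * (1 - eta) ^ 2) by nra.
    nra.
  - lra.
  - assert (0 <= s * (1 - k) <= 2 * M * eta).
    { split; [apply Rmult_le_pos; lra|apply Rmult_le_compat; lra]. }
    apply Rabs_le_between; nra.
Qed.

(** [Rabs (pB p x)] may fail to be differentiable where [pB p] vanishes, so it would not be
    admissible; [smoothed_abs] replaces it. *)
Lemma nonneg_replacement (eps g K d : R) (p : profile) : 0 < eps -> 1 <= g -> 0 < d ->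
  admissible p -> mass_le (dens eps g p) K ->
  exists q, admissible q /\ mass_le (dens eps g q) (K + d) /\ forall x, 0 <= pB q x.
Proof.
  intros He Hg Hd [Rp (T & HT & L1 & L2)] H.
  pose proof (mass_pos _ _ H) as PK.
  destruct (a_priori eps K He) as (M & PM & AP).
  destruct (AP g p Hg Rp H) as ([BA _] & _ & [BB _]).
  destruct (pot_lipschitz g (2 * M)) as [C HC].
  (* Cost per unit of [eta]: [6 * K] for the larger slope, and the Lipschitz change of the potential
     over [[- T, T]]. Outside that interval [B] is 0 or 1 and does not change. *)
  set (W := 6 * K + 2 * T * (Rabs C * (2 * M + 1)) + 1).
  assert (PW : 0 < W).
  { unfold W; pose proof (Rabs_pos C).
    assert (0 <= T * (Rabs C * (2 * M + 1))) by (apply Rmult_le_pos; nra). lra. }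
  set (eta := Rmin (/ 4) (d / W)).
  assert (PdW : 0 < d / W) by now apply Rdiv_lt_0_compat.
  assert (Heta : 0 < eta <= / 4) by (split; [apply Rmin_glb_lt; lra|apply Rmin_l]).
  assert (EW : eta * W <= d).
  { assert (eta <= d / W) as Q by apply Rmin_r.
    apply (Rmult_le_compat_r W) in Q; [|lra].
    replace (d / W * W) with d in Q by (field; lra); lra. }
  set (k := sqrt (1 + eta ^ 2) - eta).
  set (S := fun b => (sqrt (b ^ 2 + eta ^ 2) - eta) / k).
  pose proof (fun x => smoothed_abs M (pB p x) eta Heta (BB x)) as Q; cbv zeta in Q.
  assert (Pk : 3 / 4 <= k <= 1) by apply (Q 0).
  assert (S0 : S 0 = 0).
  { unfold S; replace (0 ^ 2 + eta ^ 2) with (eta ^ 2) by ring.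
    rewrite sqrt_pow2 by lra; field; lra. }
  assert (S1 : S 1 = 1).
  { unfold S; replace (1 ^ 2 + eta ^ 2) with (1 + eta ^ 2) by ring; fold k; field; lra. }
  assert (Ps : forall b, 0 < sqrt (b ^ 2 + eta ^ 2)) by (intros; apply sqrt_lt_R0; nra).
  set (S' := fun b => b * / (k * sqrt (b ^ 2 + eta ^ 2))).
  assert (DS : forall b, is_derive S b (S' b)).
  { intros b; unfold S, S'; auto_derive.
    - nra.
    - replace (b * (b * 1) + eta * (eta * 1)) with (b ^ 2 + eta ^ 2) by ring.
      specialize (Ps b); field; lra. }
  assert (CS' : Cont S').
  { intros b; apply (@ex_derive_continuous R_AbsRing R_NormedModule).
    unfold S'; auto_derive; split; [nra|split; auto].
    replace (b * (b * 1) + eta * (eta * 1)) with (b ^ 2 + eta ^ 2) by ring.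
    specialize (Ps b); nra. }
  set (q := Profile (pA p) (pA1 p) (pA2 p) (fun x => S (pB p x)) (fun x => pB1 p x * S' (pB p x))).
  assert (Rq : regular q).
  { split; simpl; try apply Rp.
    - intros x; apply (is_derive_comp S (pB p)); [apply DS|apply dB, Rp].
    - apply Cont_mult; [cont|]; apply (Cont_comp (pB p) S'); cont. }
  exists q; split; [split; [exact Rq|]|split].
  - exists T; split; auto; split; intros x Hx; simpl.
    + destruct (L1 x Hx) as (->&->&->&->); rewrite S0, Rmult_0_l; auto.
    + destruct (L2 x Hx) as (->&->&->&->); rewrite S1, Rmult_0_l; auto.
  - apply (mass_local (dens eps g p) (dens eps g q) T K d); cont; [lra|intros; now apply dens_pos| |].
    + intros x Hx; unfold dens; simpl.
      destruct (Rle_dec 0 x) as [P|P].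
      * rewrite Rabs_right in Hx by lra; destruct (L2 x Hx) as (->&->&->&->).
        rewrite S1, Rmult_0_l; lra.
      * rewrite Rabs_left in Hx by lra; destruct (L1 x ltac:(lra)) as (->&->&->&->).
        rewrite S0, Rmult_0_l; lra.
    + set (c := Rabs C * ((2 * M + 1) * eta)).
      apply Rle_trans with (Int (fun x => dens eps g p x + (6 * eta * dens eps g p x + c)) (- T) T).
      * apply int_le; cont; [lra|]; intros x _.
        destruct (Q x) as (_ & Q1 & Q2 & Q3); fold k in Q1, Q2, Q3.
        change ((sqrt (pB p x ^ 2 + eta ^ 2) - eta) / k) with (S (pB p x)) in Q2, Q3.
        assert (E1 : pot g (pA p x) (S (pB p x)) <= pot g (pA p x) (pB p x) + c).
        { rewrite <- (pot_abs g (pA p x) (pB p x)).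
          assert (BM : forall y, Rabs y <= M -> Rabs y <= 2 * M) by (intros; lra).
          assert (X := HC (pA p x) (S (pB p x)) (pA p x) (Rabs (pB p x)) (BM _ (BA x))
            ltac:(rewrite Rabs_right; lra) (BM _ (BA x)) ltac:(rewrite Rabs_Rabsolu; auto)).
          rewrite (Rminus_diag_eq (pA p x) (pA p x) eq_refl), Rabs_R0, Rplus_0_l in X.
          pose proof (Rle_abs (pot g (pA p x) (S (pB p x)) - pot g (pA p x) (Rabs (pB p x)))).
          assert (C * Rabs (S (pB p x) - Rabs (pB p x)) <= c); [|lra].
          unfold c; apply Rle_trans with (Rabs C * Rabs (S (pB p x) - Rabs (pB p x))).
          - apply Rmult_le_compat_r; [apply Rabs_pos|apply Rle_abs].
          - apply Rmult_le_compat_l; [apply Rabs_pos|auto]. }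
        assert (E2 : (pB1 p x * S' (pB p x)) ^ 2 <= (1 + 6 * eta) * pB1 p x ^ 2).
        { assert (S' (pB p x) ^ 2 <= 1 + 6 * eta).
          { set (b := pB p x); unfold S'.
            assert (Eq : (b * / (k * sqrt (b ^ 2 + eta ^ 2))) ^ 2
              = b ^ 2 * / (k ^ 2 * (b ^ 2 + eta ^ 2))).
            { rewrite <- (pow2_sqrt (b ^ 2 + eta ^ 2)) at 2 by nra.
              specialize (Ps b); field; lra. }
            rewrite Eq.
            assert (Pd : 0 < k ^ 2 * (b ^ 2 + eta ^ 2)) by (apply Rmult_lt_0_compat; nra).
            apply (Rmult_le_reg_r (k ^ 2 * (b ^ 2 + eta ^ 2))); auto.
            rewrite Rmult_assoc, Rinv_l by lra.
            pose proof (pow2_ge_0 b); nra. }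
          rewrite Rpow_mult_distr; pose proof (pow2_ge_0 (pB1 p x)); nra. }
        destruct (dens_parts eps g p x He Hg) as (E3 & E4 & E5).
        assert (Ie : 0 < / (2 * eps ^ 2)) by (apply Rinv_0_lt_compat; nra).
        apply (Rmult_le_compat_r (/ (2 * eps ^ 2))) in E2; [|lra].
        unfold dens; simpl pA; simpl pA2; simpl pB; simpl pB1.
        unfold Rdiv in *; nra.
      * rewrite !int_plus, int_scal, int_const by cont.
        specialize (H (- T) T ltac:(lra)).
        assert (6 * eta * Int (dens eps g p) (- T) T <= 6 * eta * K)
          by (apply Rmult_le_compat_l; lra).
        unfold W, c in *; lra.
  - intros x; simpl; apply (Q x).
Qed.

Lemma infimum_energy (eps g : R) : 0 < eps -> 1 <= g ->
  (exists p K, admissible p /\ mass_le (dens eps g p) K) ->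
  exists m, energy_bound eps g m /\
    forall d, 0 < d -> exists p, admissible p /\ mass_le (dens eps g p) (m + d).
Proof.
  intros He Hg (p0 & K0 & A0 & H0).
  destruct (completeness (fun y => exists p, admissible p /\ mass_le (dens eps g p) (- y)))
    as [l [U L]].
  - exists 0; intros y (p & _ & H); apply mass_pos in H; lra.
  - exists (- K0), p0; rewrite Ropp_involutive; auto.
  - exists (- l); split.
    + intros p K A H; assert (- K <= l); [|lra].
      apply U; exists p; rewrite Ropp_involutive; auto.
    + intros d Hd; apply NNPP; intros N.
      assert (l <= l - d); [|lra].
      apply L; intros y (p & A & H); apply Rnot_lt_le; intros Y.
      apply N; exists p; split; auto; apply (mass_le_weaken _ (- y)); auto; lra.
Qed.

Lemma normalized_sequence (eps g m : R) : 0 < eps -> 1 <= g ->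
  (forall d, 0 < d -> exists p, admissible p /\ mass_le (dens eps g p) (m + d)) ->
  exists p : nat -> profile, forall n, admissible (p n) /\
    mass_le (dens eps g (p n)) (m + (/ (INR n + 1)) ^ 2) /\
    (forall x, 0 <= pB (p n) x) /\ pB (p n) 0 = / 2.
Proof.
  intros He Hg H; apply (functional_choice (fun n p => admissible p /\
    mass_le (dens eps g p) (m + (/ (INR n + 1)) ^ 2) /\
    (forall x, 0 <= pB p x) /\ pB p 0 = / 2)).
  intros n; set (d := (/ (INR n + 1)) ^ 2).
  assert (Pd : 0 < d) by (apply pow_lt, inv_succ_bounds).
  (* Half of the defect is spent on near-minimality, the other half on making [B] nonnegative. *)
  destruct (H (d / 2) ltac:(lra)) as (p & Ap & Mp).
  destruct (nonneg_replacement eps g (m + d / 2) (d / 2) p) as (q & Aq & Mq & Pq); auto; [lra|].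
  replace (m + d / 2 + d / 2) with (m + d) in Mq by field.
  destruct Aq as [Rq Cq] eqn:EA; destruct Cq as (T & HT & L1 & L2).
  destruct (IVT_gen (pB q) (- T) T (/ 2)) as (t & _ & Et).
  { intros x; apply continuity_pt_filterlim, cB, Rq. }
  { destruct (L1 (- T) ltac:(lra)) as (_ & -> & _), (L2 T ltac:(lra)) as (_ & -> & _).
    rewrite Rmin_left, Rmax_right; lra. }
  exists (shift t q); split; [apply shift_admissible, Aq|]; split; [now apply shift_mass|].
  split; simpl; [auto|]; rewrite Rplus_0_l; exact Et.
Qed.

(** * A twice differentiable cutoff built from truncated powers *)

Lemma derive_eq (f : R -> R) (x a b : R) : is_derive f x a -> a = b -> is_derive f x b.
Proof. now intros D <-. Qed.

Lemma derive_id (x : R) : is_derive (fun y : R => y) x 1.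
Proof. auto_derive; auto. Qed.

Lemma derive_id_abs (x : R) : is_derive (fun y => y * Rabs y) x (2 * Rabs x).
Proof.
  destruct (Req_dec x 0) as [->|N].
  (* At 0 the difference quotient is [Rabs h]. *)
  - rewrite Rabs_R0, Rmult_0_r; apply is_derive_Reals; intros e He.
    exists (mkposreal e He); intros h Hh Lh.
    rewrite Rplus_0_l, Rmult_0_l, !Rminus_0_r; unfold Rdiv.
    rewrite (Rmult_comm h), Rmult_assoc, Rinv_r, Rmult_1_r, Rabs_Rabsolu by auto; exact Lh.
  - pose proof (is_derive_Rabs (fun y => y) x 1 (derive_id x) N) as D.
    replace (2 * Rabs x) with (1 * Rabs x + x * (sign x * 1)).
    + apply (derive_mult (fun y => y) Rabs); [apply derive_id|exact D].
    + destruct (Rlt_dec x 0).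
      * rewrite sign_eq_m1, Rabs_left; lra.
      * rewrite sign_eq_1, Rabs_right; lra.
Qed.

(* [ramp j x = max 0 x ^ j] for [j = 1, 2, 3]. *)
Definition ramp (j : nat) (x : R) : R :=
  match j with
  | 1%nat => (x + Rabs x) / 2
  | 2%nat => (x ^ 2 + x * Rabs x) / 2
  | _ => (x ^ 3 + x * (x * Rabs x)) / 2
  end.

Lemma ramp_neg (j : nat) (x : R) : x <= 0 -> ramp j x = 0.
Proof. intros H; destruct j as [|[|[|j]]]; simpl; rewrite Rabs_left1 by auto; field. Qed.

Lemma ramp_pos (x : R) : 0 <= x -> ramp 1 x = x /\ ramp 2 x = x ^ 2 /\ ramp 3 x = x ^ 3.
Proof. intros H; simpl; rewrite Rabs_right by lra; repeat split; field. Qed.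

Lemma ramp3_derive (x : R) : is_derive (ramp 3) x (3 * ramp 2 x).
Proof.
  unfold ramp; apply (is_derive_ext (fun y => / 2 * (y ^ 3 + y * (y * Rabs y)))); [intros; simpl; field|].
  eapply derive_eq.
  - apply derive_scal, (derive_plus (fun y => y ^ 3)); [auto_derive; auto|].
    apply (derive_mult (fun y => y)); [apply derive_id|apply derive_id_abs].
  - simpl; field.
Qed.

Lemma ramp2_derive (x : R) : is_derive (ramp 2) x (2 * ramp 1 x).
Proof.
  unfold ramp; apply (is_derive_ext (fun y => / 2 * (y ^ 2 + y * Rabs y))); [intros; simpl; field|].
  eapply derive_eq.
  - apply derive_scal, (derive_plus (fun y => y ^ 2)); [auto_derive; auto|apply derive_id_abs].
  - simpl; field.
Qed.

(* The integrated quadratic B-spline: a C^2 step from 0 to 1 across [0, 3]. *)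
Definition spline (j : nat) (x : R) : R :=
  ramp j x - 3 * ramp j (x - 1) + 3 * ramp j (x - 2) - ramp j (x - 3).
Definition step (x : R) : R := / 6 * spline 3 x.
Definition step1 (x : R) : R := / 2 * spline 2 x.
Definition step2 (x : R) : R := spline 1 x.

Lemma spline_derive (i j : nat) (c x : R) :
  (forall y, is_derive (ramp i) y (c * ramp j y)) ->
  is_derive (spline i) x (c * spline j x).
Proof.
  intros D; unfold spline.
  assert (S : forall t, is_derive (fun y => ramp i (y - t)) x (c * ramp j (x - t)))
    by (intros t; apply (derive_shift (ramp i) (fun y => c * ramp j y) (- t)); exact D).
  apply (derive_eq _ _
    (c * ramp j x - 3 * (c * ramp j (x - 1)) + 3 * (c * ramp j (x - 2)) - c * ramp j (x - 3)));
    [|ring].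
  apply (is_derive_minus (fun x => ramp i x - 3 * ramp i (x - 1) + 3 * ramp i (x - 2))); auto.
  apply (derive_plus (fun x => ramp i x - 3 * ramp i (x - 1))); [|now apply derive_scal].
  apply (is_derive_minus (ramp i)); [apply D|now apply derive_scal].
Qed.

Lemma step_derive (x : R) : is_derive step x (step1 x).
Proof.
  eapply derive_eq; [apply derive_scal, spline_derive, ramp3_derive|unfold step1; field].
Qed.

Lemma step1_derive (x : R) : is_derive step1 x (step2 x).
Proof.
  eapply derive_eq; [apply derive_scal, spline_derive, ramp2_derive|unfold step2; field].
Qed.

Lemma step2_Cont : Cont step2.
Proof.
  assert (H : forall t, Cont (fun x => ramp 1 (x - t))) by (intros; unfold ramp; cont).
  unfold step2, spline; cont; unfold ramp; cont.
Qed.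
#[export] Hint Resolve step2_Cont : cont.

Lemma step_left (x : R) : x <= 0 -> step x = 0 /\ step1 x = 0 /\ step2 x = 0.
Proof.
  intros; unfold step, step1, step2, spline; rewrite !ramp_neg by lra; repeat split; ring.
Qed.

(** Decides by [lra] the sign of the argument, then rewrites its ramps to zero or to plain
    powers. *)
Ltac ramp_expand x :=
  let H := fresh in
  first [ rewrite (ramp_neg 1 x), (ramp_neg 2 x), (ramp_neg 3 x) by lra
        | destruct (ramp_pos x ltac:(lra)) as (H & -> & ->); rewrite H; clear H ].

Lemma step_right (x : R) : 3 <= x -> step x = 1 /\ step1 x = 0 /\ step2 x = 0.
Proof.
  intros; unfold step, step1, step2, spline.
  ramp_expand x; ramp_expand (x - 1); ramp_expand (x - 2); ramp_expand (x - 3).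
  repeat split; field.
Qed.

Lemma step_bounds (x : R) : 0 <= step x <= 1 /\ Rabs (step1 x) <= 1 /\ Rabs (step2 x) <= 2.
Proof.
  destruct (Rle_dec x 0) as [H0|H0].
  { destruct (step_left x H0) as (-> & -> & ->); rewrite Rabs_R0; lra. }
  destruct (Rle_dec 3 x) as [H3|H3].
  { destruct (step_right x H3) as (-> & -> & ->); rewrite Rabs_R0; lra. }
  unfold step, step1, step2, spline.
  ramp_expand x; ramp_expand (x - 3).
  (* On each unit piece the spline is a cubic in a variable of [[0, 1]]; these inequalities make the
     bounds linear in its powers. The last piece is read backwards from 3. *)
  assert (U : forall y, 0 <= y <= 1 -> 0 <= y ^ 2 <= 1 /\ 0 <= y ^ 3 <= y /\ 3 * y ^ 2 - 2 * y ^ 3 <= 1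
    /\ y - y ^ 2 <= / 4).
  { intros y Hy; pose proof (pow2_ge_0 (y - / 2)); pose proof (Rmult_le_pos ((1 - y) ^ 2) (1 + 2 * y) (pow2_ge_0 _) ltac:(lra)).
    assert (0 <= y ^ 2 <= 1) by nra.
    assert (0 <= y * y ^ 2 <= y * 1) by (split; [apply Rmult_le_pos|apply Rmult_le_compat_l]; lra).
    repeat split; lra. }
  destruct (Rle_dec x 1); [|destruct (Rle_dec x 2)]; ramp_expand (x - 1); ramp_expand (x - 2).
  - specialize (U x ltac:(lra)); split; [lra|split; apply Rabs_le_between; lra].
  - specialize (U (x - 1) ltac:(lra)); set (y := x - 1) in *.
    assert (0 <= y <= 1) by (unfold y; lra).
    replace x with (1 + y) by (unfold y; ring).
    split; [lra|split; apply Rabs_le_between; lra].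
  - specialize (U (3 - x) ltac:(lra)); set (z := 3 - x) in *.
    assert (0 <= z <= 1) by (unfold z; lra).
    replace (x - 1) with (2 - z) by (unfold z; ring).
    replace (x - 2) with (1 - z) by (unfold z; ring).
    replace x with (3 - z) by (unfold z; ring).
    split; [lra|split; apply Rabs_le_between; lra].
Qed.

(** * Trial profiles and limits at infinity *)

Lemma scaled_derive (f f' : R -> R) (c x : R) : (forall y, is_derive f y (f' y)) ->
  is_derive (fun y => f (y * c)) x (f' (x * c) * c).
Proof.
  intros D; eapply derive_eq.
  - apply (is_derive_comp f (fun y => y * c)); [apply D|auto_derive; auto].
  - simpl; unfold scal; simpl; unfold mult; simpl; ring.
Qed.

(** On the unit circle the first term of [pot] vanishes and the second is at most [(g - 1) / 2].
    Stretching the turn by [L] makes the derivative terms at most [C0 / L ^ 2], using [L >= 1] for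
    the higher powers. Both are integrated over [[- 3 * L, 3 * L]], of length [6 * L]. *)
Lemma trial (eps : R) : 0 < eps -> exists C, 0 < C /\ forall g L, 1 <= g -> 1 <= L ->
  exists p, admissible p /\ mass_le (dens eps g p) (C / L + 3 * (g - 1) * L).
Proof.
  intros He; assert (Ie : 0 < / (2 * eps ^ 2)) by (apply Rinv_0_lt_compat; nra).
  set (C0 := 32 + 4 * / (2 * eps ^ 2)).
  exists (6 * C0); split; [unfold C0; lra|]; intros g L Hg HL.
  set (c := / L).
  assert (Hc : 0 < c <= 1).
  { unfold c; split; [apply Rinv_0_lt_compat; lra|].
    rewrite <- Rinv_1; apply Rinv_le_contravar; lra. }
  assert (cL : c * L = 1) by (unfold c; field; lra).
  set (th := fun x => PI / 2 * step (x * c)).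
  set (th1 := fun x => PI / 2 * (step1 (x * c) * c)).
  set (th2 := fun x => PI / 2 * (step2 (x * c) * c * c)).
  assert (D0 : forall x, is_derive th x (th1 x)).
  { intros x; apply derive_scal, scaled_derive, step_derive. }
  assert (D1 : forall x, is_derive th1 x (th2 x)).
  { intros x; apply derive_scal; eapply derive_eq.
    - apply (derive_mult (fun y => step1 (y * c)) (fun _ => c));
        [apply scaled_derive, step1_derive|auto_derive; auto].
    - simpl; ring. }
  assert (C2 : Cont th2).
  { unfold th2; repeat apply Cont_mult; cont.
    apply (Cont_comp (fun x => x * c) step2); cont. }
  pose proof (Cont_derive _ _ D0) as CT0; pose proof (Cont_derive _ _ D1) as CT1.
  assert (Dc : forall x, is_derive (fun y => cos (th y)) x (- (sin (th x) * th1 x))).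
  { intros x; eapply derive_eq; [apply (is_derive_comp cos th); [apply is_derive_cos|apply D0]|].
    simpl; unfold scal; simpl; unfold mult; simpl; ring. }
  assert (Ds : forall x, is_derive (fun y => sin (th y)) x (cos (th x) * th1 x)).
  { intros x; eapply derive_eq; [apply (is_derive_comp sin th); [apply is_derive_sin|apply D0]|].
    simpl; unfold scal; simpl; unfold mult; simpl; ring. }
  pose proof (Cont_derive _ _ Dc) as Cc; pose proof (Cont_derive _ _ Ds) as Cs.
  set (p := Profile (fun x => cos (th x)) (fun x => - (sin (th x) * th1 x))
    (fun x => - (cos (th x) * th1 x * th1 x + sin (th x) * th2 x))
    (fun x => sin (th x)) (fun x => cos (th x) * th1 x)).
  assert (Rp : regular p).
  { split; simpl; auto.
    - intros x; apply (is_derive_opp (fun y => sin (th y) * th1 y)).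
      now apply (derive_mult (fun y => sin (th y)) th1).
    - cont.
    - cont. }
  assert (E1 : forall x, x <= 0 -> th x = 0 /\ th1 x = 0 /\ th2 x = 0).
  { intros x Hx; unfold th, th1, th2; destruct (step_left (x * c)) as (-> & -> & ->); [nra|].
    repeat split; ring. }
  assert (E2 : forall x, 3 * L <= x -> th x = PI / 2 /\ th1 x = 0 /\ th2 x = 0).
  { intros x Hx; unfold th, th1, th2; destruct (step_right (x * c)) as (-> & -> & ->); [nra|].
    repeat split; ring. }
  exists p; split; [split; [exact Rp|]|].
  - exists (3 * L); split; [lra|]; split; intros x Hx; simpl.
    + destruct (E1 x ltac:(lra)) as (->&->&->); rewrite cos_0, sin_0; repeat split; ring.
    + destruct (E2 x ltac:(lra)) as (->&->&->); rewrite cos_PI2, sin_PI2; repeat split; ring.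
  - replace (6 * C0 / L + 3 * (g - 1) * L) with (0 + (6 * C0 / L + 3 * (g - 1) * L)) by ring.
    apply (mass_local (fun _ => 0) (dens eps g p) (3 * L)); cont; [lra|intros; now apply dens_pos| | |].
    + intros x Hx; unfold dens, pot; simpl pA; simpl pA2; simpl pB; simpl pB1.
      destruct (Rle_dec 0 x) as [P|P].
      * rewrite Rabs_right in Hx by lra; destruct (E2 x Hx) as (->&->&->).
        rewrite cos_PI2, sin_PI2; right; field; lra.
      * destruct (E1 x ltac:(lra)) as (->&->&->); rewrite cos_0, sin_0; right; field; lra.
    + rewrite int_const, Rmult_0_r, Rplus_0_l.
      apply Rle_trans with (Int (fun _ => C0 * c ^ 2 + (g - 1) / 2) (- (3 * L)) (3 * L)).
      2: { rewrite int_const; right; unfold Rdiv; fold c.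
           replace ((3 * L - - (3 * L)) * (C0 * c ^ 2 + (g - 1) * / 2))
             with (6 * C0 * c * (c * L) + 3 * (g - 1) * L) by field.
           rewrite cL; ring. }
      apply int_le; cont; [lra|]; intros x _.
      destruct (step_bounds (x * c)) as (_ & B1 & B2).
      assert (PB : 0 <= PI / 2 <= 2) by (pose proof PI_4; pose proof PI_RGT_0; lra).
      assert (Sq : forall y z, Rabs y <= z -> y ^ 2 <= z ^ 2)
        by (intros y z Y; rewrite <- (pow2_abs y); apply pow_incr; split; [apply Rabs_pos|auto]).
      pose proof (pow_incr (PI / 2) 2 2 PB) as PB2.
      apply Sq in B1, B2; clear Sq.
      assert (C4 : c ^ 2 * c ^ 2 <= c ^ 2).
      { assert (0 <= c ^ 2 <= 1) by nra.
        rewrite <- (Rmult_1_r (c ^ 2)) at 3; apply Rmult_le_compat_l; lra. }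
      assert (F1 : th1 x ^ 2 <= 4 * c ^ 2).
      { unfold th1.
        replace ((PI / 2 * (step1 (x * c) * c)) ^ 2)
          with ((PI / 2) ^ 2 * step1 (x * c) ^ 2 * c ^ 2) by ring.
        apply Rmult_le_compat_r; [apply pow2_ge_0|].
        replace 4 with (4 * 1) by ring; apply Rmult_le_compat; try apply pow2_ge_0; lra. }
      assert (F2 : th2 x ^ 2 <= 16 * c ^ 2).
      { unfold th2.
        replace ((PI / 2 * (step2 (x * c) * c * c)) ^ 2)
          with ((PI / 2) ^ 2 * step2 (x * c) ^ 2 * c ^ 2 * c ^ 2) by ring.
        apply Rle_trans with (16 * (c ^ 2 * c ^ 2)); [rewrite <- Rmult_assoc|nra].
        apply Rmult_le_compat_r; [apply pow2_ge_0|].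
        apply Rmult_le_compat_r; [apply pow2_ge_0|].
        replace 16 with (4 * 4) by ring; apply Rmult_le_compat; try apply pow2_ge_0; lra. }
      assert (F3 : (th1 x ^ 2) ^ 2 <= 16 * c ^ 2).
      { pose proof (pow2_ge_0 (th1 x)).
        apply Rle_trans with ((4 * c ^ 2) ^ 2); [apply pow_incr; lra|].
        nra. }
      pose proof (COS_bound (th x)) as [? ?]; pose proof (SIN_bound (th x)) as [? ?].
      assert (Sq : sin (th x) ^ 2 + cos (th x) ^ 2 = 1).
      { pose proof (sin2_cos2 (th x)); unfold Rsqr in *; lra. }
      unfold dens, pot; simpl pA; simpl pA2; simpl pB; simpl pB1.
      set (u := cos (th x)) in *; set (v := sin (th x)) in *.
      set (a := th1 x) in *; set (b := th2 x) in *.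
      assert (Pu := pow2_ge_0 u); assert (Pv := pow2_ge_0 v).
      (* The Cauchy-Schwarz inequality, by Lagrange's identity with [u ^ 2 + v ^ 2 = 1]. *)
      assert (G1 : (- (u * a * a + v * b)) ^ 2 <= (a ^ 2) ^ 2 + b ^ 2).
      { assert ((- (u * a * a + v * b)) ^ 2
          = (v ^ 2 + u ^ 2) * ((a ^ 2) ^ 2 + b ^ 2) - (v * a ^ 2 - u * b) ^ 2) as -> by ring.
        rewrite Sq; pose proof (pow2_ge_0 (v * a ^ 2 - u * b)); lra. }
      assert (G2 : (u * a) ^ 2 <= 4 * c ^ 2).
      { rewrite Rpow_mult_distr; pose proof (pow2_ge_0 a); nra. }
      assert (G3 : (u * a) ^ 2 / (2 * eps ^ 2) <= 4 * c ^ 2 * / (2 * eps ^ 2))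
        by (apply Rmult_le_compat_r; lra).
      assert (G4 : u ^ 2 * v ^ 2 <= 1) by nra.
      replace (u ^ 2 + v ^ 2 - 1) with 0 by lra.
      assert (G5 : (g - 1) / 2 * (u ^ 2 * v ^ 2) <= (g - 1) / 2 * 1)
        by (apply Rmult_le_compat_l; lra).
      unfold C0; nra.
    + intros a b ab; rewrite int_const; lra.
Qed.

Lemma abs_le_sq (x t : R) : 0 <= t -> x ^ 2 <= t ^ 2 -> Rabs x <= t.
Proof.
  intros Ht H; rewrite <- (pow2_abs x) in H; pose proof (Rabs_pos x).
  apply Rnot_lt_le; intros L; nra.
Qed.

(** Here [1 < g] is essential: at [g = 1] the potential vanishes on the whole circle and says
    nothing about [a ^ 2 * b ^ 2]. *)
Lemma pot_small (g t : R) : 1 < g -> 0 < t -> exists s, 0 < s /\ forall a b,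
  pot g a b <= s -> Rabs (a ^ 2 + b ^ 2 - 1) <= t /\ a ^ 2 * b ^ 2 <= t.
Proof.
  intros Hg Ht; exists (Rmin (t ^ 2 / 4) ((g - 1) / 2 * t)).
  assert (Pgt : 0 < (g - 1) / 2 * t) by (apply Rmult_lt_0_compat; lra).
  split; [apply Rmin_glb_lt; auto; nra|]; intros a b H.
  pose proof (Rmin_l (t ^ 2 / 4) ((g - 1) / 2 * t)).
  pose proof (Rmin_r (t ^ 2 / 4) ((g - 1) / 2 * t)).
  pose proof (pow2_ge_0 (a ^ 2 + b ^ 2 - 1)) as P1.
  assert (P2 : 0 <= a ^ 2 * b ^ 2) by (apply Rmult_le_pos; apply pow2_ge_0).
  assert (P3 : 0 <= (g - 1) / 2 * (a ^ 2 * b ^ 2)) by (apply Rmult_le_pos; lra).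
  unfold pot in H; split.
  - apply abs_le_sq; nra.
  - apply (Rmult_le_reg_l ((g - 1) / 2)); lra.
Qed.

(** By [Mod_integral_gap] each visit to the level [s] costs at least [kappa]. If visits never
    ceased, they could be chosen on disjoint unit intervals and would exceed any budget [K]. *)
Lemma tail_small (C K s : R) (h : R -> R) : 0 < s -> Mod C h -> (forall x, 0 <= h x) ->
  (forall b, 0 <= b -> Int h 0 b <= K) -> exists r, 0 < r /\ forall x, r <= x -> h x <= s.
Proof.
  intros Hs M P H; apply NNPP; intros N.
  destruct (Mod_integral_gap C s Hs) as (kappa & Pk & Gap).
  pose proof (Mod_Cont C h M) as Ch.
  assert (Q : forall n : nat, exists b, 0 <= b /\ INR n * kappa <= Int h 0 b).
  { induction n as [|n (b & Hb & I)].
    - exists 0; unfold Int; rewrite RInt_point; simpl; split; [lra|].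
      rewrite Rmult_0_l; apply Rle_refl.
    - assert (E : exists x, b + 1 <= x /\ s <= h x).
      { apply NNPP; intros E; apply N; exists (b + 1); split; [lra|]; intros x Hx.
        apply Rnot_lt_le; intros L; apply E; exists x; lra. }
      destruct E as (x & Hx & Lx); exists (x + 1); split; [lra|].
      rewrite <- (int_chasles h 0 x (x + 1)) by auto.
      pose proof (Gap h M P x Lx).
      assert (Int h 0 b <= Int h 0 x) by (apply int_mono; auto; lra).
      rewrite S_INR; lra. }
  assert (PK : 0 <= K).
  { specialize (H 0 ltac:(lra)); unfold Int in H; rewrite RInt_point in H; exact H. }
  destruct (archimed_cor1 (kappa / (K + 1))) as (n & Hn & Pn).
  { apply Rdiv_lt_0_compat; lra. }
  destruct (Q n) as (b & Hb & I); specialize (H b Hb).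
  apply lt_0_INR in Pn.
  apply (Rmult_lt_compat_r (INR n * (K + 1))) in Hn; [|nra].
  replace (/ INR n * (INR n * (K + 1))) with (K + 1) in Hn by (field; lra).
  replace (kappa / (K + 1) * (INR n * (K + 1))) with (INR n * kappa) in Hn by (field; lra).
  lra.
Qed.

Lemma constant_side (f : R -> R) (r c : R) : Cont f -> (forall x, r <= x -> f x <> c) ->
  (forall x, r <= x -> f x < c) \/ (forall x, r <= x -> c < f x).
Proof.
  intros Cf N.
  assert (V : forall x, r <= x -> Rmin (f r) (f x) <= c <= Rmax (f r) (f x) -> False).
  { intros x Hx Hc; destruct (IVT_gen f r x c) as (y & Hy & E); auto.
    - intros z; apply continuity_pt_filterlim, Cf.
    - rewrite Rmin_left in Hy by auto; apply (N y); lra. }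
  destruct (Rtotal_order (f r) c) as [L|[E|L]].
  - left; intros x Hx; apply Rnot_le_lt; intros U; apply (V x Hx).
    rewrite Rmin_left, Rmax_right; lra.
  - exfalso; apply (N r); lra.
  - right; intros x Hx; apply Rnot_le_lt; intros U; apply (V x Hx).
    rewrite Rmin_right, Rmax_left; lra.
Qed.

(** Where the potential is small, [B] cannot equal 1/2, so by connectedness it stays on one side of
    1/2 on a tail. If it stays below, [A] cannot vanish and keeps its sign. This selects the well,
    and the decay of the potential gives convergence to it. *)
Lemma well_limit (g C K : R) (A B : R -> R) : 1 < g -> Mod C A -> Mod C B ->
  (forall x, 0 <= B x) -> (forall b, 0 <= b -> Int (fun x => pot g (A x) (B x)) 0 b <= K) ->
  exists a b, ((a = 1 \/ a = -1) /\ b = 0 \/ a = 0 /\ b = 1) /\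
    forall e, 0 < e -> exists r, 0 < r /\ forall x, r <= x -> Rabs (A x - a) <= e /\ Rabs (B x - b) <= e.
Proof.
  intros Hg MA MB PB H.
  destruct (Mod_pot g C) as [D HD]; specialize (HD A B MA MB).
  assert (S : forall t, 0 < t -> exists r, 0 < r /\ forall x, r <= x ->
    Rabs (A x ^ 2 + B x ^ 2 - 1) <= t /\ A x ^ 2 * B x ^ 2 <= t).
  { intros t Ht; destruct (pot_small g t Hg Ht) as (s & Ps & Q).
    destruct (tail_small D K s _ Ps HD) as (r & Pr & T); auto.
    - intros; apply pot_pos; lra.
    - exists r; split; auto. }
  (* At [B = / 2] a defect of at most [/ 16] would force [A ^ 2 >= 11 / 16], hence
     [A ^ 2 * B ^ 2 >= 11 / 64]. *)
  destruct (S (/ 16) ltac:(lra)) as (r0 & P0 & S0).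
  assert (S0' : forall x, r0 <= x -> - / 16 <= A x ^ 2 + B x ^ 2 - 1 <= / 16 /\ A x ^ 2 * B x ^ 2 <= / 16).
  { intros x Hx; destruct (S0 x Hx) as [U V]; apply Rabs_le_between in U; auto. }
  destruct (constant_side B r0 (/ 2)) as [LB|LB].
  - exact (Mod_Cont C B MB).
  - intros x Hx E; destruct (S0' x Hx) as [U V]; rewrite E in U, V; nra.
  - assert (A2 : forall x, r0 <= x -> / 2 <= A x ^ 2).
    { intros x Hx; destruct (S0' x Hx) as [U V]; specialize (LB x Hx); specialize (PB x); nra. }
    assert (Z : forall e, 0 < e -> exists r, 0 < r /\ r0 <= r /\ forall x, r <= x ->
      Rabs (A x ^ 2 - 1) <= e /\ Rabs (B x - 0) <= e).
    (* From [A ^ 2 >= / 2] follow [B ^ 2 <= 2 * t] and then [|A ^ 2 - 1| <= 3 * t]. *)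
    { intros e He; set (t := Rmin (e / 3) (e ^ 2 / 2)).
      assert (0 < t) by (apply Rmin_glb_lt; nra).
      assert (t <= e / 3) by apply Rmin_l; assert (t <= e ^ 2 / 2) by apply Rmin_r.
      destruct (S t ltac:(auto)) as (r & Pr & T).
      pose proof (Rmax_l r r0); pose proof (Rmax_r r r0).
      exists (Rmax r r0); split; [lra|]; split; [lra|]; intros x Hx.
      destruct (T x ltac:(lra)) as [U V]; apply Rabs_le_between in U.
      specialize (A2 x ltac:(lra)); specialize (PB x).
      assert (B x ^ 2 <= 2 * t) by (pose proof (pow2_ge_0 (B x)); nra).
      split; [apply Rabs_le_between; nra|].
      rewrite Rminus_0_r; apply abs_le_sq; lra. }
    destruct (constant_side A r0 0) as [LA|LA].
    + exact (Mod_Cont C A MA).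
    + intros x Hx E; specialize (A2 x Hx); rewrite E in A2; lra.
    + exists (-1), 0; split; [auto|]; intros e He; destruct (Z e He) as (r & Pr & R0 & T).
      exists r; split; auto; intros x Hx; destruct (T x Hx) as [U V]; split; auto.
      specialize (LA x ltac:(lra)); apply Rabs_le_between in U; apply Rabs_le_between; split; nra.
    + exists 1, 0; split; [auto|]; intros e He; destruct (Z e He) as (r & Pr & R0 & T).
      exists r; split; auto; intros x Hx; destruct (T x Hx) as [U V]; split; auto.
      specialize (LA x ltac:(lra)); apply Rabs_le_between in U; apply Rabs_le_between; split; nra.
  (* From [B ^ 2 >= / 4] follow [A ^ 2 <= 4 * t] and then [|B ^ 2 - 1| <= 5 * t]. *)
  - exists 0, 1; split; [auto|]; intros e He; set (t := Rmin (e / 5) (e ^ 2 / 4)).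
    assert (0 < t) by (apply Rmin_glb_lt; nra).
    assert (t <= e / 5) by apply Rmin_l; assert (t <= e ^ 2 / 4) by apply Rmin_r.
    destruct (S t ltac:(auto)) as (r & Pr & T).
    pose proof (Rmax_l r r0); pose proof (Rmax_r r r0).
    exists (Rmax r r0); split; [lra|]; intros x Hx.
    destruct (T x ltac:(lra)) as [U V]; apply Rabs_le_between in U.
    specialize (LB x ltac:(lra)).
    assert (PA : 0 <= A x ^ 2 <= 4 * t).
    { pose proof (pow2_ge_0 (A x)); assert (/ 4 <= B x ^ 2) by nra; nra. }
    split.
    + rewrite Rminus_0_r; apply abs_le_sq; nra.
    + apply Rabs_le_between; split; nra.
Qed.

(** * Exclusion of wrong limits by gluing *)

(** Interpolates with weight [x0] between the constant state [(a, b)] and [p]; [x1] and [x2] stand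
    for the derivatives of [x0]. *)
Definition glue (a b : R) (x0 x1 x2 : R -> R) (p : profile) : profile :=
  Profile (fun x => a + x0 x * (pA p x - a))
    (fun x => x1 x * (pA p x - a) + x0 x * pA1 p x)
    (fun x => x2 x * (pA p x - a) + x1 x * pA1 p x + (x1 x * pA1 p x + x0 x * pA2 p x))
    (fun x => b + x0 x * (pB p x - b))
    (fun x => x1 x * (pB p x - b) + x0 x * pB1 p x).

Lemma glue_regular (a b : R) (x0 x1 x2 : R -> R) (p : profile) : regular p ->
  (forall x, is_derive x0 x (x1 x)) -> (forall x, is_derive x1 x (x2 x)) -> Cont x2 ->
  regular (glue a b x0 x1 x2 p).
Proof.
  intros Rp D0 D1 C2.
  pose proof (Cont_derive _ _ D0); pose proof (Cont_derive _ _ D1).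
  assert (S : forall f f' c x, is_derive f x f' -> is_derive (fun y => f y - c) x f').
  { intros f f' c x D; eapply derive_eq; [apply (is_derive_minus f (fun _ => c));
      [exact D|apply (is_derive_const c)]|]. unfold minus, plus, opp, zero; simpl; ring. }
  assert (T : forall f f' c x, is_derive f x f' -> is_derive (fun y => c + f y) x f').
  { intros f f' c x D; eapply derive_eq; [apply (derive_plus (fun _ => c) f);
      [apply (is_derive_const c)|exact D]|]. unfold zero; simpl; ring. }
  split; simpl; cont.
  - intros x; apply T, (derive_mult x0 (fun y => pA p y - a)); [apply D0|apply S, dA, Rp].
  - intros x; apply (derive_plus (fun y => x1 y * (pA p y - a)) (fun y => x0 y * pA1 p y)).
    + apply (derive_mult x1 (fun y => pA p y - a)); [apply D1|apply S, dA, Rp].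
    + apply (derive_mult x0 (pA1 p)); [apply D0|apply dA1, Rp].
  - intros x; apply T, (derive_mult x0 (fun y => pB p y - b)); [apply D0|apply S, dB, Rp].
Qed.

Lemma dens_glue_eq (eps g a b : R) (x0 x1 x2 : R -> R) (p : profile) (x : R) :
  x0 x = 1 -> x1 x = 0 -> x2 x = 0 -> dens eps g (glue a b x0 x1 x2 p) x = dens eps g p x.
Proof.
  intros E0 E1 E2; unfold dens; simpl; rewrite E0, E1, E2.
  f_equal; [f_equal; f_equal; ring|f_equal; ring].
Qed.

Lemma pot_well (g a b : R) : a ^ 2 + b ^ 2 = 1 -> a * b = 0 -> pot g a b = 0.
Proof. intros E F; unfold pot; rewrite E, <- Rpow_mult_distr, F; field. Qed.

Lemma dens_glue_zero (eps g a b : R) (x0 x1 x2 : R -> R) (p : profile) (x : R) :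
  0 < eps -> a ^ 2 + b ^ 2 = 1 -> a * b = 0 ->
  x0 x = 0 -> x1 x = 0 -> x2 x = 0 -> dens eps g (glue a b x0 x1 x2 p) x = 0.
Proof.
  intros He E F E0 E1 E2; unfold dens; simpl pA; simpl pA2; simpl pB; simpl pB1.
  rewrite E0, E1, E2.
  replace (a + 0 * (pA p x - a)) with a by ring; replace (b + 0 * (pB p x - b)) with b by ring.
  rewrite pot_well by auto; field; lra.
Qed.

(** The slope of [A] is included because the product rule puts [2 * x1 * pA1] into the glued second
    derivative. For [B] only the first derivative enters [dens], and there the cutoff multiplies
    [pB - b] alone. *)
Definition near_well (a b r : R) (p : profile) (x : R) : Prop :=
  Rabs (pA p x - a) <= r /\ Rabs (pA1 p x) <= r /\ Rabs (pB p x - b) <= r.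

Lemma sq_bound (x t : R) : Rabs x <= t -> x ^ 2 <= t ^ 2.
Proof. intros H; rewrite <- (pow2_abs x); apply pow_incr; split; [apply Rabs_pos|auto]. Qed.

(** The summands pay for the cutoff terms in the second derivative of [A], those in the first
    derivative of [B], and the potential; the numerical factors are generous. *)
Definition glue_const (eps g : R) : R := 100 + / eps ^ 2 + 9 * g.

(** The factor 3 is that of [(x + y + z) ^ 2 <= 3 * (x ^ 2 + y ^ 2 + z ^ 2)], which separates the
    derivatives of [p] from the cutoff terms. The latter are of order [r ^ 2], and [r <= 1] makes
    them linear in [r]. *)
Lemma dens_glue_le (eps g a b r : R) (x0 x1 x2 : R -> R) (p : profile) (x : R) :
  0 < eps -> 1 <= g -> (a = 1 /\ b = 0 \/ a = 0 /\ b = 1) -> 0 < r <= 1 ->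
  0 <= x0 x <= 1 -> Rabs (x1 x) <= 1 -> Rabs (x2 x) <= 2 -> near_well a b r p x ->
  dens eps g (glue a b x0 x1 x2 p) x <= glue_const eps g * r + 3 * dens eps g p x.
Proof.
  intros He Hg Hab Hr H0 H1 H2 (NA & NA1 & NB).
  assert (Ie : 0 < / (2 * eps ^ 2)) by (apply Rinv_0_lt_compat; nra).
  destruct (dens_parts eps g p x He Hg) as (_ & _ & Pp).
  unfold dens; simpl pA; simpl pA2; simpl pB; simpl pB1.
  set (u := pA p x - a) in *; set (v := pB p x - b) in *; set (w := pA1 p x) in *.
  set (c := x0 x) in *; set (c1 := x1 x) in *; set (c2 := x2 x) in *.
  assert (M : forall y z Y Z, Rabs y <= Y -> Rabs z <= Z -> Rabs (y * z) <= Y * Z)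
    by (intros; now apply Rabs_mult_le).
  assert (Hc : Rabs c <= 1) by (rewrite Rabs_right; lra).
  assert (Q1 := M _ _ _ _ H2 NA); assert (Q2 := M _ _ _ _ H1 NA1).
  assert (Q3 := M _ _ _ _ H1 NB); assert (Q4 := M _ _ _ _ Hc NA); assert (Q5 := M _ _ _ _ Hc NB).
  apply sq_bound in Q1, Q2, Q3.
  assert (Sc : c ^ 2 <= 1) by nra.
  assert (R2 : r ^ 2 <= r) by nra.
  assert (T1 : (c2 * u + c1 * w + (c1 * w + c * pA2 p x)) ^ 2 <= 24 * r ^ 2 + 3 * pA2 p x ^ 2).
  { set (y1 := c2 * u) in *; set (y2 := c1 * w) in *; set (y3 := pA2 p x).
    assert ((c * y3) ^ 2 <= y3 ^ 2).
    { rewrite Rpow_mult_distr; pose proof (pow2_ge_0 y3); nra. }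
    set (y4 := c * y3) in *.
    pose proof (pow2_ge_0 (y1 - 2 * y2)); pose proof (pow2_ge_0 (y1 - y4));
      pose proof (pow2_ge_0 (2 * y2 - y4)); nra. }
  assert (T2 : (c1 * v + c * pB1 p x) ^ 2 <= 2 * r ^ 2 + 3 * pB1 p x ^ 2).
  { set (y1 := c1 * v) in *; set (y3 := pB1 p x).
    assert ((c * y3) ^ 2 <= y3 ^ 2).
    { rewrite Rpow_mult_distr; pose proof (pow2_ge_0 y3); nra. }
    set (y4 := c * y3) in *.
    pose proof (pow2_ge_0 (y1 - y4)); pose proof (pow2_ge_0 y3); nra. }
  apply (Rmult_le_compat_r (/ (2 * eps ^ 2))) in T2; [|lra].
  assert (T3 : pot g (a + c * u) (b + c * v) <= 9 * g * r).
  { set (y := c * u) in *; set (z := c * v) in *; rewrite Rmult_1_l in Q4, Q5.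
    apply Rabs_le_between in Q4, Q5.
    assert (X : Rabs ((a + y) ^ 2 + (b + z) ^ 2 - 1) <= 4 * r).
    { apply Rabs_le_between; destruct Hab as [[-> ->]|[-> ->]]; split; nra. }
    assert (Y : Rabs ((a + y) * (b + z)) <= 2 * r).
    { apply Rabs_le_between; destruct Hab as [[-> ->]|[-> ->]]; split; nra. }
    apply sq_bound in X, Y; unfold pot; rewrite <- Rpow_mult_distr.
    apply Rle_trans with (4 * r ^ 2 + (g - 1) / 2 * (2 * r) ^ 2).
    - apply Rplus_le_compat; [lra|apply Rmult_le_compat_l; lra].
    - nra. }
  assert (E : / eps ^ 2 = 2 * / (2 * eps ^ 2)) by (field; lra).
  unfold glue_const; rewrite E; unfold Rdiv in *; nra.
Qed.

(** The two halves of [connecting] are separated because [flip (-1) p] keeps only the correct right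
    end; [cut_left] then supplies a new left one. *)
Definition left_end (p : profile) : Prop := exists T, 0 < T /\
  forall x, x <= - T -> pA p x = 1 /\ pB p x = 0 /\ pA2 p x = 0 /\ pB1 p x = 0.
Definition right_end (p : profile) : Prop := exists T, 0 < T /\
  forall x, T <= x -> pA p x = 0 /\ pB p x = 1 /\ pA2 p x = 0 /\ pB1 p x = 0.

Lemma ends_connecting (p : profile) : left_end p -> right_end p -> connecting p.
Proof.
  intros (T1 & P1 & L) (T2 & P2 & R); pose proof (Rmax_l T1 T2); pose proof (Rmax_r T1 T2).
  exists (Rmax T1 T2); split; [lra|]; split; intros; [apply L|apply R]; lra.
Qed.

(* Replacing [p] on the left of [s] by the well (1, 0) costs little, so by
   minimality [p] cannot have spent much energy there. *)
Lemma cut_left (eps g m K r s : R) (p : profile) : 0 < eps -> 1 <= g -> 0 < r <= 1 ->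
  energy_bound eps g m -> regular p -> right_end p -> mass_le (dens eps g p) K ->
  (forall x, s <= x <= s + 3 -> near_well 1 0 r p x) -> Int (dens eps g p) s (s + 3) <= r ->
  forall s', s' <= s -> Int (dens eps g p) s' s <= K - m + (3 * glue_const eps g + 3) * r.
Proof.
  intros He Hg Hr Hm Rp (T & PT & RE) H N I s' Hs.
  set (q := glue 1 0 (fun x => step (x + - s)) (fun x => step1 (x + - s)) (fun x => step2 (x + - s)) p).
  assert (Rq : regular q).
  { apply glue_regular; auto.
    - intros x; apply (derive_shift step step1), step_derive.
    - intros x; apply (derive_shift step1 step2), step1_derive.
    - apply (Cont_comp (fun x => x + - s) step2); cont. }
  assert (ZL : forall x, x <= s -> dens eps g q x = 0).
  { intros x Hx; destruct (step_left (x + - s)) as (E0 & E1 & E2); [lra|].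
    apply dens_glue_zero; auto; ring. }
  assert (ZR : forall x, s + 3 <= x -> dens eps g q x = dens eps g p x).
  { intros x Hx; destruct (step_right (x + - s)) as (E0 & E1 & E2); [lra|].
    now apply dens_glue_eq. }
  assert (Aq : admissible q).
  { split; [exact Rq|apply ends_connecting].
    - pose proof (Rabs_pos s); pose proof (Rle_abs (- s)); rewrite Rabs_Ropp in H1.
      exists (Rabs s + 1); split; [lra|]; intros x Hx; simpl.
      destruct (step_left (x + - s)) as (-> & -> & ->); [lra|]; repeat split; ring.
    - pose proof (Rmax_l T (s + 3)); pose proof (Rmax_r T (s + 3)).
      exists (Rmax T (s + 3)); split; [lra|]; intros x Hx; simpl.
      destruct (step_right (x + - s)) as (-> & -> & ->); [lra|].
      destruct (RE x) as (-> & -> & -> & ->); [lra|]; repeat split; ring. }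
  set (c := Int (dens eps g p) s' s).
  (* The glued profile pays nothing left of [s], at most [(3 * glue_const eps g + 3) * r] on the
     ramp, and at most [K - c] beyond it. *)
  assert (Mq : mass_le (dens eps g q) (K - c + (3 * glue_const eps g + 3) * r)).
  { intros x y xy.
    pose proof (Rmin_l x s); pose proof (Rmin_r x s).
    pose proof (Rmax_l y (s + 3)); pose proof (Rmax_r y (s + 3)).
    set (x0 := Rmin x s) in *; set (y0 := Rmax y (s + 3)) in *.
    apply Rle_trans with (Int (dens eps g q) x0 y0).
    { apply int_mono; cont; intros; now apply dens_pos. }
    rewrite <- (int_chasles _ x0 s y0), <- (int_chasles _ s (s + 3) y0) by cont.
    assert (I1 : Int (dens eps g q) x0 s = 0).
    { rewrite (int_ext _ (fun _ => 0)); [rewrite int_const; ring|auto|].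
      intros z Hz; apply ZL; lra. }
    assert (I2 : Int (dens eps g q) s (s + 3) <= 3 * glue_const eps g * r + 3 * r).
    { apply Rle_trans with (Int (fun z => glue_const eps g * r + 3 * dens eps g p z) s (s + 3)).
      - apply int_le; cont; [lra|]; intros z Hz.
        destruct (step_bounds (z + - s)) as (B0 & B1 & B2).
        apply dens_glue_le; auto; apply N; lra.
      - rewrite int_plus, int_const, int_scal by cont; lra. }
    assert (I3 : Int (dens eps g q) (s + 3) y0 <= K - c).
    { rewrite (int_ext _ (dens eps g p)); [|auto|intros z Hz; apply ZR; lra].
      specialize (H s' y0 ltac:(lra)).
      rewrite <- (int_chasles _ s' s y0), <- (int_chasles _ s (s + 3) y0) in H by cont.
      assert (0 <= Int (dens eps g p) s (s + 3)).
      { apply int_ge0; cont; [lra|]; intros; now apply dens_pos. }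
      fold c in H; lra. }
    lra. }
  specialize (Hm q _ Aq Mq); lra.
Qed.

(** Mirror image of [cut_left]: the profile is replaced by the well (0, 1) from [s + 3] on, so
    little energy can have been spent there. *)
Lemma cut_right (eps g m K r s : R) (p : profile) : 0 < eps -> 1 <= g -> 0 < r <= 1 ->
  energy_bound eps g m -> regular p -> left_end p -> mass_le (dens eps g p) K ->
  (forall x, s <= x <= s + 3 -> near_well 0 1 r p x) -> Int (dens eps g p) s (s + 3) <= r ->
  forall s', s + 3 <= s' -> Int (dens eps g p) (s + 3) s' <= K - m + (3 * glue_const eps g + 3) * r.
Proof.
  intros He Hg Hr Hm Rp (T & PT & LE) H N I s' Hs.
  set (q := glue 0 1 (fun x => 1 - step (x + - s)) (fun x => - step1 (x + - s))
    (fun x => - step2 (x + - s)) p).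
  assert (Rq : regular q).
  { apply glue_regular; auto.
    - intros x; eapply derive_eq; [apply (is_derive_minus (fun _ => 1) (fun x => step (x + - s)));
        [apply (is_derive_const 1)|apply (derive_shift step step1), step_derive]|].
      unfold minus, plus, opp, zero; simpl; ring.
    - intros x; apply (is_derive_opp (fun x => step1 (x + - s))).
      apply (derive_shift step1 step2), step1_derive.
    - apply Cont_opp, (Cont_comp (fun x => x + - s) step2); cont. }
  assert (ZR : forall x, s + 3 <= x -> dens eps g q x = 0).
  { intros x Hx; destruct (step_right (x + - s)) as (E0 & E1 & E2); [lra|].
    apply dens_glue_zero; auto; try rewrite E0; try rewrite E1; try rewrite E2; ring. }
  assert (ZL : forall x, x <= s -> dens eps g q x = dens eps g p x).
  { intros x Hx; destruct (step_left (x + - s)) as (E0 & E1 & E2); [lra|].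
    apply dens_glue_eq; try rewrite E0; try rewrite E1; try rewrite E2; ring. }
  assert (Aq : admissible q).
  { split; [exact Rq|apply ends_connecting].
    - pose proof (Rabs_pos s); pose proof (Rle_abs (- s)); rewrite Rabs_Ropp in H1.
      pose proof (Rmax_l T (Rabs s + 1)); pose proof (Rmax_r T (Rabs s + 1)).
      exists (Rmax T (Rabs s + 1)); split; [lra|]; intros x Hx; simpl.
      destruct (step_left (x + - s)) as (-> & -> & ->); [lra|].
      destruct (LE x) as (-> & -> & -> & ->); [lra|]; repeat split; ring.
    - pose proof (Rabs_pos s); pose proof (Rle_abs s).
      exists (Rabs s + 3); split; [lra|]; intros x Hx; simpl.
      destruct (step_right (x + - s)) as (-> & -> & ->); [lra|]; repeat split; ring. }
  set (c := Int (dens eps g p) (s + 3) s').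
  assert (Mq : mass_le (dens eps g q) (K - c + (3 * glue_const eps g + 3) * r)).
  { intros x y xy.
    pose proof (Rmin_l x s); pose proof (Rmin_r x s).
    pose proof (Rmax_l y (s + 3)); pose proof (Rmax_r y (s + 3)).
    set (x0 := Rmin x s) in *; set (y0 := Rmax y (s + 3)) in *.
    apply Rle_trans with (Int (dens eps g q) x0 y0).
    { apply int_mono; cont; intros; now apply dens_pos. }
    rewrite <- (int_chasles _ x0 s y0), <- (int_chasles _ s (s + 3) y0) by cont.
    assert (I1 : Int (dens eps g q) (s + 3) y0 = 0).
    { rewrite (int_ext _ (fun _ => 0)); [rewrite int_const; ring|auto|].
      intros z Hz; apply ZR; lra. }
    assert (I2 : Int (dens eps g q) s (s + 3) <= 3 * glue_const eps g * r + 3 * r).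
    { apply Rle_trans with (Int (fun z => glue_const eps g * r + 3 * dens eps g p z) s (s + 3)).
      - apply int_le; cont; [lra|]; intros z Hz.
        destruct (step_bounds (z + - s)) as (B0 & B1 & B2).
        apply dens_glue_le; auto; rewrite ?Rabs_Ropp; auto; [lra|apply N; lra].
      - rewrite int_plus, int_const, int_scal by cont; lra. }
    assert (I3 : Int (dens eps g q) x0 s <= K - c).
    { rewrite (int_ext _ (dens eps g p)); [|auto|intros z Hz; apply ZL; lra].
      specialize (H x0 s' ltac:(lra)).
      rewrite <- (int_chasles _ x0 s s'), <- (int_chasles _ s (s + 3) s') in H by cont.
      assert (0 <= Int (dens eps g p) s (s + 3)).
      { apply int_ge0; cont; [lra|]; intros; now apply dens_pos. }
      fold c in H; lra. }
    lra. }
  specialize (Hm q _ Aq Mq); lra.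
Qed.

Definition flip (a : R) (p : profile) : profile :=
  Profile (fun x => a * pA p x) (fun x => a * pA1 p x) (fun x => a * pA2 p x) (pB p) (pB1 p).

Lemma flip_regular (a : R) (p : profile) : regular p -> regular (flip a p).
Proof.
  intros Rp; split; simpl.
  - intros x; apply derive_scal, dA, Rp.
  - intros x; apply derive_scal, dA1, Rp.
  - cont.
  - apply dB, Rp.
  - apply cB1, Rp.
Qed.

Lemma flip_dens (eps g a : R) (p : profile) (x : R) : a ^ 2 = 1 ->
  dens eps g (flip a p) x = dens eps g p x.
Proof.
  intros Ha; unfold dens, pot; simpl pA; simpl pA2; simpl pB; simpl pB1.
  rewrite !Rpow_mult_distr, Ha, !Rmult_1_l; reflexivity.
Qed.

(** Pigeonhole over [n] consecutive windows of length 3, the width of the ramp of [step]. *)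
Lemma cheap_interval (f : R -> R) (s r : R) : Cont f -> forall n : nat, (0 < n)%nat ->
  Int f s (s + 3 * INR n) <= r * INR n ->
  exists a, s <= a /\ a + 3 <= s + 3 * INR n /\ Int f a (a + 3) <= r.
Proof.
  intros Cf; induction n as [|n IH]; [lia|]; intros _ H.
  pose proof (pos_INR n).
  rewrite S_INR in H |- *.
  destruct (Rle_dec (Int f (s + 3 * INR n) (s + 3 * INR n + 3)) r) as [L|L].
  - exists (s + 3 * INR n); repeat split; auto; lra.
  - apply Rnot_le_lt in L.
    rewrite <- (int_chasles f s (s + 3 * INR n)) in H by auto.
    replace (s + 3 * (INR n + 1)) with (s + 3 * INR n + 3) in H by ring.
    destruct n as [|n].
    + exfalso; simpl in *; unfold Int in H at 1.
      replace (s + 3 * 0) with s in * by ring.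
      rewrite RInt_point in H; unfold zero in H; simpl in H; lra.
    + destruct (IH ltac:(lia)) as (a & H1 & H2 & H3); [lra|].
      exists a; repeat split; auto; lra.
Qed.

(** Recovers a small slope from values, the only quantities known to converge: the mean value
    theorem gives a slope of at most [r / 2] between [x] and [x + d ^ 2], and the modulus of [pA1]
    adds at most [M * d]. *)
Lemma slope_small (M r d a x : R) (p : profile) : regular p -> Mod M (pA1 p) ->
  0 < d <= 1 -> M * d <= r / 2 ->
  Rabs (pA p x - a) <= r * d ^ 2 / 4 -> Rabs (pA p (x + d ^ 2) - a) <= r * d ^ 2 / 4 ->
  Rabs (pA1 p x) <= r.
Proof.
  intros Rp MA Hd HM H1 H2.
  assert (D2 : 0 < d ^ 2) by nra.
  destruct (MVT_gen (pA p) x (x + d ^ 2) (pA1 p)) as (y & Hy & E).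
  - intros; apply dA, Rp.
  - intros t _; apply continuity_pt_filterlim, cA, Rp.
  - rewrite Rmin_left, Rmax_right in Hy by lra.
    replace (x + d ^ 2 - x) with (d ^ 2) in E by ring.
    assert (V := proj2 MA d x y Hd ltac:(apply Rabs_le_between; lra)).
    apply Rabs_le_between in H1, H2, V.
    assert (- (r / 2) <= pA1 p y <= r / 2) by (split; apply (Rmult_le_reg_r (d ^ 2)); lra).
    apply Rabs_le_between; lra.
Qed.

(** Combines pigeonhole for the energy with [slope_small] for the slope. Closeness is assumed on one
    more unit of length because [slope_small] also looks at [x + d ^ 2]. *)
Lemma good_interval (M r d a b s K eps g : R) (n : nat) (p : profile) : 0 < eps -> 1 <= g ->
  regular p -> Mod M (pA1 p) -> 0 < r -> 0 < d <= 1 -> M * d <= r / 2 ->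
  mass_le (dens eps g p) K -> (0 < n)%nat -> K <= r * INR n ->
  (forall x, s <= x <= s + 3 * INR n + 1 ->
    Rabs (pA p x - a) <= r * d ^ 2 / 4 /\ Rabs (pB p x - b) <= r * d ^ 2 / 4) ->
  exists t, s <= t /\ t + 3 <= s + 3 * INR n /\
    (forall x, t <= x <= t + 3 -> near_well a b r p x) /\ Int (dens eps g p) t (t + 3) <= r.
Proof.
  intros He Hg Rp MA Hr Hd HM H Pn HK N.
  destruct (cheap_interval (dens eps g p) s r ltac:(cont) n Pn) as (t & T1 & T2 & T3).
  { pose proof (pos_INR n); eapply Rle_trans; [apply H; lra|exact HK]. }
  exists t; split; [auto|]; split; [auto|]; split; [|auto]; intros x Hx.
  assert (0 < d ^ 2 <= 1) by nra.
  destruct (N x ltac:(lra)) as [N1 N2], (N (x + d ^ 2) ltac:(lra)) as [N3 _].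
  split; [nra|]; split; [|nra].
  now apply (slope_small M r d a).
Qed.

Lemma unif_near (eps g M m L e a b : R) (p : nat -> profile) (A B : R -> R) (P : R -> Prop) :
  minimizing eps g M m p A B -> 0 < L -> 0 < e ->
  (forall x, P x -> Rabs x <= L /\ Rabs (A x - a) <= e / 2 /\ Rabs (B x - b) <= e / 2) ->
  exists N, forall n, (N <= n)%nat -> forall x, P x ->
    Rabs (pA (p n) x - a) <= e /\ Rabs (pB (p n) x - b) <= e.
Proof.
  intros H HL He Q.
  destruct (Mod_unif_on M L _ A HL (min_ModA _ _ _ _ _ _ _ H) (min_cvA _ _ _ _ _ _ _ H) (e / 2)) as [N1 H1];
    [lra|].
  destruct (Mod_unif_on M L _ B HL (min_ModB _ _ _ _ _ _ _ H) (min_cvB _ _ _ _ _ _ _ H) (e / 2)) as [N2 H2];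
    [lra|].
  exists (N1 + N2)%nat; intros n Hn x Px; destruct (Q x Px) as (Lx & QA & QB).
  specialize (H1 n ltac:(lia) x Lx); specialize (H2 n ltac:(lia) x Lx).
  split.
  - replace (pA (p n) x - a) with ((pA (p n) x - A x) + (A x - a)) by ring.
    eapply Rle_trans; [apply Rabs_triang|lra].
  - replace (pB (p n) x - b) with ((pB (p n) x - B x) + (B x - b)) by ring.
    eapply Rle_trans; [apply Rabs_triang|lra].
Qed.

(** At [B = / 2] the potential is bounded below for every [A]: if [A ^ 2 >= 3 / 8] the mixed term is
    at least [(g - 1) * (3 / 64)], and otherwise the first term is at least [9 / 256]. The resulting
    [kappa] is what a cut would save. *)
Lemma middle_energy (eps g M : R) : 0 < eps -> 1 < g -> exists kappa, 0 < kappa /\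
  forall p, regular p -> Mod M (pA p) -> Mod M (pB p) -> pB p 0 = / 2 ->
  kappa <= Int (dens eps g p) 0 1.
Proof.
  intros He Hg; destruct (Mod_pot g M) as [C HC].
  set (w := Rmin (9 / 256) ((g - 1) * (3 / 64))).
  assert (Pw : 0 < w) by (apply Rmin_glb_lt; lra).
  destruct (Mod_integral_gap C w Pw) as (kappa & Pk & Gap).
  exists kappa; split; auto; intros p Rp MA MB E.
  specialize (Gap (fun x => pot g (pA p x) (pB p x)) (HC _ _ MA MB)
    (fun x => pot_pos g _ _ ltac:(lra)) 0).
  replace (0 + 1) with 1 in Gap by ring.
  eapply Rle_trans; [apply Gap|].
  - assert (w <= 9 / 256) by apply Rmin_l; assert (w <= (g - 1) * (3 / 64)) by apply Rmin_r.
    rewrite E; unfold pot; set (y := pA p 0 ^ 2).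
    assert (0 <= y) by apply pow2_ge_0.
    destruct (Rle_dec (3 / 8) y).
    + pose proof (pow2_ge_0 (y + (/ 2) ^ 2 - 1)).
      assert ((g - 1) / 2 * ((3 / 8) * (/ 2) ^ 2) <= (g - 1) / 2 * (y * (/ 2) ^ 2))
        by (apply Rmult_le_compat_l; lra).
      lra.
    + assert (0 <= (g - 1) / 2 * (y * (/ 2) ^ 2)) by (apply Rmult_le_pos; lra).
      assert ((3 / 8) ^ 2 <= (y + (/ 2) ^ 2 - 1) ^ 2) by nra.
      lra.
  - apply int_le; cont; [lra|]; intros; apply pot_le_dens; lra.
Qed.

(** The order of choice matters: [r] makes gluing cheap compared with [kappa], then [d] makes the
    slope variation small compared with [r], and [n] gives enough windows for the pigeonhole. *)
Lemma cut_parameters (eps g M K kappa : R) : 0 < eps -> 1 <= g -> 0 < kappa ->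
  exists r d (n : nat), 0 < r <= 1 /\ 0 < d <= 1 /\ M * d <= r / 2 /\ (0 < n)%nat /\
    K <= r * INR n /\ (3 * glue_const eps g + 3) * r <= kappa / 4.
Proof.
  intros He Hg Hk; set (C := 3 * glue_const eps g + 3).
  assert (PC : 0 < C).
  { unfold C, glue_const; assert (0 < / eps ^ 2) by (apply Rinv_0_lt_compat; nra); lra. }
  set (r := Rmin 1 (kappa / 4 / C)).
  assert (P1 : 0 < kappa / 4 / C) by (apply Rdiv_lt_0_compat; lra).
  assert (P2 : 0 < r) by (apply Rmin_glb_lt; lra).
  assert (P3 : r <= kappa / 4 / C) by apply Rmin_r.
  set (d := Rmin 1 (r / 2 / (Rabs M + 1))).
  pose proof (Rabs_pos M); pose proof (Rle_abs M).
  assert (Q1 : 0 < r / 2 / (Rabs M + 1)) by (apply Rdiv_lt_0_compat; lra).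
  assert (Q2 : 0 < d) by (apply Rmin_glb_lt; lra).
  assert (Q3 : d <= r / 2 / (Rabs M + 1)) by apply Rmin_r.
  destruct (archimed_cor1 (r / (Rabs K + 1))) as (n & Hn & Pn).
  { pose proof (Rabs_pos K); apply Rdiv_lt_0_compat; lra. }
  exists r, d, n; split; [split; [auto|apply Rmin_l]|]; split; [split; [auto|apply Rmin_l]|].
  split; [|split; [auto|split]].
  - apply (Rmult_le_compat_r (Rabs M + 1)) in Q3; [|lra].
    replace (r / 2 / (Rabs M + 1) * (Rabs M + 1)) with (r / 2) in Q3 by (field; lra); nra.
  - apply lt_0_INR in Pn; pose proof (Rabs_pos K); pose proof (Rle_abs K).
    apply (Rmult_lt_compat_r (INR n * (Rabs K + 1))) in Hn; [|nra].
    replace (/ INR n * (INR n * (Rabs K + 1))) with (Rabs K + 1) in Hn by (field; lra).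
    replace (r / (Rabs K + 1) * (INR n * (Rabs K + 1))) with (r * INR n) in Hn by (field; lra).
    lra.
  - fold C; apply (Rmult_le_compat_r C) in P3; [|lra].
    replace (kappa / 4 / C * C) with (kappa / 4) in P3 by (field; lra); lra.
Qed.

Lemma small_defect (kappa : R) : 0 < kappa -> exists N, forall n, (N <= n)%nat ->
  (/ (INR n + 1)) ^ 2 <= kappa.
Proof.
  intros Hk; destruct (archimed_cor1 kappa Hk) as (N & HN & PN).
  exists N; intros n Hn; destruct (inv_succ_bounds n).
  apply lt_0_INR in PN; apply le_INR in Hn.
  assert (/ (INR n + 1) <= / INR N) by (apply Rinv_le_contravar; lra).
  nra.
Qed.

Lemma mass_top (eps g M m : R) (p : nat -> profile) (A B : R -> R) (n : nat) :
  minimizing eps g M m p A B -> mass_le (dens eps g (p n)) (m + 1).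
Proof.
  intros H; apply (mass_le_weaken _ (m + (/ (INR n + 1)) ^ 2)); [|apply H].
  destruct (inv_succ_bounds n); nra.
Qed.

(** The cut is made in a member [p k] that is close to the limit on a fixed window. Gluing and the
    defect of [p k] cost [kappa / 4] each, while the discarded part contains [[0, 1]] with energy at
    least [kappa]. *)
Lemma right_end_not_A (eps g M m a : R) (p : nat -> profile) (A B : R -> R) :
  0 < eps -> 1 < g -> minimizing eps g M m p A B ->
  (forall n, Mod M (pA1 (p n))) -> (forall n, pB (p n) 0 = / 2) -> (a = 1 \/ a = -1) ->
  (forall e, 0 < e -> exists r, 0 < r /\ forall x, r <= x -> Rabs (A x - a) <= e /\ Rabs (B x - 0) <= e) ->
  False.
Proof.
  intros He Hg H MA1 HB Ha Lim.
  assert (Ea : a ^ 2 = 1) by (destruct Ha as [-> | ->]; ring).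
  destruct (middle_energy eps g M He Hg) as (kappa & Pk & HK).
  destruct (cut_parameters eps g M (m + 1) kappa) as (r & d & n & Hr & Hd & HM & Pn & Hn & HC);
    auto; [lra|].
  assert (Pe : 0 < r * d ^ 2) by (apply Rmult_lt_0_compat; [lra|apply pow_lt; lra]).
  assert (Pe4 : 0 < r * d ^ 2 / 4) by lra.
  destruct (Lim (r * d ^ 2 / 4 / 2) ltac:(lra)) as (R0 & PR & Near).
  pose proof (Rmax_l R0 1); pose proof (Rmax_r R0 1); pose proof (pos_INR n).
  (* Starting at 1 or later keeps [[0, 1]] in the part to be discarded. *)
  set (s := Rmax R0 1) in *.
  destruct (unif_near eps g M m (s + 3 * INR n + 1) (r * d ^ 2 / 4) a 0 p A B
    (fun x => s <= x <= s + 3 * INR n + 1)) as [N1 F1]; auto; [lra| |].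
  { intros x Hx; split; [rewrite Rabs_right; lra|apply Near; lra]. }
  destruct (small_defect (kappa / 4) ltac:(lra)) as [N2 F2].
  set (k := (N1 + N2)%nat).
  specialize (F1 k ltac:(lia)); specialize (F2 k ltac:(lia)).
  destruct (min_adm _ _ _ _ _ _ _ H k) as [Rk (T & PT & _ & RE)].
  destruct (good_interval M r d a 0 s (m + 1) eps g n (p k)) as (t & T1 & T2 & T3 & T4); auto; try lra.
  { apply (mass_top eps g M m p A B k H). }
  assert (E : forall x y, x <= y -> Int (dens eps g (flip a (p k))) x y = Int (dens eps g (p k)) x y).
  { intros; apply int_ext; auto; intros; now apply flip_dens. }
  assert (Cut := cut_left eps g m (m + (/ (INR k + 1)) ^ 2) r t (flip a (p k)) He ltac:(lra) Hr
    (min_low _ _ _ _ _ _ _ H) (flip_regular a _ Rk)).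
  rewrite (E t (t + 3)) in Cut by lra.
  specialize (HK (p k) Rk (min_ModA _ _ _ _ _ _ _ H k) (min_ModB _ _ _ _ _ _ _ H k) (HB k)).
  assert (I : Int (dens eps g (p k)) 0 1 <= Int (dens eps g (p k)) 0 t).
  { apply int_mono; cont; try lra; intros; apply dens_pos; lra. }
  rewrite <- (E 0 t) in I by lra.
  assert (Int (dens eps g (flip a (p k))) 0 t <= kappa / 4 + kappa / 4); [|lra].
  eapply Rle_trans; [apply Cut|]; auto; try lra.
  - exists T; split; auto; intros x Hx; simpl; destruct (RE x Hx) as (-> & -> & -> & ->).
    repeat split; ring.
  - intros x y xy; rewrite E by auto; now apply H.
  - intros x Hx; destruct (T3 x Hx) as (U & V & W); unfold near_well; simpl.
    replace (a * pA (p k) x - 1) with (a * (pA (p k) x - a)) by (rewrite <- Ea; ring).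
    rewrite !Rabs_mult.
    assert (Rabs a = 1) as -> by (destruct Ha as [-> | ->]; unfold Rabs; destruct Rcase_abs; lra).
    rewrite !Rmult_1_l; auto.
Qed.

Lemma left_end_not_B (eps g M m : R) (p : nat -> profile) (A B : R -> R) :
  0 < eps -> 1 < g -> minimizing eps g M m p A B ->
  (forall n, Mod M (pA1 (p n))) -> (forall n, pB (p n) 0 = / 2) ->
  (forall e, 0 < e -> exists r, 0 < r /\
     forall x, r <= x -> Rabs (A (- x) - 0) <= e /\ Rabs (B (- x) - 1) <= e) ->
  False.
Proof.
  intros He Hg H MA1 HB Lim.
  destruct (middle_energy eps g M He Hg) as (kappa & Pk & HK).
  destruct (cut_parameters eps g M (m + 1) kappa) as (r & d & n & Hr & Hd & HM & Pn & Hn & HC);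
    auto; [lra|].
  assert (Pe : 0 < r * d ^ 2) by (apply Rmult_lt_0_compat; [lra|apply pow_lt; lra]).
  assert (Pe4 : 0 < r * d ^ 2 / 4) by lra.
  destruct (Lim (r * d ^ 2 / 4 / 2) ltac:(lra)) as (R0 & PR & Near).
  pose proof (pos_INR n).
  (* The window with its additional unit ends at [- R0], where the limit is already near the well,
     and lies left of [[0, 1]]. *)
  set (s := - R0 - 1 - 3 * INR n).
  destruct (unif_near eps g M m (- s) (r * d ^ 2 / 4) 0 1 p A B
    (fun x => s <= x <= s + 3 * INR n + 1)) as [N1 F1]; auto; [unfold s; lra| |].
  { intros x Hx; split; [rewrite Rabs_left1; unfold s in *; lra|].
    replace x with (- - x) by ring; apply Near; unfold s in *; lra. }
  destruct (small_defect (kappa / 4) ltac:(lra)) as [N2 F2].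
  set (k := (N1 + N2)%nat).
  specialize (F1 k ltac:(lia)); specialize (F2 k ltac:(lia)).
  destruct (min_adm _ _ _ _ _ _ _ H k) as [Rk (T & PT & LE & _)].
  destruct (good_interval M r d 0 1 s (m + 1) eps g n (p k)) as (t & T1 & T2 & T3 & T4); auto; try lra.
  { apply (mass_top eps g M m p A B k H). }
  assert (T5 : t + 3 <= 0) by (unfold s in *; lra).
  specialize (HK (p k) Rk (min_ModA _ _ _ _ _ _ _ H k) (min_ModB _ _ _ _ _ _ _ H k) (HB k)).
  assert (I : Int (dens eps g (p k)) 0 1 <= Int (dens eps g (p k)) (t + 3) 1).
  { apply int_mono; cont; try lra; intros; apply dens_pos; lra. }
  assert (Cut := cut_right eps g m (m + (/ (INR k + 1)) ^ 2) r t (p k) He ltac:(lra) Hr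
    (min_low _ _ _ _ _ _ _ H) Rk ltac:(exists T; auto) (min_mass _ _ _ _ _ _ _ H k) T3 T4 1 ltac:(lra)).
  lra.
Qed.

(** * Existence and the limit g -> 1 *)

Lemma chain_scal (c : R) (k : nat) (F : R -> R) : forall f, chain k f F ->
  chain k (fun x => c * f x) (fun x => c * F x).
Proof.
  induction k as [|k IH]; intros f H.
  - intros x; now rewrite (H x).
  - destruct H as (f' & D & C); exists (fun x => c * f' x); split; auto.
    intros x; now apply derive_scal.
Qed.

Lemma chain_ext (k : nat) (F G : R -> R) : (forall x, F x = G x) -> forall f, chain k f F -> chain k f G.
Proof.
  intros E; induction k as [|k IH]; intros f H.
  - intros x; now rewrite (H x).
  - destruct H as (f' & D & C); exists f'; auto.
Qed.

(** The potential depends on values only, so its integrals pass to the limit; this is the finite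
    energy that [well_limit] needs. *)
Lemma limit_energy (eps g M m : R) (p : nat -> profile) (A B : R -> R) :
  0 < eps -> 1 <= g -> minimizing eps g M m p A B ->
  forall b, 0 < b -> Int (fun x => pot g (A x) (B x)) (- b) b <= m + 1.
Proof.
  intros He Hg H b Hb.
  destruct (pot_lipschitz g M) as [K HK].
  pose proof (Mod_limit M _ A (min_ModA _ _ _ _ _ _ _ H) (min_cvA _ _ _ _ _ _ _ H)) as LA.
  pose proof (Mod_limit M _ B (min_ModB _ _ _ _ _ _ _ H) (min_cvB _ _ _ _ _ _ _ H)) as LB.
  pose proof (Mod_Cont M A LA); pose proof (Mod_Cont M B LB).
  apply le_epsilon; intros e Pe.
  destruct (int_unif_limit b (fun n x => pot g (pA (p n) x) (pB (p n) x))
    (fun x => pot g (A x) (B x)) Hb) with (e := e) as [N HN]; auto.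
  - intros n; pose proof (proj1 (min_adm _ _ _ _ _ _ _ H n)); cont.
  - cont.
  - apply (unif_on_lipschitz b M K (fun n => pA (p n)) (fun n => pB (p n)) A B (pot g)); auto.
    + intros n; apply H.
    + intros n; apply H.
    + apply LA.
    + apply LB.
    + apply (Mod_unif_on M); auto; apply H.
    + apply (Mod_unif_on M); auto; apply H.
  - specialize (HN N (le_n N)); apply Rabs_le_between in HN.
    pose proof (proj1 (min_adm _ _ _ _ _ _ _ H N)) as RN.
    pose proof (mass_top eps g M m p A B N H (- b) b ltac:(lra)).
    assert (Int (fun x => pot g (pA (p N) x) (pB (p N) x)) (- b) b <= Int (dens eps g (p N)) (- b) b)
      by (apply int_le; cont; [lra|]; intros; now apply pot_le_dens).
    lra.
Qed.

Lemma minimizing_exists (eps g : R) : 0 < eps -> 1 < g -> exists M m p A B,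
  minimizing eps g M m p A B /\ (forall n, Mod M (pA1 (p n))) /\
  (forall n x, 0 <= pB (p n) x) /\ (forall n, pB (p n) 0 = / 2).
Proof.
  intros He Hg.
  destruct (trial eps He) as (C & PC & HT).
  (* Any profile of finite energy makes the infimum meaningful, so [L = 1] will do. *)
  destruct (HT g 1 ltac:(lra) ltac:(lra)) as (p0 & A0 & M0).
  destruct (infimum_energy eps g He ltac:(lra)) as (m & Lo & Ap); [eauto|].
  destruct (normalized_sequence eps g m He ltac:(lra) Ap) as (p & Hp).
  destruct (a_priori eps (m + 1) He) as (M & PM & HM).
  assert (Hm : forall n, Mod M (pA (p n)) /\ Mod M (pA1 (p n)) /\ Mod M (pB (p n))).
  { intros n; destruct (Hp n) as (Ad & Ma & _); apply (HM g); [lra|apply Ad|].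
    apply (mass_le_weaken _ (m + (/ (INR n + 1)) ^ 2)); auto.
    destruct (inv_succ_bounds n); nra. }
  destruct (ascoli M (fun n => pA (p n))) as (f1 & F1 & A & CA); [intros; apply Hm|].
  destruct (ascoli M (fun n => pB (p (f1 n)))) as (f2 & F2 & B & CB); [intros; apply Hm|].
  exists M, m, (fun n => p (f1 (f2 n))), A, B.
  split; [split|split; [|split]]; auto; intros n; try apply Hm; try apply Hp.
  (* Both extractions only raise the index, so the defect prescribed for [n] still bounds that of
     the chosen member. *)
  - destruct (Hp (f1 (f2 n))) as (_ & Ma & _).
    eapply mass_le_weaken; [|exact Ma].
    apply Rplus_le_compat_l, pow_incr; split; [left; apply inv_succ_bounds|].
    assert (INR n <= INR (f1 (f2 n))) by (apply le_INR; specialize (F1 (f2 n)); specialize (F2 n); lia).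
    pose proof (pos_INR n); apply Rinv_le_contravar; lra.
  - apply (Un_cv_sub (fun k => pA (p (f1 k)) n)); auto.
Qed.

Lemma filterlim_minus (A B : R -> R) (a b : R) :
  (forall e, 0 < e -> exists r, 0 < r /\
     forall x, r <= x -> Rabs (A (- x) - a) <= e /\ Rabs (B (- x) - b) <= e) ->
  filterlim (fun x : R => (A x, B x)) (Rbar_locally m_infty) (locally (a, b)).
Proof.
  intros H P [e He]; pose proof (cond_pos e).
  destruct (H (e / 2) ltac:(lra)) as (r & _ & Hr).
  exists (- r); intros x Hx; apply He.
  specialize (Hr (- x) ltac:(lra)); rewrite Ropp_involutive in Hr.
  split; [change (Rabs (A x - a) < e)|change (Rabs (B x - b) < e)]; lra.
Qed.

Lemma filterlim_plus (A B : R -> R) (a b : R) :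
  (forall e, 0 < e -> exists r, 0 < r /\
     forall x, r <= x -> Rabs (A x - a) <= e /\ Rabs (B x - b) <= e) ->
  filterlim (fun x : R => (A x, B x)) (Rbar_locally p_infty) (locally (a, b)).
Proof.
  intros H P [e He]; pose proof (cond_pos e).
  destruct (H (e / 2) ltac:(lra)) as (r & _ & Hr).
  exists r; intros x Hx; apply He.
  specialize (Hr x ltac:(lra)).
  split; [change (Rabs (A x - a) < e)|change (Rabs (B x - b) < e)]; lra.
Qed.

Lemma Un_cv_le (u : nat -> R) (l c : R) (N : nat) :
  Un_cv u l -> (forall n, (N <= n)%nat -> u n <= c) -> l <= c.
Proof.
  intros C H; apply le_epsilon; intros e He; destruct (C e He) as [N' HN].
  specialize (HN (N + N')%nat ltac:(lia)); specialize (H (N + N')%nat ltac:(lia)).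
  unfold Rdist in HN; apply Rabs_lt_between in HN; lra.
Qed.

Definition sphere_defect (A B : R -> R) (x : R) : R := Rabs (A x ^ 2 + B x ^ 2 - 1).

Lemma sphere_defect_cv (a b : nat -> R -> R) (A B : R -> R) (x : R) :
  Un_cv (fun n => a n x) (A x) -> Un_cv (fun n => b n x) (B x) ->
  Un_cv (fun n => sphere_defect (a n) (b n) x) (sphere_defect A B x).
Proof.
  intros CA CB.
  assert (C1 : Un_cv (fun _ => 1) 1).
  { intros e He; exists 0%nat; intros; unfold Rdist; rewrite Rminus_diag, Rabs_R0; lra. }
  apply cv_cvabs.
  apply (CV_minus (fun n => a n x ^ 2 + b n x ^ 2) (fun _ => 1)).
  - apply (CV_plus (fun n => a n x ^ 2) (fun n => b n x ^ 2)); simpl.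
    + apply (CV_mult (fun n => a n x) (fun n => a n x * 1)); auto.
      apply (CV_mult (fun n => a n x) (fun _ => 1)); auto; exact C1.
    + apply (CV_mult (fun n => b n x) (fun n => b n x * 1)); auto.
      apply (CV_mult (fun n => b n x) (fun _ => 1)); auto; exact C1.
  - exact C1.
Qed.

(** The last clause exports what (3) needs without the minimizing sequence. A bound on the sphere
    defect common to all regular profiles of energy at most [K] passes to the limit, as members of
    the sequence eventually have such energy when the infimum is below [K]; [K' < K] leaves room for
    their defect. The quantifiers over [s], [K] and [K'] come after [A] and [B], so one solution
    serves every tolerance. *)
Lemma heteroclinic (eps g : R) : 0 < eps -> 1 < g -> exists A B,
  smooth_heteroclinic_solution eps g A B /\ (forall x, 0 <= B x) /\
  forall s K K', (forall p, regular p -> mass_le (dens eps g p) K ->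
      forall x, sphere_defect (pA p) (pB p) x <= s) ->
    K' < K -> (exists p, admissible p /\ mass_le (dens eps g p) K') ->
    forall x, sphere_defect A B x <= s.
Proof.
  intros He Hg.
  destruct (minimizing_exists eps g He Hg) as (M & m & p & A & B & H & MA1 & PB & HB).
  pose proof (Mod_limit M _ A (min_ModA _ _ _ _ _ _ _ H) (min_cvA _ _ _ _ _ _ _ H)) as LA.
  pose proof (Mod_limit M _ B (min_ModB _ _ _ _ _ _ _ H) (min_cvB _ _ _ _ _ _ _ H)) as LB.
  pose proof (Mod_Cont M A LA) as CA; pose proof (Mod_Cont M B LB) as CB.
  assert (B0 : forall x, 0 <= B x).
  { intros x; apply Ropp_le_cancel; rewrite Ropp_0.
    apply (Un_cv_le (fun n => - pB (p n) x) (- B x) 0 0).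
    - apply (CV_opp (fun n => pB (p n) x)), H.
    - intros n _; specialize (PB n x); lra. }
  pose proof (limit_energy eps g M m p A B He ltac:(lra) H) as E.
  set (h := fun x => pot g (A x) (B x)) in *.
  assert (Ch : Cont h) by (unfold h; cont).
  assert (Ph : forall x, 0 <= h x) by (intros; apply pot_pos; lra).
  assert (Ep : forall b, 0 <= b -> Int h 0 b <= m + 1).
  { intros b Hb; apply Rle_trans with (Int h (- (b + 1)) (b + 1)); [apply int_mono; auto; lra|].
    apply E; lra. }
  assert (Em : forall b, 0 <= b -> Int (fun x => h (- x)) 0 b <= m + 1).
  { intros b Hb; rewrite int_reflect by auto.
    apply Rle_trans with (Int h (- (b + 1)) (b + 1)); [apply int_mono; auto; lra|].
    apply E; lra. }
  destruct (well_limit g M (m + 1) A B Hg LA LB B0 Ep) as (a1 & b1 & [[W1 ->]|[-> ->]] & L1).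
  { exfalso; apply (right_end_not_A eps g M m a1 p A B); auto. }
  destruct (well_limit g M (m + 1) (fun x => A (- x)) (fun x => B (- x)) Hg) as (a & b & W & L2); auto;
    [now apply Mod_comp_opp|now apply Mod_comp_opp|].
  destruct W as [[W ->]|[-> ->]].
  2: { exfalso; apply (left_end_not_B eps g M m p A B); auto. }
  assert (Ea : a * a = 1) by (destruct W as [-> | ->]; ring).
  pose proof (limit_equation_A eps g M m p A B He ltac:(lra) H) as QA.
  pose proof (limit_equation_B eps g M m p A B He ltac:(lra) H) as QB.
  set (A' := fun x => a * A x).
  assert (QA' : chain 4 A' (fun x => - 1 * potA g (A' x) (B x))).
  { apply (chain_ext 4 (fun x => a * (- 1 * potA g (A x) (B x)))); [|now apply chain_scal].
    intros x; unfold potA, A'.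
    replace (a * A x * (a * A x)) with (a * a * (A x * A x)) by ring; rewrite Ea; ring. }
  assert (QB' : chain 2 B (fun x => eps ^ 2 * potB g (A' x) (B x))).
  { apply (chain_ext 2 (fun x => eps ^ 2 * potB g (A x) (B x))); auto.
    intros x; unfold potB, A'.
    replace (a * A x * (a * A x)) with (a * a * (A x * A x)) by ring; rewrite Ea; ring. }
  assert (Na : Rabs a = 1) by (destruct W as [-> | ->]; unfold Rabs; destruct Rcase_abs; lra).
  destruct (bootstrap g (- 1) (eps ^ 2) A' B QA' QB') as [SA SB].
  exists A', B; split; [|split; [exact B0|]].
  - split; [exact SA|]; split; [exact SB|]; split; [now apply chains_solve|split].
    + apply filterlim_minus; intros e Pe; destruct (L2 e Pe) as (r & Pr & Hr).
      exists r; split; auto; intros x Hx; destruct (Hr x Hx) as [U V]; split; auto.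
      unfold A'; replace (a * A (- x) - 1) with (a * (A (- x) - a)) by (rewrite <- Ea; ring).
      rewrite Rabs_mult, Na; lra.
    + apply filterlim_plus; intros e Pe; destruct (L1 e Pe) as (r & Pr & Hr).
      exists r; split; auto; intros x Hx; destruct (Hr x Hx) as [U V]; split; auto.
      unfold A'; replace (a * A x - 0) with (a * (A x - 0)) by ring.
      rewrite Rabs_mult, Na; lra.
  - intros s K K' Small HK (q & Aq & Mq) x.
    assert (LK : m < K) by (apply Rle_lt_trans with K'; auto; now apply (min_low _ _ _ _ _ _ _ H q)).
    destruct (small_defect (K - m) ltac:(lra)) as [N HN].
    assert (EA : sphere_defect A' B x = sphere_defect A B x).
    { unfold sphere_defect, A'; rewrite Rpow_mult_distr.
      replace (a ^ 2) with (a * a) by ring; now rewrite Ea, Rmult_1_l. }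
    rewrite EA.
    apply (Un_cv_le (fun n => sphere_defect (pA (p n)) (pB (p n)) x) _ s N).
    + apply (sphere_defect_cv (fun n => pA (p n)) (fun n => pB (p n))); apply H.
    + intros n Hn; apply Small; [apply H|].
      apply (mass_le_weaken _ (m + (/ (INR n + 1)) ^ 2)); [specialize (HN n Hn); lra|apply H].
Qed.

(** One point with defect above [s] would cost [kappa] by [Mod_integral_gap], so [K = kappa / 2]
    excludes it. The cap 1 on [K] fixes [M] before [kappa] is known, and neither depends on [g]. *)
Lemma low_energy_near_sphere (eps s : R) : 0 < eps -> 0 < s -> exists K, 0 < K /\
  forall g p, 1 <= g -> regular p -> mass_le (dens eps g p) K ->
  forall x, sphere_defect (pA p) (pB p) x <= s.
Proof.
  intros He Hs.
  destruct (a_priori eps 1 He) as (M & PM & HM).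
  destruct (Mod_sphere M) as [D HD].
  destruct (Mod_integral_gap D (s ^ 2 / 4)) as (kappa & Pk & Gap); [nra|].
  exists (Rmin 1 (kappa / 2)); split; [apply Rmin_glb_lt; lra|].
  intros g p Hg Rp H x.
  pose proof (Rmin_l 1 (kappa / 2)); pose proof (Rmin_r 1 (kappa / 2)).
  destruct (HM g p Hg Rp) as (MA & _ & MB); [now apply (mass_le_weaken _ _ 1) in H|].
  apply Rnot_lt_le; intros L; unfold sphere_defect in L.
  specialize (Gap _ (HD _ _ MA MB)).
  assert (kappa <= Int (fun y => (pA p y ^ 2 + pB p y ^ 2 - 1) ^ 2 / 4) x (x + 1)).
  { apply Gap.
    - intros y; pose proof (pow2_ge_0 (pA p y ^ 2 + pB p y ^ 2 - 1)); lra.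
    - rewrite <- (pow2_abs (pA p x ^ 2 + pB p x ^ 2 - 1)); nra. }
  specialize (H x (x + 1) ltac:(lra)).
  assert (Int (fun y => (pA p y ^ 2 + pB p y ^ 2 - 1) ^ 2 / 4) x (x + 1)
    <= Int (dens eps g p) x (x + 1)).
  { apply int_le; cont; [lra|]; intros y _.
    eapply Rle_trans; [now apply (pot_ge g)|now apply pot_le_dens]. }
  lra.
Qed.

(** [L] is fixed first, so that the derivative cost [C / L] is at most [K / 2]; only then is [g - 1]
    made small enough for the potential cost over that length. *)
Lemma low_energy_exists (eps K : R) : 0 < eps -> 0 < K -> exists d, 0 < d /\
  forall g, 1 < g < 1 + d -> exists p, admissible p /\ mass_le (dens eps g p) K.
Proof.
  intros He HK; destruct (trial eps He) as (C & PC & HT).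
  set (L := 1 + 2 * C / K).
  assert (P : 0 < 2 * C / K) by (apply Rdiv_lt_0_compat; lra).
  assert (PL : 1 <= L) by (unfold L; lra).
  assert (E : C / L <= K / 2).
  { apply (Rmult_le_reg_r L); [lra|].
    replace (C / L * L) with C by (field; lra).
    replace (K / 2 * L) with (K / 2 + C) by (unfold L; field; lra); lra. }
  exists (K / (6 * L)); split; [apply Rdiv_lt_0_compat; lra|]; intros g Hg.
  destruct (HT g L ltac:(lra) PL) as (p & Ap & Mp); exists p; split; auto.
  apply (mass_le_weaken _ (C / L + 3 * (g - 1) * L)); auto.
  assert (3 * (g - 1) * L <= K / 2); [|lra].
  replace (K / 2) with (3 * (K / (6 * L)) * L) by (field; lra).
  apply Rmult_le_compat_r; lra.
Qed.

Lemma sup_line_small (f : R -> R) (s : R) : (forall x, 0 <= f x <= s) ->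
  is_finite (sup_line f) /\ 0 <= real (sup_line f) <= s.
Proof.
  intros H; unfold sup_line.
  destruct (Lub_Rbar_correct (fun y => exists x, y = f x)) as [U L].
  assert (L1 : Rbar_le (Lub_Rbar (fun y => exists x, y = f x)) s).
  { apply L; intros y [x ->]; apply H. }
  assert (L2 : Rbar_le (f 0) (Lub_Rbar (fun y => exists x, y = f x))).
  { apply U; now exists 0. }
  specialize (H 0).
  destruct (Lub_Rbar (fun y => exists x, y = f x)) as [l| |]; simpl in *; try tauto.
  split; [reflexivity|lra].
Qed.

Theorem theorem1 :
  exists A B : R -> R -> R -> R,
    (forall eps g : R, 0 < eps -> 1 < g ->
       smooth_heteroclinic_solution eps g (A eps g) (B eps g)) /\
    (forall eps g : R, 0 < eps -> 1 < g ->
       forall x : R, 0 <= B eps g x) /\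
    (forall eps : R, 0 < eps ->
       lim_one_right
         (fun g : R =>
            sup_line (fun x : R => Rabs (A eps g x ^ 2 + B eps g x ^ 2 - 1)))
         0).
Proof.
  (* Choice over pairs [(eps, g)] makes a single family, whose members carry the clause on the
     sphere defect along. *)
  destruct (functional_choice (fun (eg : R * R) (AB : (R -> R) * (R -> R)) =>
    0 < fst eg -> 1 < snd eg ->
    smooth_heteroclinic_solution (fst eg) (snd eg) (fst AB) (snd AB) /\
    (forall x, 0 <= snd AB x) /\
    forall s K K', (forall p, regular p -> mass_le (dens (fst eg) (snd eg) p) K ->
        forall x, sphere_defect (pA p) (pB p) x <= s) ->
      K' < K -> (exists p, admissible p /\ mass_le (dens (fst eg) (snd eg) p) K') ->
      forall x, sphere_defect (fst AB) (snd AB) x <= s)) as [F HF].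
  { intros [eps g]; simpl.
    destruct (classic (0 < eps /\ 1 < g)) as [[He Hg]|N].
    - destruct (heteroclinic eps g He Hg) as (A & B & P); exists (A, B); auto.
    (* Default value outside the parameter range, where the implication is vacuous. *)
    - exists (fun _ => 0, fun _ => 0); tauto. }
  exists (fun eps g => fst (F (eps, g))), (fun eps g => snd (F (eps, g))).
  split; [|split].
  - intros eps g He Hg; apply (HF (eps, g) He Hg).
  - intros eps g He Hg; apply (HF (eps, g) He Hg).
  - intros eps He.
    assert (Q : forall s, 0 < s -> exists d, 0 < d /\ forall g, 1 < g < 1 + d ->
      forall x, 0 <= sphere_defect (fst (F (eps, g))) (snd (F (eps, g))) x <= s).
    { intros s Hs; destruct (low_energy_near_sphere eps s He Hs) as (K & PK & Near).
      (* Trial energy [K / 2], because the clause of [heteroclinic] asks for a level strictly below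
         [K]. *)
      destruct (low_energy_exists eps (K / 2) He ltac:(lra)) as (d & Pd & Low).
      exists d; split; auto; intros g Hg x; split; [apply Rabs_pos|].
      destruct (HF (eps, g) He (proj1 Hg)) as (_ & _ & Small).
      apply (Small s K (K / 2)); simpl; [|lra|auto].
      intros p; apply Near; lra. }
    assert (T : forall s, 0 < s -> at_right 1 (fun g => is_finite (sup_line
        (sphere_defect (fst (F (eps, g))) (snd (F (eps, g)))))
      /\ 0 <= real (sup_line (sphere_defect (fst (F (eps, g))) (snd (F (eps, g))))) <= s)).
    { intros s Hs; destruct (Q s Hs) as (d & Pd & Hd).
      exists (mkposreal d Pd); intros g Bg Hg; apply sup_line_small, Hd.
      change (Rabs (g - 1) < d) in Bg; apply Rabs_lt_between in Bg; lra. }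
    split.
    + apply (filter_imp _ _ (fun g H => proj1 H) (T 1 Rlt_0_1)).
    + intros P [e HP]; pose proof (cond_pos e).
      apply (filter_imp _ _) with (2 := T (e / 2) ltac:(lra)).
      intros g [_ Hg]; apply HP.
      change (Rabs (real (sup_line (sphere_defect (fst (F (eps, g))) (snd (F (eps, g))))) - 0) < e).
      rewrite Rminus_0_r, Rabs_right; lra.
Qed.
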